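(* Let $a$ satisfy (A1)-(A4) and $\sigma$ satisfy (S1)-(S3) with sequence $\delta$ (conditions listed in the context), and let $X$ be the solution of $$\mathrm{d}X(t)=a(t,X(t))\,\mathrm{d}t+\sigma(t)\,\mathrm{d}W(t),\quad t\in[0,T],\qquad X(0)=x_0 .$$ Fix $\bar M=(M_n^* )_{n=1}^\infty\in\mathcal{G}_\delta$ and let $X^{Eq*}_{M_n^*,n}$ be the output of the truncated dimension Euler scheme based on the equidistant mesh with $n$ subintervals. Then $$\big(\operatorname{cost}(X^{Eq*}_{M_n^*,n})\big)^{1/2}\,\big\|X-X^{Eq*}_{M_n^*,n}\big\|_2\ \approx\ \sqrt{\frac{M_n^*T}{6}}\left(\int_0^T\|\sigma(t)\|_{\ell^2}^2\,\mathrm{d}t\right)^{1/2},\qquad n\to+\infty .$$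
   Context: Setting. $T>0$, $x_0\in\mathbb{R}$. $(\Omega,\Sigma,\mathbb{P})$ is a complete probability space with a filtration $(\Sigma_t)_{t\ge0}$ satisfying the usual conditions, and $W=[W_1,W_2,\ldots]^T$ is a sequence of independent scalar $(\Sigma_t)$-Wiener processes; $\int\sigma\,\mathrm{d}W=\sum_k\int\sigma_k\,\mathrm{d}W_k$. $\ell^2=\ell^2(\mathbb{R})$. Sequence $\delta$. $\delta=(\delta(k))_{k\ge1}$ is a positive, strictly decreasing real sequence with limit $0$. $\mathcal{G}_\delta$ is the set of all non-decreasing sequences $G=(G(n))_{n\ge1}\subset\mathbb{N}$ with $G(n)\to+\infty$ and $\lim_{n\to\infty}n^{1/2}\delta(G(n))=0$. Drift. $a\in\mathcal{C}^{1,2}([0,T]\times\mathbb{R})$ is real valued and for some $C_1>0$: (A1) $|a(t,x)-a(s,x)|\le C_1(1+|x|)|t-s|$ for all $t,s\in[0,T]$, $x\in\mathbb{R}$; (A2) $|a(t,0)|\le C_1$ for all $t\in[0,T]$; (A3) $|a(t,x)-a(t,y)|\le C_1|x-y|$ for all $x,y\in\mathbb{R}$, $t\in[0,T]$; (A4) $|\frac{\partial a}{\partial x}(t,x)-\frac{\partial a}{\partial x}(t,y)|\le C_1|x-y|$ for all $t\in[0,T]$, $x,y\in\mathbb{R}$. Diffusion. $\sigma=(\sigma_1,\sigma_2,\ldots):[0,T]\to\ell^2$ and for some $C_2>0$: (S1) $\|\sigma(0)\|_{\ell^2}\le C_2$; (S2) $\|\sigma(t)-\sigma(s)\|_{\ell^2}\le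 C_2|t-s|$ for all $t,s\in[0,T]$; (S3) $\|\sigma(t)-P_k\sigma(t)\|_{\ell^2}\le C_2\delta(k)$ for all $k\in\mathbb{N}$, $t\in[0,T]$, where $P_kv=(v_1,\ldots,v_k,0,0,\ldots)$. Write $\sigma^M=P_M\sigma$. Algorithm. For $n\in\mathbb{N}$ let $t_j=Tj/n$, $j=0,\ldots,n$, $Y(0)=x_0$ and $Y(t_{j+1})=Y(t_j)+a(t_j,Y(t_j))(t_{j+1}-t_j)+\sigma^{M_n^*}(t_j)(W(t_{j+1})-W(t_j))$, $j=0,\ldots,n-1$. The process $X^{Eq*}_{M_n^*,n}$ on $[0,T]$ is the piecewise linear interpolation of the values $Y(t_j)$. Cost and error. $\operatorname{cost}(X^{Eq*}_{M_n^*,n})=M_n^*n$ if $\sigma\not\equiv0$, and $=0$ if $\sigma\equiv0$ (number of evaluations of scalar Wiener processes). $\|X-Y\|_2=\left(\mathbb{E}\int_0^T|X(t)-Y(t)|^2\,\mathrm{d}t\right)^{1/2}$. Asymptotic notation. $a_n\approx b_n$, $n\to+\infty$, means $\lim_{n\to\infty}a_n/b_n=1$, with the convention $0/0=1$ (used only in the trivial case $\sigma\equiv0$). *)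

(* Defs.v *)
From HB Require Import structures.
From mathcomp Require Import all_boot all_order all_algebra finmap.
From mathcomp Require Import all_classical all_reals all_analysis.

Set Implicit Arguments.
Unset Strict Implicit.
Unset Printing Implicit Defensive.

Import Order.TTheory GRing.Theory Num.Theory.
Import numFieldNormedType.Exports.

Local Open Scope classical_set_scope.
Local Open Scope ring_scope.

(* Components of an element of l^2 and the Wiener processes are indexed from 0:
   [v i] is the (i+1)-st component and [W i] the (i+1)-st Wiener process.
   Truncation levels, [delta] and the sequences in [G_class] keep the indexing
   from 1; their values at 0 are irrelevant. *)

Section sequences_and_coefficients.
Context {R : realType}.

Definition l2norm (v : nat -> R) : \bar R :=
  'N[@counting nat R]_2%:E[EFin \o v]%E.

Definition l2proj (k : nat) (v : nat -> R) : nat -> R :=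
  fun i => if (i < k)%N then v i else 0.

Definition delta_seq (delta : nat -> R) : Prop :=
  [/\ forall k, (0 < k)%N -> 0 < delta k,
      forall k l, (0 < k)%N -> (k < l)%N -> delta l < delta k
    & delta k @[k --> \oo] --> (0 : R)].

Definition G_class (delta : nat -> R) : set (nat -> nat) :=
  [set G | [/\ forall n, (0 < n)%N -> (0 < G n)%N,
               forall m n, (0 < m)%N -> (m <= n)%N -> (G m <= G n)%N,
               G n @[n --> \oo] --> \oo
             & Num.sqrt n%:R * delta (G n) @[n --> \oo] --> (0 : R)]].

(* C^{1,2}([0,T] x R); the time derivative is one-sided at 0 and T. *)
Definition C12 (T : R) (a : R -> R -> R) : Prop :=
  let cont (f : R -> R -> R) :=
    {within `[0, T] `*` [set: R], continuous (fun p : R * R => f p.1 p.2)} in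
  [/\ cont a,
      exists at_ : R -> R -> R, cont at_ /\
        forall t x : R, t \in `[0, T] ->
          (a s x - a t x) / (s - t) @[s --> within `[0, T] t^'] --> at_ t x,
      (forall t x : R, t \in `[0, T] -> derivable (a t) x 1) /\
        cont (fun t x => derive1 (a t) x)
    & (forall t x : R, t \in `[0, T] -> derivable (derive1 (a t)) x 1) /\
        cont (fun t x => derive1 (derive1 (a t)) x)].

Record drift_conditions (T C1 : R) (a : R -> R -> R) : Prop := {
  drift_C12 : C12 T a ;
  drift_time : forall t s x : R, t \in `[0, T] -> s \in `[0, T] ->
    `|a t x - a s x| <= C1 * (1 + `|x|) * `|t - s| ;
  drift_bound : forall t : R, t \in `[0, T] -> `|a t 0| <= C1 ;
  drift_lipschitz : forall t x y : R, t \in `[0, T] ->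
    `|a t x - a t y| <= C1 * `|x - y| ;
  drift_derivative_lipschitz : forall t x y : R, t \in `[0, T] ->
    `|derive1 (a t) x - derive1 (a t) y| <= C1 * `|x - y| }.

Record diffusion_conditions (T C2 : R) (delta : nat -> R)
    (sigma : R -> nat -> R) : Prop := {
  diffusion_l2 : forall t : R, t \in `[0, T] -> (l2norm (sigma t) < +oo)%E ;
  diffusion_init : (l2norm (sigma 0%R) <= C2%:E)%E ;
  diffusion_lipschitz : forall t s : R, t \in `[0, T] -> s \in `[0, T] ->
    (l2norm (fun i => sigma t i - sigma s i)%R <= (C2 * `|t - s|)%:E)%E ;
  diffusion_tail : forall (k : nat) (t : R), (0 < k)%N -> t \in `[0, T] ->
    (l2norm (fun i => sigma t i - l2proj k (sigma t) i)%R
       <= (C2 * delta k)%:E)%E }.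

End sequences_and_coefficients.

Section stochastic_setting.
Context {d : measure_display} {Omega : measurableType d} {R : realType}.
Variable P : probability Omega R.

Record filtration_usual (F : R -> set (set Omega)) : Prop := {
  filtration_sigma : forall t : R, 0 <= t -> sigma_algebra setT (F t) ;
  filtration_sub : forall t : R, 0 <= t -> F t `<=` measurable ;
  filtration_mono : forall s t : R, 0 <= s -> s <= t -> F s `<=` F t ;
  filtration_right : forall t : R, 0 <= t ->
    \bigcap_(s in [set s | t < s]) F s `<=` F t ;
  filtration_null : forall A, P.-negligible A -> F 0 A }.

Definition adapted_at (F : R -> set (set Omega)) (X : R -> Omega -> R) (t : R) :=
  forall B : set R, measurable B -> F t (X t @^-1` B).

Record wiener_process (F : R -> set (set Omega)) (W : R -> Omega -> R)
  : Prop := {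
  wiener_adapted : forall t : R, 0 <= t -> adapted_at F W t ;
  wiener_init : {ae P, forall w, W 0 w = 0} ;
  wiener_continuous :
    {ae P, forall w, {within `[0, +oo[, continuous (W ^~ w)}} ;
  wiener_normal : forall (s t : R) (B : set R), 0 <= s -> s < t -> measurable B ->
    P ((fun w => (W t w - W s w)%R) @^-1` B)
      = normal_prob 0 (Num.sqrt (t - s)) B ;
  wiener_independent : forall (s t : R) (A : set Omega) (B : set R), 0 <= s -> s < t -> F s A ->
    measurable B ->
    P (A `&` (fun w => (W t w - W s w)%R) @^-1` B)
      = (P A * P ((fun w => (W t w - W s w)%R) @^-1` B))%E }.

Definition process_sigma (W : R -> Omega -> R) : set (set Omega) :=
  <<s [set A | exists (t : R) (B : set R),
         [/\ 0 <= t, measurable B & A = W t @^-1` B]] >>.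

Definition independent_processes (W : nat -> R -> Omega -> R) : Prop :=
  forall (J : {fset nat}) (A : nat -> set Omega),
    (forall k, k \in J -> process_sigma (W k) (A k)) ->
    P (\bigcap_(k in [set` J]) A k) = (\prod_(k <- J) P (A k))%E.

(* A list of triples (c, u, v) encodes the step function
   \sum c 1_{]u, v]}, whose integral against W is \sum c (W(v) - W(u)). *)
Definition step_fun (l : seq (R * R * R)) (s : R) : R :=
  \sum_(p <- l) p.1.1 * \1_(`]p.1.2, p.2] : set R) s.

Definition step_integral (W : R -> Omega -> R) (l : seq (R * R * R))
    (w : Omega) : R :=
  \sum_(p <- l) p.1.1 * (W p.2 w - W p.1.2 w).

(* I is (a version of) the stochastic integral \int_0^t f dW of a deterministic
   f : it is the mean-square limit of the integrals of step functions that
   converge to f in L^2([0, t]). *)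
Definition is_stoch_integral (W : R -> Omega -> R) (f : R -> R) (t : R)
    (I : Omega -> R) : Prop :=
  measurable_fun setT I /\
  exists phi : nat -> seq (R * R * R),
    [/\ forall n, all (fun p => (0 <= p.1.2) && (p.1.2 <= p.2 <= t)) (phi n),
        (\int[lebesgue_measure]_(s in `[0%R, t])
           ((f s - step_fun (phi n) s) ^+ 2)%:E)%E @[n --> \oo] --> 0%E
      & 'E_P[fun w => ((I w - step_integral W (phi n) w) ^+ 2)%R]%E
          @[n --> \oo] --> 0%E].

(* \int_0^t sigma dW = \sum_k \int_0^t sigma_k dW_k, in mean square. *)
Definition is_stoch_integral_seq (W : nat -> R -> Omega -> R)
    (sigma : R -> nat -> R) (t : R) (I : Omega -> R) : Prop :=
  measurable_fun setT I /\
  exists J : nat -> Omega -> R,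
    (forall k, is_stoch_integral (W k) (fun s => sigma s k) t (J k)) /\
    'E_P[fun w => ((I w - \sum_(k < m) J k w) ^+ 2)%R]%E @[m --> \oo] --> 0%E.

Record sde_solution (F : R -> set (set Omega)) (W : nat -> R -> Omega -> R)
    (T x0 : R) (a : R -> R -> R) (sigma : R -> nat -> R) (X : R -> Omega -> R)
  : Prop := {
  sde_adapted : forall t : R, t \in `[0, T] -> adapted_at F X t ;
  sde_continuous : {ae P, forall w, {within `[0, T], continuous (X ^~ w)}} ;
  sde_init : {ae P, forall w, X 0 w = x0} ;
  sde_equation : forall t : R, t \in `[0, T] ->
    exists2 I, is_stoch_integral_seq W sigma t I &
      {ae P, forall w, X t w =
        x0 + \int[lebesgue_measure]_(s in `[0, t]) a s (X s w) + I w} }.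

Definition dist2 (T : R) (X Y : R -> Omega -> R) : \bar R :=
  sqrte (\int[P]_w \int[lebesgue_measure]_(t in `[0%R, T])
           (`|X t w - Y t w| ^+ 2)%:E)%E.

End stochastic_setting.

Section scheme.
Context {Omega : Type} {R : realType}.

Definition mesh (T : R) (n j : nat) : R := T * j%:R / n%:R.

Fixpoint euler (T x0 : R) (a : R -> R -> R) (sigma : R -> nat -> R)
    (W : nat -> R -> Omega -> R) (M n j : nat) (w : Omega) : R :=
  if j is i.+1 then
    let y := euler T x0 a sigma W M n i w in
    let t := mesh T n i in
    let t' := mesh T n i.+1 in
    y + a t y * (t' - t) + \sum_(k < M) sigma t k * (W k t' w - W k t w)
  else x0.

(* On [t_j, t_{j+1}] the interpolation is affine; the index j is capped at
   n - 1 so that t = T belongs to the last subinterval. *)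
Definition euler_interp (T x0 : R) (a : R -> R -> R) (sigma : R -> nat -> R)
    (W : nat -> R -> Omega -> R) (M n : nat) (t : R) (w : Omega) : R :=
  let j := minn (Num.truncn (t * n%:R / T)) n.-1 in
  let Y := euler T x0 a sigma W M n in
  Y j w + (t - mesh T n j) / (mesh T n j.+1 - mesh T n j)
            * (Y j.+1 w - Y j w).

Definition cost (T : R) (sigma : R -> nat -> R) (M n : nat) : R :=
  if `[< forall (t : R) (k : nat), t \in `[0, T] -> sigma t k = 0 >] then 0 else (M * n)%:R.

(* a_n ~ b_n, with the convention 0/0 = 1. *)
Definition asymp_equiv (u v : nat -> \bar R) : Prop :=
  (if (u n == 0) && (v n == 0) then 1 else u n / v n)%E @[n --> \oo] --> 1%E.

End scheme.

(* Main.v *)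
Require Import Defs.
From HB Require Import structures.
From mathcomp Require Import all_boot all_order all_algebra finmap.
From mathcomp Require Import all_classical all_reals all_analysis.
From mathcomp Require Import measurable_realfun ring lra.

Set Implicit Arguments.
Unset Strict Implicit.
Unset Printing Implicit Defensive.

Import Order.TTheory GRing.Theory Num.Theory.
Import numFieldNormedType.Exports.

Local Open Scope classical_set_scope.
Local Open Scope ring_scope.


(** Let $h=T/n$ and let $\tilde X$ be the time-continuous Euler process [euler_cont],
   which follows the frozen coefficients between the mesh points, so that the scheme is
   its piecewise linear interpolation. The error splits as

   $X - X^{Eq} = (X-\tilde X) + (\tilde X - X^{Eq}).$

   The second term carries the limit. On a cell $[t_j,t_{j+1}]$ the drift cancels and a
   Brownian bridge remains, with variance
   $c_j (t-t_j)(t_{j+1}-t)/h$, where $c_j=\sum_{k<M}\sigma_k(t_j)^2$ ([bridge_L2]).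
   Integration gives $\frac{h^2}{6}\sum_j c_j$ ([interpolation_error]), and $h\sum_j c_j$
   is a Riemann sum of $\|\sigma\|^2$ ([trunc_norm2_riemann]). Hence $n$ times the mean
   square of the second term tends to $\frac{T}{6}\int_0^T\|\sigma\|^2$.

   The first term is negligible: $n\,E\int_0^T|X-\tilde X|^2\to 0$. By Gronwall
   ([gronwall_L2]) it suffices to estimate the terms that do not come from the Lipschitz
   dependence of the drift. The error of the stochastic integral is controlled by the
   isometry, with a bound of order $h^2+\delta(M_n)^2$ ([stoch_integral_seq_error],
   [sigma_step_error]); this is $o(1/n)$ because $n\,\delta(M_n)^2\to0$. The drift error
   $a(s,\tilde X_s)-a(t_j,\tilde X_{t_j})$ has size $h^{1/2}$, which is not sufficient by
   itself. Its main part $\partial_x a(t_j,\tilde X_{t_j})\,\sum_k\sigma_k(t_j)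
   (W_k(s)-W_k(t_j))$ is orthogonal over different cells, so its time integral has mean
   square of order $h^2$ ([time_int_lin_part]). The remainder is quadratic in the noise
   of the first $K$ components and linear in that of the others, which gives mean squares
   of order $h^2+h\,\delta(K)^2$ with a constant depending on $K$ in front of $h^2$
   ([rem_part_L2]). One first lets $n\to\infty$ and then $K\to\infty$.

   Almost sure path properties are replaced by sure ones by modifying all processes on a
   common null set ([continuous_modification]). Of the modified driving processes one keeps
   the structure [noise]: adapted processes whose increments are orthogonal to the past and
   across components, with variance equal to the elapsed time and bounded fourth moments. *)


(** * Square-integrable functions *)

Section square_integrable.
Context d (T : measurableType d) (R : realType).
Variable mu : {measure set T -> \bar R}.
Variable D : set T.
Hypothesis mD : measurable D.
Implicit Types f g h : T -> R.

Definition sqint f : Prop :=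
  measurable_fun D f /\ (\int[mu]_(x in D) ((f x) ^+ 2)%:E < +oo)%E.

(** Real-valued, so that the inner-product algebra below is carried out in a field;
   it is meaningful on [sqint] functions. *)
Definition ip f g : R := \int[mu]_(x in D) (f x * g x).

Lemma sqint_meas f : sqint f -> measurable_fun D f. Proof. by case. Qed.

Lemma measurable_sqE f : measurable_fun D f ->
  measurable_fun D (EFin \o (fun x => (f x) ^+ 2)).
Proof. by move=> mf; apply/measurable_EFinP; exact: measurable_funX. Qed.

Lemma ge0_integral_sq f : (0 <= \int[mu]_(x in D) ((f x) ^+ 2)%:E)%E.
Proof. by apply: integral_ge0 => x _; rewrite lee_fin sqr_ge0. Qed.

Lemma sqint_le f g : measurable_fun D f ->
  (forall x, D x -> `|f x| <= `|g x|) -> sqint g -> sqint f.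
Proof.
move=> mf fg [mg gi]; split=> //; apply: le_lt_trans gi.
apply: ge0_le_integral => //; [by move=> *; rewrite lee_fin sqr_ge0|exact: measurable_sqE
  |exact: measurable_sqE|].
move=> x Dx; rewrite lee_fin -(real_normK (num_real (f x))) -(real_normK (num_real (g x))).
by rewrite lerXn2r ?nnegrE ?fg.
Qed.

Lemma sqintD f g : sqint f -> sqint g -> sqint (fun x => f x + g x).
Proof.
move=> [mf fi] [mg gi]; split; first exact: measurable_funD.
apply: (@le_lt_trans _ _
  (\int[mu]_(x in D) ((2 * (f x) ^+ 2)%:E + (2 * (g x) ^+ 2)%:E))%E).
  apply: ge0_le_integral => //.
  - by move=> *; rewrite lee_fin sqr_ge0.
  - by apply: measurable_sqE; exact: measurable_funD.
  - by apply: emeasurable_funD; apply/measurable_EFinP/measurable_funM => //;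
      exact: measurable_funX.
  - move=> x Dx; rewrite -EFinD lee_fin.
    have := sqr_ge0 (f x - g x); rewrite !expr2; nra.
rewrite ge0_integralD //.
- under eq_integral do rewrite EFinM.
  under [X in (_ + X)%E]eq_integral do rewrite EFinM.
  rewrite !ge0_integralZl_EFin //; try exact: measurable_sqE;
    try by move=> *; rewrite lee_fin sqr_ge0.
  by rewrite lte_add_pinfty // lte_mul_pinfty // ?lee_fin.
- by move=> *; rewrite lee_fin mulr_ge0 // sqr_ge0.
- by apply/measurable_EFinP/measurable_funM => //; exact: measurable_funX.
- by move=> *; rewrite lee_fin mulr_ge0 // sqr_ge0.
- by apply/measurable_EFinP/measurable_funM => //; exact: measurable_funX.
Qed.

Lemma sqint0 : sqint (fun _ => 0).
Proof.
split; first exact: measurable_cst.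
by rewrite (eq_integral (cst 0%E)) ?integral0 ?ltry // => x _; rewrite expr0n.
Qed.

Lemma sqintZ c f : sqint f -> sqint (fun x => c * f x).
Proof.
move=> [mf fi]; split; first exact: measurable_funM.
under eq_integral do rewrite exprMn EFinM.
rewrite ge0_integralZl_EFin ?sqr_ge0 //; last 2 first.
  by move=> *; rewrite lee_fin sqr_ge0.
  exact: measurable_sqE.
by rewrite lte_mul_pinfty ?lee_fin ?sqr_ge0.
Qed.

Lemma sqintN f : sqint f -> sqint (fun x => - f x).
Proof.
move=> /(sqintZ (-1)); congr sqint.
by apply/funext => x; rewrite mulN1r.
Qed.

Lemma sqintB f g : sqint f -> sqint g -> sqint (fun x => f x - g x).
Proof. by move=> fi gi; exact: sqintD fi (sqintN gi). Qed.

Lemma sqint_sum (I : eqType) (s : seq I) (f : I -> T -> R) :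
  (forall i, i \in s -> sqint (f i)) -> sqint (fun x => \sum_(i <- s) f i x).
Proof.
elim: s => [|i s IH] H.
  by under eq_fun do rewrite big_nil; exact: sqint0.
under eq_fun do rewrite big_cons.
apply: sqintD; first by apply: H; rewrite mem_head.
by apply: IH => j js; apply: H; rewrite inE js orbT.
Qed.

Lemma sqint_sum_ord n (f : nat -> T -> R) :
  (forall i, (i < n)%N -> sqint (f i)) -> sqint (fun x => \sum_(i < n) f i x).
Proof.
move=> H; under eq_fun do rewrite -(big_mkord xpredT (fun i => f i _)).
by apply: sqint_sum => i; rewrite mem_index_iota => /andP[_]; exact: H.
Qed.

Lemma sqint_bounded_mul (c : R) (b f : T -> R) : measurable_fun D b ->
  (forall x, D x -> `|b x| <= c) -> sqint f -> sqint (fun x => b x * f x).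
Proof.
move=> mb bc fi; apply: (@sqint_le _ (fun x => c * f x)); last exact: sqintZ.
  by apply: measurable_funM => //; case: fi.
by move=> x Dx; rewrite !normrM ler_wpM2r // (le_trans (bc _ Dx)) // ler_norm.
Qed.

Lemma sqint_cst c : (mu D < +oo)%E -> sqint (fun _ => c).
Proof.
move=> Doo; split; first exact: measurable_cst.
by rewrite integral_cst // lte_mul_pinfty // lee_fin sqr_ge0.
Qed.

Lemma integrable_sq f : sqint f -> mu.-integrable D (EFin \o (fun x => (f x) ^+ 2)).
Proof.
move=> [mf fi]; apply/integrableP; split; first exact: measurable_sqE.
by under eq_integral do rewrite /= ger0_norm ?sqr_ge0 //.
Qed.

Lemma integrable_mul f g : sqint f -> sqint g ->
  mu.-integrable D (EFin \o (fun x => f x * g x)).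
Proof.
move=> fi gi.
have := integrableD mD (integrable_sq fi) (integrable_sq gi).
apply: le_integrable => //.
  by apply/measurable_EFinP/measurable_funM; [case: fi|case: gi].
move=> x _; rewrite /= lee_fin normrM.
rewrite [leRHS]ger0_norm ?addr_ge0 ?sqr_ge0 //.
have := sqr_ge0 (`|f x| - `|g x|).
rewrite -(real_normK (num_real (f x))) -(real_normK (num_real (g x))).
have := normr_ge0 (f x); have := normr_ge0 (g x); nra.
Qed.

Lemma ipE f g : sqint f -> sqint g ->
  (\int[mu]_(x in D) (f x * g x)%:E)%E = (ip f g)%:E.
Proof.
by move=> fi gi; rewrite /ip /Rintegral fineK // integrable_fin_num // integrable_mul.
Qed.

Lemma ip_sqE f : sqint f -> (\int[mu]_(x in D) ((f x) ^+ 2)%:E)%E = (ip f f)%:E.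
Proof. by move=> fi; rewrite -ipE //; apply: eq_integral => x _; rewrite expr2. Qed.

Lemma ipC f g : ip f g = ip g f.
Proof. by apply: eq_Rintegral => x _; rewrite mulrC. Qed.

Lemma ip_ge0 f : 0 <= ip f f.
Proof. by apply: Rintegral_ge0 => x _; rewrite -expr2 sqr_ge0. Qed.

Lemma eq_ip f g f' g' : (forall x, D x -> f x = f' x) -> (forall x, D x -> g x = g' x) ->
  ip f g = ip f' g'.
Proof. by move=> e1 e2; apply: eq_Rintegral => x /set_mem Dx; rewrite e1 ?e2. Qed.

Lemma ipDl f g h : sqint f -> sqint g -> sqint h ->
  ip (fun x => f x + g x) h = ip f h + ip g h.
Proof.
move=> fi gi hi; rewrite /ip -RintegralD //; try exact: integrable_mul.
by apply: eq_Rintegral => x _; rewrite mulrDl.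
Qed.

Lemma ipDr f g h : sqint f -> sqint g -> sqint h ->
  ip h (fun x => f x + g x) = ip h f + ip h g.
Proof. by move=> *; rewrite ipC ipDl // ![ip _ h]ipC. Qed.

Lemma ipZl c f h : sqint f -> sqint h -> ip (fun x => c * f x) h = c * ip f h.
Proof.
move=> fi hi; rewrite /ip -RintegralZl //; last exact: integrable_mul.
by apply: eq_Rintegral => x _; rewrite mulrA.
Qed.

Lemma ipZr c f h : sqint f -> sqint h -> ip h (fun x => c * f x) = c * ip h f.
Proof. by move=> *; rewrite ipC ipZl // ipC. Qed.

Lemma ip0l h : ip (fun _ => 0) h = 0.
Proof.
rewrite /ip (@eq_Rintegral _ _ _ _ _ (fun _ => 0)); first by rewrite Rintegral_cst // mul0r.
by move=> x _; rewrite mul0r.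
Qed.

Lemma ipNl f h : sqint f -> sqint h -> ip (fun x => - f x) h = - ip f h.
Proof.
move=> fi hi; rewrite -mulN1r -ipZl //; apply: eq_ip => // x _; by rewrite mulN1r.
Qed.

Lemma ipBl f g h : sqint f -> sqint g -> sqint h ->
  ip (fun x => f x - g x) h = ip f h - ip g h.
Proof. by move=> fi gi hi; rewrite ipDl ?ipNl //; exact: sqintN. Qed.

Lemma ipBr f g h : sqint f -> sqint g -> sqint h ->
  ip h (fun x => f x - g x) = ip h f - ip h g.
Proof. by move=> *; rewrite ipC ipBl // ![ip _ h]ipC. Qed.

Lemma ip_suml (I : eqType) (s : seq I) (f : I -> T -> R) h :
  (forall i, i \in s -> sqint (f i)) -> sqint h ->
  ip (fun x => \sum_(i <- s) f i x) h = \sum_(i <- s) ip (f i) h.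
Proof.
move=> + hi; elim: s => [|i s IH] H.
  by under eq_fun do rewrite big_nil; rewrite big_nil ip0l.
under eq_fun do rewrite big_cons.
have Hs j : j \in s -> sqint (f j) by move=> js; apply: H; rewrite inE js orbT.
rewrite ipDl // ?big_cons ?IH //; first by apply: H; rewrite mem_head.
exact: sqint_sum.
Qed.

Lemma ip_sumr (I : eqType) (s : seq I) (f : I -> T -> R) h :
  (forall i, i \in s -> sqint (f i)) -> sqint h ->
  ip h (fun x => \sum_(i <- s) f i x) = \sum_(i <- s) ip h (f i).
Proof. by move=> Hs hi; rewrite ipC ip_suml //; apply: eq_bigr => i _; rewrite ipC. Qed.

Lemma ip_suml_ord n (f : nat -> T -> R) h :
  (forall i, (i < n)%N -> sqint (f i)) -> sqint h ->
  ip (fun x => \sum_(i < n) f i x) h = \sum_(i < n) ip (f i) h.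
Proof.
move=> H hi; under eq_fun do rewrite -(big_mkord xpredT (fun i => f i _)).
rewrite ip_suml //; first by rewrite big_mkord.
by move=> i; rewrite mem_index_iota => /andP[_]; exact: H.
Qed.

Lemma ip_sumr_ord n (f : nat -> T -> R) h :
  (forall i, (i < n)%N -> sqint (f i)) -> sqint h ->
  ip h (fun x => \sum_(i < n) f i x) = \sum_(i < n) ip h (f i).
Proof. by move=> Hs hi; rewrite ipC ip_suml_ord //; apply: eq_bigr => i _; rewrite ipC. Qed.

Lemma ip_le f g : measurable_fun D f ->
  (forall x, D x -> `|f x| <= `|g x|) -> sqint g -> ip f f <= ip g g.
Proof.
move=> mf fg gi; have fi := sqint_le mf fg gi.
apply: le_Rintegral => //; try exact: integrable_mul.
move=> x Dx; rewrite -!expr2 -(real_normK (num_real (f x))) -(real_normK (num_real (g x))).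
by rewrite lerXn2r ?nnegrE ?fg.
Qed.

Lemma ip_young f g : sqint f -> sqint g ->
  ip (fun x => f x + g x) (fun x => f x + g x) <= 2 * ip f f + 2 * ip g g.
Proof.
move=> fi gi; have fg := sqintD fi gi; have fg' := sqintB fi gi.
have := ip_ge0 (fun x => f x - g x).
rewrite (ipBl fi gi fg') (ipBr fi gi fi) (ipBr fi gi gi).
rewrite (ipDl fi gi fg) (ipDr fi gi fi) (ipDr fi gi gi) (ipC g f); lra.
Qed.

Lemma ip_absM f g : sqint f -> sqint g -> `|ip f g| <= (ip f f + ip g g) / 2.
Proof.
move=> fi gi; have fg := sqintD fi gi; have fg' := sqintB fi gi.
have := ip_ge0 (fun x => f x - g x); have := ip_ge0 (fun x => f x + g x).
rewrite (ipBl fi gi fg') (ipBr fi gi fi) (ipBr fi gi gi).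
rewrite (ipDl fi gi fg) (ipDr fi gi fi) (ipDr fi gi gi) (ipC g f) => h1 h2.
by rewrite ler_norml; apply/andP; split; lra.
Qed.

End square_integrable.

(** * Independence and expectation of products *)

Lemma sqint_prob_cst d (T : measurableType d) (R : realType) (P : probability T R)
  (c : R) : sqint P setT (fun _ => c).
Proof.
apply: sqint_cst => //.
by rewrite [X in (X < _)%E](_ : _ = 1%E) ?ltry //; exact: probability_setT.
Qed.

Section independence.
Context d (T : measurableType d) (R : realType) (P : probability T R).
Variables X Y : T -> R.
Hypothesis sX : sqint P setT X.
Hypothesis sY : sqint P setT Y.
Hypothesis XY : forall A B : set R, measurable A -> measurable B ->
  P (X @^-1` A `&` Y @^-1` B) = (P (X @^-1` A) * P (Y @^-1` B))%E.

Let mX : measurable_fun setT X. Proof. by case: sX. Qed.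
Let mY : measurable_fun setT Y. Proof. by case: sY. Qed.
HB.instance Definition _ := isMeasurableFun.Build _ _ _ _ X mX.
HB.instance Definition _ := isMeasurableFun.Build _ _ _ _ Y mY.

Let phi (w : T) : R * R := (X w, Y w).
Let mphi : measurable_fun setT phi. Proof. exact: measurable_fun_pair. Qed.
HB.instance Definition _ := isMeasurableFun.Build _ _ _ _ phi mphi.

Let m1 : probability R R := distribution P (X : {mfun T >-> R}).
Let m2 : probability R R := distribution P (Y : {mfun T >-> R}).
Let m12 : probability (R * R)%type R := distribution P (phi : {mfun T >-> (R * R)%type}).

(** Independence says that the joint law agrees with the product of the marginal
   laws on rectangles, hence everywhere. *)
Let m12E S : measurable S -> (m1 \x m2)%E S = m12 S.
Proof. by apply: product_measure_unique => A B mA mB; rewrite -XY. Qed.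

Lemma ip_independent :
  ip P setT X Y = (\int[P]_w X w) * (\int[P]_w Y w).
Proof.
pose f (p : R * R) := (p.1 * p.2)%:E.
have mf : measurable_fun setT f.
  by apply/measurable_EFinP; exact: measurable_funM.
have sub1 := sqint_prob_cst P 1.
have iX : P.-integrable setT (EFin \o X).
  by have := integrable_mul measurableT sX sub1; apply: eq_integrable => // x _ /=; rewrite mulr1.
have iY : P.-integrable setT (EFin \o Y).
  by have := integrable_mul measurableT sY sub1; apply: eq_integrable => // x _ /=; rewrite mulr1.
have iXY := integrable_mul measurableT sX sY.
have if12 : m12.-integrable setT f.
  exact: (integrable_pushforward mphi mf).
have if' : (m1 \x m2)%E.-integrable setT f.
  move/integrableP : if12 => [_ h]; apply/integrableP; split=> //.
  rewrite (_ : \int[_]_x _ = \int[m12]_x `|f x|)%E //.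
  by apply: eq_measure_integral => A mA _; exact: m12E.
have e1 : (\int[m12]_z f z = (ip P setT X Y)%:E)%E.
  rewrite /m12 /distribution integral_pushforward //=.
  by rewrite preimage_setT -ipE.
have e2 : (\int[m12]_z f z = \int[(m1 \x m2)%E]_z f z)%E.
  by apply: eq_measure_integral => A mA _; apply: esym; exact: m12E.
have mEFin : measurable_fun setT (@EFin R) by exact/measurable_EFinP.
have idm1 : (\int[m1]_x x%:E = (\int[P]_w X w)%:E)%E.
  rewrite /m1 /distribution integral_pushforward //=.
  by rewrite preimage_setT /Rintegral fineK // integrable_fin_num.
have idm2 : (\int[m2]_x x%:E = (\int[P]_w Y w)%:E)%E.
  rewrite /m2 /distribution integral_pushforward //=.
  by rewrite preimage_setT /Rintegral fineK // integrable_fin_num.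
have im1 : m1.-integrable setT (fun x : R => x%:E).
  exact: (integrable_pushforward mX (mEFin)).
have im2 : m2.-integrable setT (fun x : R => x%:E).
  exact: (integrable_pushforward mY (mEFin)).
apply: EFin_inj; rewrite -e1 e2 -integral12_prod_meas1 // /fubini_F /f /=.
under eq_integral do under eq_integral do rewrite EFinM.
under eq_integral => x _.
  rewrite integralZl // idm2 muleC; over.
by rewrite integralZl // idm1 -EFinM mulrC.
Qed.

End independence.

(** * Moments of the centred normal law *)

Lemma cvg_invn (R : realType) : (n%:R)^-1 @[n --> \oo] --> (0 : R).
Proof.
apply/gtr0_cvgV0; last exact: cvgr_idn.
by exists 1%N => // n /= n0; rewrite ltr0n.
Qed.

Section normal_moments.
Variables (R : realType) (s : R).
Hypothesis s_gt0 : 0 < s.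
Notation mu := (@lebesgue_measure R).
Local Notation phi := (normal_pdf 0 s).

Let s_neq0 : s != 0. Proof. by rewrite gt_eqF. Qed.

Lemma centred_normal_pdfE x : phi x = normal_peak s * expR (- (x ^+ 2) / (s ^+ 2 *+ 2)).
Proof. by rewrite normal_pdfE // /normal_fun subr0. Qed.

Lemma is_derive_normal_pdf (x : R) : is_derive x 1 phi (- (x / s ^+ 2) * phi x).
Proof.
rewrite (_ : phi = fun x => normal_peak s * expR (- (x ^+ 2) / (s ^+ 2 *+ 2))); last first.
  by apply/funext => y; exact: centred_normal_pdfE.
have h : is_derive x 1 (fun x : R => - (x ^+ 2) / (s ^+ 2 *+ 2)) (- (x / s ^+ 2)).
  apply: is_derive_eq.
  rewrite /GRing.scale /=; field. exact: s_neq0.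
pose g (x : R) : R := - (x ^+ 2) / (s ^+ 2 *+ 2).
have h1 : is_derive x 1 (expR \o g) (expR (g x) * (- (x / s ^+ 2))).
  exact: (@is_derive1_comp _ (@expR R) g x _ _ (is_derive_expR (g x)) h).
rewrite (_ : - (x / s ^+ 2) * _ =
    normal_peak s * (expR (g x) * - (x / s ^+ 2))); last by ring.
exact: (@is_deriveZ _ _ _ (expR \o g) (normal_peak s) _ _ _ h1).
Qed.

Lemma sqr_normal_pdf_le (x : R) : x ^+ 2 * phi x <= normal_peak s * (s ^+ 2 *+ 2).
Proof.
have c0 : 0 < s ^+ 2 *+ 2 by rewrite mulrn_wgt0 // exprn_gt0.
rewrite centred_normal_pdfE mulrCA ler_wpM2l ?normal_peak_ge0 //.
rewrite mulNr expRN ler_pdivrMr ?expR_gt0 //.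
rewrite -ler_pdivrMl // mulrC (le_trans _ (expR_ge1Dx _)) //.
by rewrite lerDr.
Qed.

Let cphi : continuous phi. Proof. exact: continuous_normal_pdf. Qed.

Let cmoment k : continuous (fun x : R => x ^+ k * phi x).
Proof. by move=> x; apply: cvgM; [exact: exprn_continuous|exact: cphi]. Qed.

(** Since $x\varphi(x) = (-s^2\varphi)'(x)$, integration by parts lowers the degree
   of a moment by two. *)
Let by_parts (n k : nat) : (0 < n)%N ->
  \int[mu]_(x in `[0, n%:R]) (x ^+ k.+2 * phi x) =
  - (s ^+ 2 * n%:R ^+ k.+1 * phi n%:R)
  + k.+1%:R * s ^+ 2 * \int[mu]_(x in `[0, n%:R]) (x ^+ k * phi x).
Proof.
move=> n0.
have dF (x : R) : is_derive x 1 (fun x : R => x ^+ k.+1) (k.+1%:R * x ^+ k).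
  apply: DeriveDef; first exact: exprn_derivable.
  by rewrite -derive1E exp_derive1.
have dG (x : R) : is_derive x 1 (fun x => - s ^+ 2 * phi x) (x * phi x).
  apply: (is_derive_eq (is_deriveZ (- s ^+ 2) (is_derive_normal_pdf x))).
  by rewrite /GRing.scale /=; field.
have := @Rintegration_by_parts R (fun x => x ^+ k.+1) (fun x => - s ^+ 2 * phi x)
  (fun x => k.+1%:R * x ^+ k) (fun x => x * phi x) 0 n%:R.
have cX m : continuous (fun x : R => x ^+ m) by exact: exprn_continuous.
have cE (f : R -> R) : continuous f -> {within `[0, n%:R], continuous f}.
  by move=> cf; exact: continuous_subspaceT.
have lr (f : R -> R) : continuous f -> (forall x, derivable f x 1) ->
   derivable_oo_LRcontinuous f 0 n%:R.
  move=> cf df; split; first by move=> *; exact: df.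
    exact/cvg_at_right_filter/cf.
  exact/cvg_at_left_filter/cf.
rewrite (@eq_Rintegral _ _ _ mu `[0, n%:R] (fun x => x ^+ k.+1 * (x * phi x)) (fun x => x ^+ k.+2 * phi x)); last first.
  by move=> x _; rewrite mulrA -exprSr.
move=> -> //; last 7 first.
- by rewrite ltr0n.
- apply: cE => x; apply: cvgM; [exact: cvg_cst|exact: cX].
- by apply: lr => // x; have [] := dF x.
- by move=> x _; rewrite derive1E; have [_ ->] := dF x.
- by apply: cE => x; apply: cvgM; [exact: cvg_id|exact: cphi].
- apply: lr; first by move=> x; apply: cvgM; [exact: cvg_cst|exact: cphi].
  by move=> x; have [] := dG x.
- by move=> x _; rewrite derive1E; have [_ ->] := dG x.
rewrite (_ : \int[mu]_(x in _) _ = - (k.+1%:R * s ^+ 2) *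
    \int[mu]_(x in `[0, n%:R]) (x ^+ k * phi x)); first by rewrite expr0n /=; ring.
rewrite -RintegralZl //; last first.
  apply: continuous_compact_integrable; first exact: segment_compact.
  exact: cE.
by apply: eq_Rintegral => x _; ring.
Qed.

Let even_pdf x : phi (- x) = phi x.
Proof. by rewrite !centred_normal_pdfE sqrrN. Qed.

Let half k := (\int[mu]_(x in `[0%R, +oo[) (x ^+ k * phi x)%:E)%E.

Let half_even k : ~~ odd k ->
  (\int[mu]_x (x ^+ k * phi x)%:E = 2%:E * half k)%E.
Proof.
move=> ek; rewrite ge0_symfun_integralT //.
- by rewrite (_ : [set x | _] = `[0, +oo[%classic) //;
    apply/seteqP; split => x/=; rewrite in_itv/= andbT.
- by move=> x; rewrite mulr_ge0 ?normal_pdf_ge0 // exprn_even_ge0.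
- by move=> x /=; rewrite even_pdf exprNn -signr_odd (negbTE ek) expr0 mul1r.
Qed.

Let partial_cvg k : ~~ odd k ->
  (\int[mu]_(x in `[0%R, n%:R]) (x ^+ k * phi x))%:E @[n --> \oo] --> half k.
Proof.
move=> ek; rewrite (_ : (fun n : nat => _) = fun n => (\int[mu]_(x in `[0%R, n%:R]) (x ^+ k * phi x)%:E)%E).
  apply: ge0_cvgn_integral => [x|]; first by rewrite mulr_ge0 ?normal_pdf_ge0 // exprn_even_ge0.
  exact: continuous_measurable_fun.
apply/funext => n; rewrite /Rintegral fineK //.
apply: integrable_fin_num => //.
apply: continuous_compact_integrable; first exact: segment_compact.
exact: continuous_subspaceT.
Qed.

Let half0 : half 0 = (2^-1)%:E.
Proof.
have : (\int[mu]_x (x ^+ 0 * phi x)%:E = 1%:E)%E.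
  by rewrite -(integral_normal_pdf 0 s); apply: eq_integral => x _; rewrite expr0 mul1r.
rewrite half_even //; case: (half 0) => [r| |] /=; first last.
- by rewrite mulrNy gtr0_sg // mul1e.
- by rewrite mulry gtr0_sg // mul1e.
by rewrite -EFinM => h; congr EFin; move: (EFin_inj h); lra.
Qed.

Let half2 : half 2 = (s ^+ 2 / 2)%:E.
Proof.
have h0 := @partial_cvg 0 isT; rewrite half0 in h0.
have h2 := @partial_cvg 2 isT.
have h0' : (\int[mu]_(x in `[0%R, n%:R]) (x ^+ 0 * phi x)) @[n --> \oo] --> (2^-1 : R).
  by move/fine_cvgP : h0 => [].
have bnd : - (s ^+ 2 * n%:R ^+ 1 * phi n%:R) @[n --> \oo] --> (0 : R).
  rewrite -[X in _ --> X]oppr0; apply: cvgN.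
  pose c := s ^+ 2 * (normal_peak s * (s ^+ 2 *+ 2)).
  have hc : c * (n%:R)^-1 @[n --> \oo] --> c * 0.
    by apply: cvgM; [exact: cvg_cst|exact: cvg_invn].
  rewrite mulr0 in hc.
  apply: (squeeze_cvgr _ (cvg_cst 0) hc); near=> n.
  rewrite !mulr_ge0 ?normal_pdf_ge0 ?(ltW s_gt0) //=.
  have n0 : 0 < n%:R :> R by rewrite ltr0n; near: n; exact: nbhs_infty_gt.
  rewrite ler_pdivlMr // [leLHS](_ : _ = s ^+ 2 * (n%:R ^+ 2 * phi n%:R)); last by ring.
  by rewrite ler_wpM2l ?sqr_ge0 // sqr_normal_pdf_le.
have h2' : (\int[mu]_(x in `[0%R, n%:R]) (x ^+ 2 * phi x)) @[n --> \oo] --> (0 + 1%:R * s ^+ 2 * 2^-1 : R).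
  apply: (@cvg_trans _ ((- (s ^+ 2 * n%:R ^+ 1 * phi n%:R) + 1%:R * s ^+ 2 *
    \int[mu]_(x in `[0, n%:R]) (x ^+ 0 * phi x)) @[n --> \oo])).
    apply: near_eq_cvg; near=> n; rewrite by_parts //.
    by near: n; exact: nbhs_infty_gt.
  by apply: cvgD => //; apply: cvgM; [exact: cvg_cst|].
apply: (cvg_unique _ h2); first exact: ereal_hausdorff.
apply: cvg_EFin; last first.
  by move: h2'; rewrite add0r mul1r; exact.
exact: nearW.
Unshelve. all: by end_near. Qed.

Lemma normal_second_moment : (\int[mu]_x (x ^+ 2 * phi x)%:E = (s ^+ 2)%:E)%E.
Proof. by rewrite half_even // half2 -EFinM mulrCA divff ?mulr1. Qed.

(** An inequality is enough: the boundary term at infinity has the favourable sign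
   and is simply dropped. *)
Lemma normal_fourth_moment : (\int[mu]_x (x ^+ 4 * phi x)%:E <= (3 * s ^+ 4)%:E)%E.
Proof.
rewrite half_even //.
suff h : (half 4 <= (3 * s ^+ 2 * (s ^+ 2 / 2))%:E)%E.
  apply: (le_trans (lee_wpmul2l _ h)) => //.
  by rewrite -EFinM lee_fin [leRHS](_ : _ = 2 * (3 * s ^+ 2 * (s ^+ 2 / 2))) //; field.
have h2 := @partial_cvg 2 isT; rewrite half2 in h2.
have h2' : (\int[mu]_(x in `[0%R, n%:R]) (x ^+ 2 * phi x)) @[n --> \oo] --> (s ^+ 2 / 2 : R).
  by move/fine_cvgP : h2 => [].
have h3 : (3 * s ^+ 2 * \int[mu]_(x in `[0%R, n%:R]) (x ^+ 2 * phi x))%:E @[n --> \oo] --> (3 * s ^+ 2 * (s ^+ 2 / 2))%:E.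
  apply: cvg_EFin; first exact: nearW.
  by apply: cvgM; [exact: cvg_cst|].
apply: (lee_cvg_to (@partial_cvg 4 isT) h3).
near=> n; rewrite lee_fin by_parts; last by near: n; exact: nbhs_infty_gt.
by rewrite gerDr oppr_le0 !mulr_ge0 ?normal_pdf_ge0 ?exprn_ge0 ?(ltW s_gt0).
Unshelve. all: by end_near. Qed.


Let nu : probability (measurableTypeR R) R := normal_prob 0 s.
Let mphi : measurable_fun setT phi. Proof. exact: measurable_normal_pdf. Qed.

(** By uniqueness, the density is the Radon-Nikodym derivative of the law. *)
Lemma integral_normal_prob (f : measurableTypeR R -> R) :
  measurable_fun setT f -> (forall x, 0 <= f x) ->
  (\int[normal_prob 0 s]_x (f x)%:E = \int[mu]_x (f x * phi x)%:E)%E.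
Proof.
move=> mf f0; have dom : nu `<< mu by exact: normal_prob_dominates.
have mEf : measurable_fun setT (EFin \o f) by exact/measurable_EFinP.
rewrite -(Radon_Nikodym_SigmaFinite.change_of_variables dom (f := EFin \o f)) //.
under [RHS]eq_integral do rewrite EFinM.
have gi := Radon_Nikodym_SigmaFinite.f_integrable dom.
have mEphi : measurable_fun setT (EFin \o phi) by exact/measurable_EFinP.
apply: ae_eq_integral => //.
- by apply: emeasurable_funM => //; exact: measurable_int gi.
- exact: emeasurable_funM.
apply: ae_eqe_mul2l; apply: integral_ae_eq => // E _ mE.
by rewrite -Radon_Nikodym_SigmaFinite.f_integral.
Qed.

(** Equality of the two one-sided first moments, by symmetry of the density; with
   their finiteness it makes the mean vanish. *)
Lemma normal_pos_neg_part :
  (\int[mu]_x (Num.max x 0 * phi x)%:E = \int[mu]_x (Num.max (- x) 0 * phi x)%:E)%E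
  /\ (\int[mu]_x (Num.max x 0 * phi x)%:E < +oo)%E.
Proof.
set A := (\int[mu]_x (Num.max x 0 * phi x)%:E)%E.
set B := (\int[mu]_x (Num.max (- x) 0 * phi x)%:E)%E.
have mx : measurable_fun setT (fun x : R => Num.max x 0 * phi x).
  by apply: measurable_funM => //; exact: measurable_maxr.
have my : measurable_fun setT (fun x : R => Num.max (- x) 0 * phi x).
  by apply: measurable_funM => //; apply: measurable_maxr => //; exact: measurableT_comp.
have px x : 0 <= Num.max x 0 * phi x :> R.
  by rewrite mulr_ge0 ?normal_pdf_ge0 // le_max lexx orbT.
have py x : 0 <= Num.max (- x) 0 * phi x :> R.
  by rewrite mulr_ge0 ?normal_pdf_ge0 // le_max lexx orbT.
have AB : (\int[mu]_x (`|x| * phi x)%:E = A + B)%E.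
  rewrite -ge0_integralD //; [|by move=> *; rewrite lee_fin|by apply/measurable_EFinP
    |by move=> *; rewrite lee_fin|by apply/measurable_EFinP].
  apply: eq_integral => x _; rewrite -EFinD -mulrDl; congr ((_ * _)%:E).
  by case: (ger0P x) => x0; case: (lerP x 0) => ?; case: (lerP (- x) 0) => ?; lra.
have AA : (\int[mu]_x (`|x| * phi x)%:E = 2%:E * A)%E.
  rewrite ge0_symfun_integralT.
  - congr (_ * _)%E; rewrite /A integral_mkcond; apply: eq_integral => x _.
    rewrite patchE; case: ifPn => [|]; rewrite ?inE ?notin_setE /=.
      by move=> x0; rewrite ger0_norm // max_l.
    by move=> /negP; rewrite -ltNge => x0; rewrite max_r ?mul0r // ltW.
  - by move=> x; rewrite mulr_ge0 ?normal_pdf_ge0.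
  - move=> x; apply: cvgM; [exact: norm_continuous|exact: cphi].
  - by move=> x /=; rewrite normrN even_pdf.
have Afin : (A < +oo)%E.
  apply: (@le_lt_trans _ _ (\int[mu]_x ((x ^+ 0 * phi x)%:E + (x ^+ 2 * phi x)%:E))%E).
    apply: ge0_le_integral => //; [by move=> *; rewrite lee_fin|by apply/measurable_EFinP| |].
      by apply: emeasurable_funD; apply/measurable_EFinP;
        apply: measurable_funM => //; exact: exprn_measurable.
    move=> x _; rewrite -EFinD lee_fin -mulrDl ler_wpM2r ?normal_pdf_ge0 //.
    rewrite expr0 ge_max; apply/andP; split; last by rewrite addr_ge0 ?sqr_ge0.
    by have := sqr_ge0 (x - 1); rewrite !expr2; nra.
  rewrite ge0_integralD //.
  - rewrite normal_second_moment (_ : \int[mu]_x (x ^+ 0 * phi x)%:E = 1)%E ?lte_add_pinfty ?ltry //.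
    by rewrite -(integral_normal_pdf 0 s); apply: eq_integral => x _; rewrite expr0 mul1r.
  - by move=> x _; rewrite lee_fin mulr_ge0 ?normal_pdf_ge0.
  - by apply/measurable_EFinP; apply: measurable_funM => //; exact: exprn_measurable.
  - by move=> x _; rewrite lee_fin mulr_ge0 ?normal_pdf_ge0 ?sqr_ge0.
  - by apply/measurable_EFinP; apply: measurable_funM => //; exact: exprn_measurable.
split=> //.
have A0 : (0 <= A)%E by apply: integral_ge0 => x _; rewrite lee_fin.
have B0 : (0 <= B)%E by apply: integral_ge0 => x _; rewrite lee_fin.
move: AA; rewrite AB; move: Afin A0 B0.
case: A {AB} => [p| |] //; case: B => [q| |] // _ _ _.
by rewrite -EFinM -EFinD => h; congr EFin; move: (EFin_inj h); lra.
Qed.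

End normal_moments.

Section centred_normal_variable.
Context d (T : measurableType d) (R : realType) (P : probability T R).
Variables (Z : T -> R) (s : R).
Hypothesis s_gt0 : 0 < s.
Hypothesis mZ : measurable_fun setT Z.
Hypothesis lawZ : forall B : set R, measurable B -> P (Z @^-1` B) = normal_prob 0 s B.
Notation mu := (@lebesgue_measure R).

Let Z' : T -> measurableTypeR R := Z.
Let mZ' : measurable_fun setT Z'. Proof. exact: mZ. Qed.
HB.instance Definition _ := isMeasurableFun.Build _ _ _ _ Z' mZ'.

Let law : probability (measurableTypeR R) R :=
  distribution P (Z' : {mfun T >-> measurableTypeR R}).

Lemma integral_centred_normal (f : R -> R) :
  measurable_fun setT f -> (forall x, 0 <= f x) ->
  (\int[P]_w (f (Z w))%:E = \int[mu]_x (f x * normal_pdf 0 s x)%:E)%E.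
Proof.
move=> mf f0; have mEf : measurable_fun setT (EFin \o f) by exact/measurable_EFinP.
rewrite -integral_normal_prob //.
transitivity (\int[law]_x (f x)%:E)%E.
  by rewrite /law /distribution ge0_integral_pushforward // ?preimage_setT // => x _; rewrite lee_fin.
by apply: eq_measure_integral => A mA _; rewrite /= -lawZ.
Qed.

Lemma centred_normal_second_moment : (\int[P]_w ((Z w) ^+ 2)%:E = (s ^+ 2)%:E)%E.
Proof.
rewrite (@integral_centred_normal (fun x => x ^+ 2)) ?normal_second_moment // => x.
exact: sqr_ge0.
Qed.

Lemma sqint_centred_normal : sqint P setT Z.
Proof. by split => //; rewrite centred_normal_second_moment ltry. Qed.

Lemma centred_normal_fourth_moment : (\int[P]_w ((Z w) ^+ 4)%:E <= (3 * s ^+ 4)%:E)%E.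
Proof.
rewrite (@integral_centred_normal (fun x => x ^+ 4)) ?normal_fourth_moment // => x.
by rewrite exprn_even_ge0.
Qed.

Lemma centred_normal_mean : \int[P]_w Z w = 0.
Proof.
have [e f] := normal_pos_neg_part s_gt0.
rewrite /Rintegral integralE.
under eq_integral do rewrite funeposE -EFin_max.
under [X in (_ - X)%E]eq_integral do rewrite funenegE -EFinN -EFin_max.
have mneg : measurable_fun setT (fun x : R => Num.max (- x) 0).
  by apply: measurable_maxr => //; exact: measurableT_comp.
have mpos : measurable_fun setT (fun x : R => Num.max x 0) by exact: measurable_maxr.
rewrite (@integral_centred_normal (fun x => Num.max x 0)) //; last by move=> x; rewrite le_max lexx orbT.
rewrite (@integral_centred_normal (fun x => Num.max (- x) 0)) //; last by move=> x; rewrite le_max lexx orbT.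
rewrite -e subee // ge0_fin_numE // integral_ge0 // => x _.
by rewrite lee_fin mulr_ge0 ?normal_pdf_ge0 // le_max lexx orbT.
Qed.

End centred_normal_variable.

(** * Second-order structure of the driving noise *)

Section sub_sigma_algebra.
Context d (Omega : measurableType d) (R : realType).
Implicit Types (G H : set (set Omega)) (f g : Omega -> R).

(** Measurability with respect to the sigma-algebra generated by [G]; phrased
   with the generated measurable type so that the closure properties of
   measurable functions apply verbatim. *)
Definition fmeas G f :=
  @measurable_fun _ _ (g_sigma_algebraType G) R setT f.

Lemma fmeasP G f : sigma_algebra setT G ->
  (forall B : set R, measurable B -> G (f @^-1` B)) -> fmeas G f.
Proof.
move=> sG h _ B mB; rewrite setTI; apply: sub_sigma_algebra; exact: h.
Qed.

Lemma fmeas_preimage G f (B : set R) : sigma_algebra setT G -> fmeas G f ->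
  measurable B -> G (f @^-1` B).
Proof.
move=> sG mf mB; have := mf measurableT B mB; rewrite setTI.
by rewrite /measurable /= -[X in _ -> X _](sigma_algebra_id sG).
Qed.

Lemma fmeas_sub G f : G `<=` measurable -> fmeas G f -> measurable_fun setT f.
Proof.
move=> sub mf _ B mB; have := mf measurableT B mB; rewrite setTI.
apply: smallest_sub => //; exact: sigma_algebra_measurable.
Qed.

Lemma fmeas_mono G H f : G `<=` H -> fmeas G f -> fmeas H f.
Proof.
move=> sub mf _ B mB; have := mf measurableT B mB; rewrite setTI.
exact: sub_smallest2r.
Qed.

Lemma fmeas_cst G c : fmeas G (fun _ => c).
Proof. exact: measurable_cst. Qed.

Lemma fmeasD G f g : fmeas G f -> fmeas G g -> fmeas G (fun w => f w + g w).
Proof. exact: measurable_funD. Qed.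

Lemma fmeasB G f g : fmeas G f -> fmeas G g -> fmeas G (fun w => f w - g w).
Proof. exact: measurable_funB. Qed.

Lemma fmeasM G f g : fmeas G f -> fmeas G g -> fmeas G (fun w => f w * g w).
Proof. exact: measurable_funM. Qed.

Lemma fmeas_comp G (h : R -> R) f : measurable_fun setT h -> fmeas G f ->
  fmeas G (fun w => h (f w)).
Proof. exact: measurableT_comp. Qed.

Lemma fmeas_sum G n (f : nat -> Omega -> R) :
  (forall i, (i < n)%N -> fmeas G (f i)) -> fmeas G (fun w => \sum_(i < n) f i w).
Proof.
elim: n => [|n IH] H.
  by under eq_fun do rewrite big_ord0; exact: fmeas_cst.
under eq_fun do rewrite big_ord_recr /=.
by apply: fmeasD; [apply: IH => i /ltnW; exact: H|exact: H].
Qed.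

End sub_sigma_algebra.

Section noise.
Context d (Omega : measurableType d) (R : realType) (P : probability Omega R).
Implicit Types (F : R -> set (set Omega)) (W : nat -> R -> Omega -> R).

Definition incr (W : R -> Omega -> R) (s t : R) : Omega -> R := fun w => W t w - W s w.

(** A description of the driving processes by second moments, with a bound on the
   fourth moments of single increments. Each clause survives a modification on null
   sets, so that it passes to versions all of whose paths are continuous. *)
Record noise F W : Prop := {
  noise_sub : forall (t : R) (f : Omega -> R), 0 <= t -> fmeas (F t) f -> measurable_fun setT f ;
  noise_mono : forall (s t : R) (f : Omega -> R), 0 <= s -> s <= t -> fmeas (F s) f -> fmeas (F t) f ;
  noise_adapted : forall k (t : R), 0 <= t -> fmeas (F t) (W k t) ;
  noise_sqint : forall k (s t : R), 0 <= s -> s <= t -> sqint P setT (incr (W k) s t) ;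
  noise_orth : forall k (s t : R) (xi : Omega -> R), 0 <= s -> s <= t -> fmeas (F s) xi ->
    sqint P setT xi -> ip P setT xi (incr (W k) s t) = 0 ;
  noise_var : forall k (s t : R), 0 <= s -> s <= t ->
    ip P setT (incr (W k) s t) (incr (W k) s t) = t - s ;
  noise_fourth : forall k (s t : R), 0 <= s -> s <= t ->
    (\int[P]_w ((incr (W k) s t w) ^+ 4)%:E <= (3 * (t - s) ^+ 2)%:E)%E ;
  noise_uncorr : forall k l (s t s' t' : R), k != l -> 0 <= s -> s <= t -> 0 <= s' -> s' <= t' ->
    ip P setT (incr (W k) s t) (incr (W l) s' t') = 0 }.

Lemma process_sigma_incr (W : R -> Omega -> R) s t (B : set R) : 0 <= s -> 0 <= t ->
  measurable B -> process_sigma W (incr W s t @^-1` B).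
Proof.
move=> s0 t0 mB.
set G := [set A | exists (t : R) (B : set R), [/\ 0 <= t, measurable B & A = W t @^-1` B]].
have mW u : 0 <= u -> fmeas G (W u).
  by move=> u0 _ C mC; rewrite setTI; apply: sub_sigma_algebra; exists u, C.
have := fmeasB (mW _ t0) (mW _ s0) measurableT mB.
by rewrite setTI.
Qed.

Lemma wiener_noise F W : filtration_usual P F ->
  (forall k, wiener_process P F (W k)) -> independent_processes P W -> noise F W.
Proof.
move=> hF hW hI.
have adW k t : 0 <= t -> fmeas (F t) (W k t).
  by move=> t0; apply: fmeasP; [exact: filtration_sigma hF _ t0|exact: wiener_adapted (hW k) _ t0].
have mW k t : 0 <= t -> measurable_fun setT (W k t).
  by move=> t0; apply: fmeas_sub (adW k t t0); exact: filtration_sub hF _ t0.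
have m_incr k s t : 0 <= s -> s <= t -> measurable_fun setT (incr (W k) s t).
  move=> s0 st; apply: measurable_funB; apply: mW => //; exact: le_trans st.
have incr_id k s : incr (W k) s s = fun _ => 0.
  by apply/funext => w; rewrite /incr subrr.
have law k s t : 0 <= s -> s < t -> forall B : set R, measurable B ->
    P (incr (W k) s t @^-1` B) = normal_prob 0 (Num.sqrt (t - s)) B.
  by move=> s0 st B mB; exact: (wiener_normal (hW k)).
have sq_incr k s t : 0 <= s -> s <= t -> sqint P setT (incr (W k) s t).
  move=> s0; rewrite le_eqVlt => /predU1P[<-|st].
    by rewrite incr_id; exact: sqint0.
  apply: (@sqint_centred_normal _ _ _ P _ (Num.sqrt (t - s))) => //.
  - by rewrite sqrtr_gt0 subr_gt0.
  - by apply: m_incr => //; exact: ltW.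
  - exact: law.
have mean0 k s t : 0 <= s -> s <= t -> \int[P]_w incr (W k) s t w = 0.
  move=> s0; rewrite le_eqVlt => /predU1P[<-|st].
    by rewrite incr_id Rintegral_cst // mul0r.
  apply: (@centred_normal_mean _ _ _ P _ (Num.sqrt (t - s))) => //.
  - by rewrite sqrtr_gt0 subr_gt0.
  - by apply: m_incr => //; exact: ltW.
  - exact: law.
split=> //.
- by move=> t f t0; apply: fmeas_sub; exact: filtration_sub hF _ t0.
- by move=> s t f s0 st; apply: fmeas_mono; exact: filtration_mono hF _ _ s0 st.
- move=> k s t xi s0 st mxi sxi.
  rewrite (@ip_independent _ _ _ P xi (incr (W k) s t)) ?mean0 ?mulr0 //; first exact: sq_incr.
  move=> A B mA mB; move: st; rewrite le_eqVlt => /predU1P[<-|st].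
    rewrite incr_id; have [B0|B0] := pselect (B 0).
      rewrite (_ : (fun=> 0) @^-1` B = setT); last by apply/seteqP; split.
      by rewrite setIT [X in (_ * X)%E](_ : _ = 1%E) ?mule1 //; exact: probability_setT.
    rewrite (_ : (fun=> 0) @^-1` B = set0); last by apply/seteqP; split.
    by rewrite setI0 measure0 mule0.
  apply: (wiener_independent (hW k)) => //.
  by apply: fmeas_preimage => //; exact: filtration_sigma hF _ s0.
- move=> k s t s0; rewrite le_eqVlt => /predU1P[<-|st].
    by rewrite incr_id ip0l // subrr.
  apply: EFin_inj; rewrite -ip_sqE //; last by apply: sq_incr => //; exact: ltW.
  rewrite (@centred_normal_second_moment _ _ _ P _ (Num.sqrt (t - s))) //.
  + by rewrite sqr_sqrtr // subr_ge0 ltW.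
  + by rewrite sqrtr_gt0 subr_gt0.
  + by apply: m_incr => //; exact: ltW.
  + exact: law.
- move=> k s t s0; rewrite le_eqVlt => /predU1P[<-|st].
    rewrite incr_id (eq_integral (cst 0%E)) ?integral0; last by move=> x _; rewrite expr0n.
    by rewrite lee_fin mulr_ge0 // sqr_ge0.
  apply: le_trans (@centred_normal_fourth_moment _ _ _ P _ (Num.sqrt (t - s)) _ _ _) _.
  + by rewrite sqrtr_gt0 subr_gt0.
  + by apply: m_incr => //; exact: ltW.
  + exact: law.
  + rewrite lee_fin (_ : Num.sqrt (t - s) ^+ 4 = (Num.sqrt (t - s) ^+ 2) ^+ 2); last by ring.
    by rewrite sqr_sqrtr // subr_ge0 ltW.
- move=> k l s t s' t' kl s0 st s0' st'.
  rewrite ip_independent ?mean0 ?mulr0 //; [exact: sq_incr|exact: sq_incr|].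
  move=> A B mA mB.
  (* the pair of indices is seen as a two-element subfamily *)
  pose C i := if i == k then incr (W k) s t @^-1` A else incr (W l) s' t' @^-1` B.
  have := hI [fset k; l]%fset C.
  rewrite (_ : \bigcap_(i in _) _ = C k `&` C l); last first.
    apply/seteqP; split=> w.
      by move=> h; split; apply: h; rewrite /= !inE eqxx ?orbT.
    by move=> [h1 h2] i /=; rewrite !inE => /orP[] /eqP ->.
  rewrite big_fsetU1 /= ?big_seq_fset1 ?inE // /C eqxx (eq_sym l) (negbTE kl) => -> //.
  move=> i; rewrite !inE => /orP[] /eqP ->.
    by rewrite eqxx; apply: process_sigma_incr => //; exact: le_trans st.
  by rewrite (eq_sym l) (negbTE kl); apply: process_sigma_incr => //; exact: le_trans st'.
Qed.

End noise.

Section ae_modification.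
Context d (T : measurableType d) (R : realType).
Variable mu : {measure set T -> \bar R}.
Variable D : set T.
Hypothesis mD : measurable D.
Implicit Types f g : T -> R.

Lemma sqint_ae f g : measurable_fun D f -> ae_eq mu D f g -> sqint mu D g -> sqint mu D f.
Proof.
move=> mf fg [mg gi]; split=> //; apply: le_lt_trans gi.
rewrite le_eqVlt; apply/orP; left; apply/eqP; apply: ae_eq_integral => //.
- exact: measurable_sqE.
- exact: measurable_sqE.
- by apply: filterS fg => x h Dx /=; rewrite h.
Qed.

Lemma ip_ae f f' g g' : measurable_fun D f -> measurable_fun D f' ->
  measurable_fun D g -> measurable_fun D g' ->
  ae_eq mu D f f' -> ae_eq mu D g g' -> ip mu D f g = ip mu D f' g'.
Proof.
move=> mf mf' mg mg' e1 e2; rewrite /ip /Rintegral; congr fine.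
apply: ae_eq_integral => //.
- by apply/measurable_EFinP; exact: measurable_funM.
- by apply/measurable_EFinP; exact: measurable_funM.
- by apply: filterS2 e1 e2 => x h1 h2 Dx /=; rewrite h1 // h2.
Qed.

End ae_modification.

Section noise_modification.
Context d (Omega : measurableType d) (R : realType) (P : probability Omega R).

(** Apart from adaptedness, the processes enter [noise] only through integrals. *)
Lemma noise_ae (F : R -> set (set Omega)) (W W' : nat -> R -> Omega -> R) :
  noise P F W -> (forall k (t : R), 0 <= t -> fmeas (F t) (W' k t)) ->
  (forall k (t : R), 0 <= t -> ae_eq P setT (W' k t) (W k t)) -> noise P F W'.
Proof.
move=> nW aW' e.
have m_incr k (s t : R) : 0 <= s -> s <= t -> measurable_fun setT (incr (W' k) s t).
  move=> s0 st; have t0 := le_trans s0 st.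
  by apply: measurable_funB; [exact: (noise_sub nW t0 (aW' _ _ t0))|exact: (noise_sub nW s0 (aW' _ _ s0))].
have ei k (s t : R) : 0 <= s -> s <= t -> ae_eq P setT (incr (W' k) s t) (incr (W k) s t).
  move=> s0 st; have t0 := le_trans s0 st.
  apply: filterS2 (e k s s0) (e k t t0) => w h1 h2 _.
  by rewrite /incr h1 // h2.
have mi k (s t : R) : 0 <= s -> s <= t -> measurable_fun setT (incr (W k) s t).
  by move=> s0 st; case: (noise_sqint nW k s0 st).
split=> //.
- exact: noise_sub nW.
- exact: noise_mono nW.
- move=> k s t s0 st; apply: (sqint_ae measurableT (m_incr _ _ _ s0 st) (ei _ _ _ s0 st)).
  exact: noise_sqint nW _ _ _ s0 st.
- move=> k s t xi s0 st mxi sxi; rewrite -(noise_orth nW k s0 st mxi sxi).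
  have mx := noise_sub nW s0 mxi.
  apply: ip_ae => //; [exact: m_incr|exact: mi|exact: aeW|exact: ei].
- move=> k s t s0 st; rewrite -(noise_var nW k s0 st).
  by apply: ip_ae => //; first [exact: m_incr|exact: mi|exact: ei].
- move=> k s t s0 st; apply: le_trans (noise_fourth nW k s0 st).
  rewrite le_eqVlt; apply/orP; left; apply/eqP; apply: ae_eq_integral => //.
  + by apply/measurable_EFinP; apply: measurable_funX; exact: m_incr.
  + by apply/measurable_EFinP; apply: measurable_funX; exact: mi.
  + by apply: filterS (ei k _ _ s0 st) => w h _ /=; rewrite h.
- move=> k l s t s' t' kl s0 st s0' st'; rewrite -(noise_uncorr nW kl s0 st s0' st').
  by apply: ip_ae => //; first [exact: m_incr|exact: mi|exact: ei].
Qed.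

End noise_modification.

Section isometry.
Context d (Omega : measurableType d) (R : realType) (P : probability Omega R).
Variables (F : R -> set (set Omega)) (W : nat -> R -> Omega -> R).
Hypothesis nW : noise P F W.
Notation E := (ip P setT).
Notation L2P := (sqint P setT).

Let mT : measurable (setT : set Omega). Proof. exact: measurableT. Qed.

Lemma ip_brownian k l (s t : R) : 0 <= s -> 0 <= t ->
  E (incr (W k) 0 s) (incr (W l) 0 t) = if k == l then Num.min s t else 0.
Proof.
wlog st : k l s t / s <= t => [H s0 t0|].
  have [st|ts] := leP s t.
    by rewrite (H k l s t st) // min_l.
  by rewrite ipC (H l k t s (ltW ts)) // eq_sym min_l ?(ltW ts).
move=> s0 t0; case: eqVneq => [<-|kl]; last by rewrite (noise_uncorr nW).
rewrite min_l // (@eq_ip _ _ _ _ _ _ _ (incr (W k) 0 s)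
   (fun w => incr (W k) 0 s w + incr (W k) s t w)) //; last first.
  by move=> w _; rewrite /incr; ring.
have h0 := noise_sqint nW k (lexx 0) s0; have h1 := noise_sqint nW k s0 st.
rewrite (ipDr mT h0 h1 h0) (noise_var nW) // (noise_orth nW) // ?addr0 ?subr0 //.
apply: fmeasB; first exact: noise_adapted nW _ _ s0.
apply: (noise_mono nW (lexx 0) s0); exact: (noise_adapted nW).
Qed.

(** Bilinearity reduces the covariance of increments over arbitrary, possibly
   overlapping intervals to that of the processes started at $0$. *)
Lemma ip_incr k l (s t s' t' : R) : 0 <= s -> s <= t -> 0 <= s' -> s' <= t' ->
  E (incr (W k) s t) (incr (W l) s' t') =
  if k == l then Num.min t t' - Num.min t s' - Num.min s t' + Num.min s s' else 0.
Proof.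
move=> s0 st s0' st'; have t0 := le_trans s0 st; have t0' := le_trans s0' st'.
have e j (u v : R) : incr (W j) u v = fun w => incr (W j) 0 v w - incr (W j) 0 u w.
  by apply/funext => w; rewrite /incr; ring.
have h j (u : R) : 0 <= u -> L2P (incr (W j) 0 u) by move=> u0; exact: (noise_sqint nW).
rewrite (e k s t) (e l s' t').
have hB := sqintB mT (h l _ t0') (h l _ s0').
rewrite (ipBl mT (h k _ t0) (h k _ s0) hB).
rewrite (ipBr mT (h l _ t0') (h l _ s0') (h k _ t0)) (ipBr mT (h l _ t0') (h l _ s0') (h k _ s0)).
rewrite !ip_brownian //; case: eqP => _; ring.
Qed.

Notation mu := (@lebesgue_measure R).

Lemma ip_indic (T s t : R) : 0 <= s -> s <= T -> 0 <= t -> t <= T ->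
  ip mu `[0, T] (\1_`]0, s]) (\1_`]0, t]) = Num.min s t.
Proof.
move=> s0 sT t0 tT; rewrite /ip.
rewrite (@eq_Rintegral _ _ _ mu _ (\1_(`]0, Num.min s t] : set R))); last first.
  move=> x _; rewrite !indicE -natrM mulnb; congr (_%:R).
  by rewrite !mem_setE /= !in_itv /= le_min; case: (0 < x).
rewrite /Rintegral integral_indic // setIidl; last first.
  move=> x /=; rewrite !in_itv /= => /andP[x0]; rewrite le_min => /andP[xs _].
  by rewrite ltW //= (le_trans xs).
rewrite [X in fine X](lebesgue_measure_itv (`]0, Num.min s t] : interval R)) /= lte_fin.
case: ltP => [_|h] /=; first by rewrite oppr0 addr0.
by apply: le_anti; rewrite le_min s0 t0 h.
Qed.

Lemma sqint_indic (T s t : R) : sqint mu `[0, T] (\1_`]s, t] : R -> R).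
Proof.
split; first exact: measurable_indic.
apply: (@le_lt_trans _ _ (\int[mu]_(x in `[0%R, T]) (cst (1%:E) x))%E); last first.
  rewrite integral_cst // mul1e [X in (X < _)%E](lebesgue_measure_itv (`[0, T] : interval R)) /=.
  by case: ifP => _; rewrite ?ltry.
apply: ge0_le_integral => //.
- by apply: measurable_sqE; exact: measurable_indic.
- move=> x _; rewrite /= lee_fin indicE; case: (_ \in _); rewrite ?expr1n ?expr0n //.
Qed.

Lemma ip_incr_indic k l (T s t s' t' : R) : 0 <= s -> s <= t -> t <= T ->
    0 <= s' -> s' <= t' -> t' <= T ->
  E (incr (W k) s t) (incr (W l) s' t') =
  if k == l then ip mu `[0, T] (\1_`]s, t]) (\1_`]s', t']) else 0.
Proof.
move=> s0 st tT s0' st' tT'; rewrite ip_incr //; case: eqP => // _.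
have sT := le_trans st tT; have sT' := le_trans st' tT'.
have t0 := le_trans s0 st; have t0' := le_trans s0' st'.
have e (u v : R) : 0 <= u -> u <= v ->
    (\1_`]u, v] : R -> R) = fun x => \1_`]0, v] x - \1_`]0, u] x.
  move=> u0 uv; apply/funext => x; rewrite !indicE !mem_setE /= !in_itv /=.
  by case: (ltP 0 x) => ?; case: (leP x u) => ?; case: (leP x v) => ? /=; lra.
rewrite (e s t) // (e s' t') //.
have h (u v : R) := sqint_indic T u v.
have mI : measurable (`[0, T] : set (measurableTypeR R)) by exact: measurable_itv.
have hB := sqintB mI (h 0 t') (h 0 s').
rewrite (ipBl mI (h 0 t) (h 0 s) hB) (ipBr mI (h 0 t') (h 0 s') (h 0 t)).
rewrite (ipBr mI (h 0 t') (h 0 s') (h 0 s)) !ip_indic //; ring.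
Qed.

Definition step_in (T : R) (l : seq (R * R * R)) :=
  all (fun p => (0 <= p.1.2) && (p.1.2 <= p.2 <= T)) l.

Lemma sqint_step_integral T k l : step_in T l -> L2P (step_integral (W k) l).
Proof.
move=> /allP hl; apply: sqint_sum => // p pl; apply: sqintZ => //.
by have /and3P[? ? ?] := hl _ pl; exact: (noise_sqint nW).
Qed.

Lemma sqint_step_fun T l : sqint mu `[0, T] (step_fun l).
Proof. by apply: sqint_sum => // p pl; apply: sqintZ => //; exact: sqint_indic. Qed.

(** The Wiener increments over two intervals have the same covariance as the
   indicators of these intervals in $L^2([0,T])$, so integrals of step functions
   are isometric whatever the overlaps between the intervals. *)
Lemma step_isometry T k k' l l' : step_in T l -> step_in T l' ->
  E (step_integral (W k) l) (step_integral (W k') l') =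
  if k == k' then ip mu `[0, T] (step_fun l) (step_fun l') else 0.
Proof.
move=> hl hl'; have sl := sqint_step_integral k hl; have sl' := sqint_step_integral k' hl'.
move: (hl) (hl') => /allP al /allP al'.
have mI : measurable (`[0, T] : set (measurableTypeR R)) by exact: measurable_itv.
rewrite {1}/step_integral ip_suml //; last first.
  move=> p pl; apply: sqintZ => //; have /and3P[? ? ?] := al _ pl; exact: (noise_sqint nW).
rewrite [in RHS]/step_fun [in RHS]ip_suml //; last 2 first.
- by move=> p _; apply: sqintZ => //; exact: sqint_indic.
- exact: sqint_step_fun.
transitivity (\sum_(p <- l) (if k == k' then
    ip mu `[0, T] (fun s => p.1.1 * \1_`]p.1.2, p.2] s) (step_fun l') else 0)); last first.
  by case: eqP => // _; rewrite big1.
apply: eq_big_seq => p pl; have /and3P[p1 p2 p3] := al _ pl.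
have sp := noise_sqint nW k p1 p2.
rewrite (ipZl mT p.1.1 sp sl') (ipZl mI p.1.1 (sqint_indic T p.1.2 p.2) (sqint_step_fun T l')).
rewrite /step_integral ip_sumr //; last first.
  move=> q ql; apply: sqintZ => //; have /and3P[? ? ?] := al' _ ql; exact: (noise_sqint nW).
rewrite [in RHS]/step_fun [in RHS]ip_sumr //; last 2 first.
- by move=> q _; apply: sqintZ => //; exact: sqint_indic.
- exact: sqint_indic.
transitivity (p.1.1 * \sum_(q <- l') (if k == k' then
    ip mu `[0, T] (\1_`]p.1.2, p.2]) (fun s => q.1.1 * \1_`]q.1.2, q.2] s) else 0)); last first.
  by case: eqP => // _; rewrite big1 ?mulr0.
congr (_ * _); apply: eq_big_seq => q ql; have /and3P[q1 q2 q3] := al' _ ql.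
have sq := noise_sqint nW k' q1 q2.
rewrite (ipZr mT q.1.1 sq sp) (ipZr mI q.1.1 (sqint_indic T q.1.2 q.2) (sqint_indic T p.1.2 p.2)).
by rewrite (@ip_incr_indic _ _ T) //; case: eqP => // _; rewrite mulr0.
Qed.

End isometry.

(** * Stochastic integrals of deterministic functions *)

Lemma cvge0_lt (R : realType) (f : nat -> \bar R) (e : R) : 0 < e ->
  f n @[n --> \oo] --> 0%E -> \forall n \near \oo, (f n < e%:E)%E.
Proof.
move=> e0 /fine_cvgP[fin cv].
have h : \forall n \near \oo, fine (f n) < e by apply: (cvgr_lt _ cv).
by apply: filterS2 fin h => n fn; rewrite -{2}(fineK fn) lte_fin.
Qed.

Lemma sum_ord_tail0 (R : pzSemiRingType) (f : nat -> R) (m n : nat) : (m <= n)%N ->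
  (forall k, (m <= k)%N -> f k = 0) -> \sum_(k < n) f k = \sum_(k < m) f k.
Proof.
move=> mn f0; rewrite -!(big_mkord xpredT f) (big_cat_nat (leq0n m) mn) //=.
rewrite [X in _ + X]big_nat_cond [X in _ + X]big1 ?addr0 // => i.
by rewrite andbT => /andP[mi _]; exact: f0.
Qed.

Section sums_in_L2.
Context d (T : measurableType d) (R : realType).
Variable mu : {measure set T -> \bar R}.
Variable D : set T.
Hypothesis mD : measurable D.

Lemma ip_sum_ord m (f : nat -> T -> R) : (forall i, (i < m)%N -> sqint mu D (f i)) ->
  ip mu D (fun x => \sum_(i < m) f i x) (fun x => \sum_(i < m) f i x) =
  \sum_(i < m) \sum_(j < m) ip mu D (f i) (f j).
Proof.
move=> h; have hs := sqint_sum_ord mD h.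
rewrite ip_suml_ord //; apply: eq_bigr => i _.
by rewrite ip_sumr_ord //; exact: h.
Qed.

Lemma ip_orthogonal_sum m (f : nat -> T -> R) :
  (forall i, (i < m)%N -> sqint mu D (f i)) ->
  (forall i j, (i < m)%N -> (j < m)%N -> i != j -> ip mu D (f i) (f j) = 0) ->
  ip mu D (fun x => \sum_(i < m) f i x) (fun x => \sum_(i < m) f i x) =
  \sum_(i < m) ip mu D (f i) (f i).
Proof.
move=> h o; rewrite ip_sum_ord //; apply: eq_bigr => i _.
rewrite (bigD1 i) //= big1 ?addr0 // => j ji.
by apply: o => //; rewrite eq_sym.
Qed.

Lemma ip_sum_le m (f : nat -> T -> R) : (forall i, (i < m)%N -> sqint mu D (f i)) ->
  ip mu D (fun x => \sum_(i < m) f i x) (fun x => \sum_(i < m) f i x) <=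
  m%:R * \sum_(i < m) ip mu D (f i) (f i).
Proof.
move=> h; rewrite ip_sum_ord //.
apply: (@le_trans _ _ (\sum_(i < m) \sum_(j < m) ((ip mu D (f i) (f i) + ip mu D (f j) (f j)) / 2))).
  apply: ler_sum => i _; apply: ler_sum => j _.
  by apply: le_trans (ler_norm _) _; apply: ip_absM => //; exact: h.
set S := \sum_(i < m) ip mu D (f i) (f i).
rewrite (eq_bigr (fun i : 'I_m => m%:R / 2 * ip mu D (f i) (f i) + S / 2)); last first.
  move=> i _; rewrite -mulr_suml big_split /= sumr_const card_ord -mulr_natl -/S; ring.
rewrite big_split /= -mulr_sumr -/S sumr_const card_ord -[S / 2 *+ m]mulr_natl.
by rewrite (_ : _ + _ = m%:R * S) //; field.
Qed.

End sums_in_L2.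

Section stochastic_integral_error.
Context d (Omega : measurableType d) (R : realType) (P : probability Omega R).
Variables (F : R -> set (set Omega)) (W : nat -> R -> Omega -> R).
Hypothesis nW : noise P F W.
Notation E := (ip P setT).
Notation mu := (@lebesgue_measure R).
Notation EL t := (ip mu `[0, t]).

Let mT : measurable (setT : set Omega). Proof. exact: measurableT. Qed.
Let mI (t : R) : measurable (`[0, t] : set (measurableTypeR R)).
Proof. exact: measurable_itv. Qed.

Lemma stoch_integral_approx k (f : R -> R) t J (e : R) : 0 < e ->
  sqint mu `[0, t] f -> is_stoch_integral P (W k) f t J ->
  sqint P setT J /\ exists l, [/\ step_in t l,
    E (fun w => J w - step_integral (W k) l w) (fun w => J w - step_integral (W k) l w) <= e &
    EL t (fun s => f s - step_fun l s) (fun s => f s - step_fun l s) <= e].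
Proof.
move=> e0 sf [mJ [phi [hphi c1 c2]]].
have := filterI (cvge0_lt e0 c1) (cvge0_lt e0 c2).
move=> [n _ /(_ n (leqnn n))] /= [h1 h2].
have sA := sqint_step_integral nW k (hphi n).
move: h2; rewrite unlock => h2.
have sJA : sqint P setT (fun w => J w - step_integral (W k) (phi n) w).
  split; last exact: lt_trans h2 (ltry _).
  by apply: measurable_funB => //; case: sA.
have sJ : sqint P setT J.
  have := sqintD mT sJA sA; congr sqint; apply/funext => w; by rewrite subrK.
split=> //; exists (phi n); split; first exact: hphi.
  by rewrite -lee_fin -ip_sqE // ltW.
rewrite -lee_fin -ip_sqE ?(ltW h1) //.
exact: (sqintB (mI t) sf (sqint_step_fun t (phi n))).
Qed.

Lemma step_diff_isometry t k k' l1 l2 l1' l2' :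
  step_in t l1 -> step_in t l2 -> step_in t l1' -> step_in t l2' ->
  E (fun w => step_integral (W k) l1 w - step_integral (W k) l2 w)
    (fun w => step_integral (W k') l1' w - step_integral (W k') l2' w) =
  if k == k' then EL t (fun s => step_fun l1 s - step_fun l2 s)
                       (fun s => step_fun l1' s - step_fun l2' s) else 0.
Proof.
move=> h1 h2 h1' h2'.
have s1 := sqint_step_integral nW k h1; have s2 := sqint_step_integral nW k h2.
have s1' := sqint_step_integral nW k' h1'; have s2' := sqint_step_integral nW k' h2'.
have sf := sqint_step_fun t.
rewrite (ipBl mT s1 s2 (sqintB mT s1' s2')) (ipBr mT s1' s2' s1) (ipBr mT s1' s2' s2).
rewrite (ipBl (mI t) (sf l1) (sf l2) (sqintB (mI t) (sf l1') (sf l2'))).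
rewrite (ipBr (mI t) (sf l1') (sf l2') (sf l1)) (ipBr (mI t) (sf l1') (sf l2') (sf l2)).
rewrite !(step_isometry nW (T := t)) //; case: eqP => _; ring.
Qed.

(** The stochastic integral is a double limit: of series of integrals, and of step
   functions in each of them. The error to a sum of step integrals is split into the
   tail of the series, the approximation errors of the first [m] integrals, and a sum
   of orthogonal differences of step integrals, which the isometry turns into the
   assumed bound [C]. Two applications of $(x+y)^2 \le 2x^2+2y^2$ and one more inside
   the isometric sum account for the factor $8$. *)
Lemma stoch_integral_seq_error (sg : R -> nat -> R) t I M (l : nat -> seq (R * R * R)) (C : R) :
  is_stoch_integral_seq P W sg t I ->
  (forall k, step_in t (l k)) -> (forall k, (M <= k)%N -> l k = [::]) ->
  (forall k, sqint mu `[0, t] (fun s => sg s k)) ->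
  (forall m, \sum_(k < m) EL t (fun s => sg s k - step_fun (l k) s)
                              (fun s => sg s k - step_fun (l k) s) <= C) ->
  let err w := I w - \sum_(k < M) step_integral (W k) (l k) w in
  sqint P setT err /\ E err err <= 8 * C.
Proof.
move=> [mI0 [J [hJ cI]]] hl l0 ssg hC err.
have sl k : sqint P setT (step_integral (W k) (l k)) by exact: (sqint_step_integral nW).
have sJ k : sqint P setT (J k).
  by have [] := stoch_integral_approx ltr01 (ssg k) (hJ k).
have sSJ m : sqint P setT (fun w => \sum_(k < m) J k w) by exact: sqint_sum_ord.
have sSl m : sqint P setT (fun w => \sum_(k < m) step_integral (W k) (l k) w).
  by apply: (@sqint_sum_ord _ _ _ _ _ mT m (fun k => step_integral (W k) (l k))).
have sIS (m : nat) : ('E_P[(fun w => (I w - \sum_(k < m) J k w) ^+ 2)%R] < +oo)%E ->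
    sqint P setT (fun w => I w - \sum_(k < m) J k w).
  rewrite unlock => h; split=> //; apply: measurable_funB => //; by case: (sSJ m).
have sI : sqint P setT I.
  have [m _ /(_ m (leqnn m))] := cvge0_lt ltr01 cI => /= h.
  have := sqintD mT (sIS m (lt_trans h (ltry _))) (sSJ m).
  by congr sqint; apply/funext => w; rewrite subrK.
have serr : sqint P setT err := sqintB mT sI (sSl M).
split=> //; apply/ler_addgt0Pr => eta eta0.
(* the errors below add up to [8 * C] and 14 multiples of this quantity *)
have eta1 : 0 < eta / 14 by lra.
have [m0 _ hm0] := cvge0_lt eta1 cI.
pose m := maxn m0 M; have /= hm := hm0 m (leq_maxl _ _).
have sIm := sIS m (lt_trans hm (ltry _)).
have IS : E (fun w => I w - \sum_(k < m) J k w) (fun w => I w - \sum_(k < m) J k w) <= eta / 14.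
  by rewrite -lee_fin -ip_sqE //; move: hm; rewrite unlock => /ltW.
(* the errors of the [m] integrals are not known to be orthogonal: their sum costs a
   factor [m], and there are [m] of them *)
pose e := eta / 14 / (m.+1)%:R ^+ 2.
have e0 : 0 < e by rewrite divr_gt0 // exprn_gt0 // ltr0n.
have /choice [ph hph] : forall k, exists ph, [/\ step_in t ph,
    E (fun w => J k w - step_integral (W k) ph w) (fun w => J k w - step_integral (W k) ph w) <= e &
    EL t (fun s => sg s k - step_fun ph s) (fun s => sg s k - step_fun ph s) <= e].
  by move=> k; have [] := stoch_integral_approx e0 (ssg k) (hJ k).
have php k : step_in t (ph k) by have [] := hph k.
have sp k : sqint P setT (step_integral (W k) (ph k)) by exact: (sqint_step_integral nW).
pose G1 w := \sum_(k < m) (J k w - step_integral (W k) (ph k) w).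
pose G2 w := \sum_(k < m) (step_integral (W k) (ph k) w - step_integral (W k) (l k) w).
have sG1 : sqint P setT G1.
  by apply: (@sqint_sum_ord _ _ _ _ _ mT m (fun k w => J k w - step_integral (W k) (ph k) w)) => k _;
    exact: sqintB.
have sG2 : sqint P setT G2.
  by apply: (@sqint_sum_ord _ _ _ _ _ mT m (fun k w => step_integral (W k) (ph k) w - step_integral (W k) (l k) w)) => k _;
    exact: sqintB.
have mle : m%:R * (m%:R * e) <= eta / 14.
  rewrite mulrA /e mulrCA ger_pMr; last lra.
  rewrite ler_pdivrMr ?exprn_gt0 ?ltr0n // mul1r -expr2 lerXn2r ?nnegrE ?ler0n //.
  by rewrite ler_nat.
have mle1 : m%:R * e <= eta / 14.
  have [->|m1] := posnP m; first by rewrite mul0r; lra.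
  apply: le_trans mle; apply: ler_peMl; last by rewrite ler1n.
  by rewrite mulr_ge0 ?ler0n ?(ltW e0).
have b1 : E G1 G1 <= eta / 14.
  apply: le_trans (@ip_sum_le _ _ _ _ _ mT m (fun k w => J k w - step_integral (W k) (ph k) w) _) _.
    by move=> k _; exact: sqintB.
  apply: le_trans mle; rewrite ler_wpM2l //.
  apply: le_trans (ler_sum _ (G := fun=> e) _) _; last by rewrite sumr_const card_ord mulr_natl.
  by move=> k _; have [] := hph k.
have b2 : E G2 G2 <= 2 * (eta / 14) + 2 * C.
  rewrite (@ip_orthogonal_sum _ _ _ _ _ mT m (fun k w => step_integral (W k) (ph k) w - step_integral (W k) (l k) w)).
  - apply: (@le_trans _ _ (\sum_(k < m) (2 * e + 2 * EL t (fun s => sg s k - step_fun (l k) s)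
                              (fun s => sg s k - step_fun (l k) s)))).
      apply: ler_sum => k _; rewrite (@step_diff_isometry t) // eqxx.
      have s1 := sqintB (mI t) (ssg k) (sqint_step_fun t (ph k)).
      have s2 := sqintB (mI t) (ssg k) (sqint_step_fun t (l k)).
      rewrite (_ : EL t _ _ = EL t (fun s => - (sg s k - step_fun (ph k) s) + (sg s k - step_fun (l k) s))
        (fun s => - (sg s k - step_fun (ph k) s) + (sg s k - step_fun (l k) s))); last first.
        by apply: eq_ip => s _; ring.
      apply: le_trans (ip_young (mI t) (sqintN (mI t) s1) s2) _.
      rewrite lerD2r ler_pM2l // (ipNl (mI t) s1 (sqintN (mI t) s1)).
      rewrite ipC (ipNl (mI t) s1 s1) opprK.
      by have [] := hph k.
    rewrite big_split /= sumr_const card_ord (_ : 2 * e *+ m = 2 * (m%:R * e)); last first.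
      by rewrite -mulr_natl; ring.
    rewrite -mulr_sumr.
    by apply: lerD; rewrite ler_pM2l //; exact: hC.
  - by move=> k _; exact: sqintB.
  - by move=> i j _ _ ij; rewrite (@step_diff_isometry t) // (negbTE ij).
have e3 : err = fun w => (I w - \sum_(k < m) J k w) + (G1 w + G2 w).
  apply/funext => w; rewrite /err /G1 /G2 !sumrB.
  rewrite (sum_ord_tail0 (f := fun k => step_integral (W k) (l k) w) (leq_maxr m0 M)); first by ring.
  by move=> k Mk; rewrite l0 // /step_integral big_nil.
rewrite e3; apply: le_trans (ip_young mT sIm (sqintD mT sG1 sG2)) _.
have := ip_young mT sG1 sG2; lra.
Qed.

End stochastic_integral_error.

(** * The diffusion coefficient in $\ell^2$ *)

Section l2_norm.
Variable R : realType.
Implicit Types u v : nat -> R.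

Lemma l2normE v : l2norm v = sqrte (\sum_(0 <= i <oo) ((v i) ^+ 2)%:E)%E.
Proof.
rewrite /l2norm Lnorm_counting // poweR12_sqrt.
  congr sqrte; apply: eq_eseriesr => i _; rewrite -[(EFin \o v) i]/((v i)%:E) abse_EFin.
  by rewrite poweR_EFin powR_mulrn // real_normK // num_real.
by apply: nneseries_ge0 => i _ _; rewrite poweR_ge0.
Qed.

Lemma l2norm_sq v : (l2norm v ^+ 2 = \sum_(0 <= i <oo) ((v i) ^+ 2)%:E)%E.
Proof.
rewrite l2normE sqr_sqrte //.
by apply: nneseries_ge0 => i _ _; rewrite lee_fin sqr_ge0.
Qed.

Lemma l2norm_ge0 v : (0 <= l2norm v)%E.
Proof. by rewrite l2normE sqrte_ge0. Qed.

Lemma l2norm_triangle u v : (l2norm (fun i => (u i + v i)%R) <= l2norm u + l2norm v)%E.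
Proof. by apply: (@minkowski_EFin _ _ _ (@counting nat R) u v 2) => //; rewrite ler1n. Qed.

Lemma l2normN v : l2norm (fun i => - v i) = l2norm v.
Proof.
by rewrite !l2normE; congr sqrte; apply: eq_eseriesr => i _; rewrite sqrrN.
Qed.

Lemma l2norm_sum_le v (c : R) m : (l2norm v <= c%:E)%E -> \sum_(i < m) (v i) ^+ 2 <= c ^+ 2.
Proof.
move=> vc; have c0 : (0 <= c) by rewrite -lee_fin (le_trans (l2norm_ge0 v)).
have h : (l2norm v ^+ 2 <= (c ^+ 2)%:E)%E.
  by rewrite expe2 expr2 EFinM lee_pmul // l2norm_ge0.
rewrite -lee_fin; apply: le_trans h; rewrite l2norm_sq.
apply: le_trans (nneseries_lim_ge m _); last by move=> i _ _; rewrite lee_fin sqr_ge0.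
by rewrite big_mkord sumEFin.
Qed.

Lemma l2norm_proj_sq M v : (l2norm (l2proj M v) ^+ 2 = (\sum_(i < M) (v i) ^+ 2)%:E)%E.
Proof.
rewrite l2norm_sq (@nneseries_split _ _ 0 M); last by move=> i _; rewrite lee_fin sqr_ge0.
rewrite add0n [X in (_ + X)%E]eseries0 ?adde0; last first.
  by move=> i Mi _; rewrite /l2proj ltnNge Mi /= expr0n.
rewrite big_mkord -sumEFin; apply: eq_bigr => i _.
by rewrite /l2proj ltn_ord.
Qed.

End l2_norm.

Section diffusion.
Variables (R : realType) (T C2 : R) (delta : nat -> R) (sigma : R -> nat -> R).
Hypothesis T0 : 0 < T.
Hypothesis C0 : 0 < C2.
Hypothesis hs : diffusion_conditions T C2 delta sigma.

Definition snorm (t : R) : R := fine (l2norm (sigma t)).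
(** A bound for $\|\sigma(t)\|$ on $[0,T]$. *)
Definition sbound : R := C2 * (1 + T).

Lemma sbound_gt0 : 0 < sbound. Proof. by rewrite mulr_gt0 // addr_gt0. Qed.

Lemma snormE t : t \in `[0, T] -> l2norm (sigma t) = (snorm t)%:E.
Proof.
move=> tT; rewrite /snorm fineK // ge0_fin_numE ?l2norm_ge0 //.
exact: (diffusion_l2 hs tT).
Qed.

Lemma snorm_ge0 t : 0 <= snorm t. Proof. by rewrite fine_ge0 // l2norm_ge0. Qed.

Let Lip (s t : R) : s \in `[0, T] -> t \in `[0, T] -> snorm t - snorm s <= C2 * `|t - s|.
Proof.
move=> sT tT; rewrite lerBlDr -lee_fin EFinD -!snormE //.
apply: le_trans (leeD2r _ (diffusion_lipschitz hs tT sT)).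
apply: le_trans (l2norm_triangle _ _).
rewrite (_ : (fun i => _) = sigma t) //.
by apply/funext => i; rewrite subrK.
Qed.

Lemma snorm_lip s t : s \in `[0, T] -> t \in `[0, T] -> `|snorm t - snorm s| <= C2 * `|t - s|.
Proof.
move=> sT tT; rewrite ler_norml; apply/andP; split; last exact: Lip.
by rewrite lerNl opprB distrC; exact: Lip.
Qed.

Let zT : 0 \in `[0, T]. Proof. by rewrite in_itv /= lexx ltW. Qed.

Lemma snorm_le t : t \in `[0, T] -> snorm t <= sbound.
Proof.
move=> tT; have := Lip zT tT; have : snorm 0 <= C2.
  by rewrite -lee_fin -snormE //; exact: (diffusion_init hs).
move: tT; rewrite in_itv /= subr0 => /andP[t0 tT]; rewrite ger0_norm // /sbound.
have h : C2 * t <= C2 * T by rewrite ler_pM2l.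
lra.
Qed.

Lemma sum_sigma_le t m : t \in `[0, T] -> \sum_(k < m) (sigma t k) ^+ 2 <= sbound ^+ 2.
Proof. by move=> tT; apply: l2norm_sum_le; rewrite snormE // lee_fin snorm_le. Qed.

Lemma sigma_lip k s t : s \in `[0, T] -> t \in `[0, T] ->
  `|sigma t k - sigma s k| <= C2 * `|t - s|.
Proof.
move=> sT tT; have := l2norm_sum_le k.+1 (diffusion_lipschitz hs tT sT).
rewrite big_ord_recr /= => h.
have h2 : (sigma t k - sigma s k) ^+ 2 <= (C2 * `|t - s|) ^+ 2.
  by apply: le_trans h; rewrite lerDr sumr_ge0 // => i _; rewrite sqr_ge0.
by rewrite -ler_sqr ?nnegrE ?mulr_ge0 ?(ltW C0) // real_normK // num_real.
Qed.

(** Freezing the time and truncating to $M$ components costs the time increment and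
   the tail $\delta(M)$. *)
Lemma sum_sigma_error s t M m : s \in `[0, T] -> t \in `[0, T] -> (0 < M)%N ->
  \sum_(k < m) (sigma s k - (if (k < M)%N then sigma t k else 0)) ^+ 2 <=
  2 * (C2 * `|s - t|) ^+ 2 + 2 * (C2 * delta M) ^+ 2.
Proof.
move=> sT tT M0.
apply: (@le_trans _ _ (\sum_(k < m) (2 * (sigma s k - sigma t k) ^+ 2 +
   2 * (sigma t k - l2proj M (sigma t) k) ^+ 2))).
  apply: ler_sum => k _; rewrite -/(l2proj M (sigma t) k).
  have := sqr_ge0 ((sigma s k - sigma t k) - (sigma t k - l2proj M (sigma t) k)).
  by rewrite !expr2; nra.
rewrite big_split /= -!mulr_sumr; apply: lerD; rewrite ler_pM2l //.
- exact: (l2norm_sum_le m (diffusion_lipschitz hs sT tT)).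
- exact: (l2norm_sum_le m (diffusion_tail hs M0 tT)).
Qed.

Lemma sum_sigma_tail t K m : t \in `[0, T] -> (0 < K)%N ->
  \sum_(k < m) (if (k < K)%N then 0 else sigma t k) ^+ 2 <= (C2 * delta K) ^+ 2.
Proof.
move=> tT K0; apply: le_trans (l2norm_sum_le m (diffusion_tail hs K0 tT)).
by apply: ler_sum => k _; rewrite /l2proj; case: ifP => _; rewrite ?subrr ?subr0 ?expr0n.
Qed.

Lemma sum_sigma_snorm s t M : s \in `[0, T] -> t \in `[0, T] -> (0 < M)%N ->
  `|\sum_(k < M) (sigma t k) ^+ 2 - snorm s ^+ 2| <=
  2 * sbound * (C2 * `|s - t| + C2 * delta M).
Proof.
move=> sT tT M0; set p := fine (l2norm (l2proj M (sigma t))).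
have pfin : l2norm (l2proj M (sigma t)) = p%:E.
  rewrite /p fineK // ge0_fin_numE ?l2norm_ge0 //.
  have := l2norm_proj_sq M (sigma t); case: (l2norm (l2proj M (sigma t))) => [r|//|//].
  by move=> _; exact: ltry.
have p0 : 0 <= p by rewrite fine_ge0 // l2norm_ge0.
have pE : \sum_(k < M) (sigma t k) ^+ 2 = p ^+ 2.
  by apply: EFin_inj; rewrite -l2norm_proj_sq pfin.
have pB : p <= sbound.
  by rewrite -ler_sqr ?nnegrE ?(ltW sbound_gt0) // -pE sum_sigma_le.
have tail := diffusion_tail hs M0 tT.
have p_lt : p - snorm t <= C2 * delta M.
  rewrite lerBlDr -lee_fin EFinD -pfin -snormE //.
  apply: le_trans (leeD2r _ tail); rewrite -[X in (_ <= X + _)%E]l2normN.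
  apply: le_trans (l2norm_triangle _ _).
  by rewrite (_ : (fun i => _) = l2proj M (sigma t)) //; apply/funext => i; ring.
have t_lt : snorm t - p <= C2 * delta M.
  rewrite lerBlDr -lee_fin EFinD -pfin -snormE //.
  apply: le_trans (leeD2r _ tail).
  apply: le_trans (l2norm_triangle _ _).
  by rewrite (_ : (fun i => _) = sigma t) //; apply/funext => i; ring.
have l := snorm_lip tT sT; rewrite pE.
have h : `|p - snorm s| <= C2 * `|s - t| + C2 * delta M.
  by move: l; rewrite !ler_norml => /andP[l1 l2]; apply/andP; split; lra.
have sB := snorm_le sT; have s0 := snorm_ge0 s.
rewrite subr_sqr normrM mulrC ler_pM //.
by rewrite ger0_norm; lra.
Qed.

End diffusion.

(** * The equidistant mesh *)

Section mesh.
Variables (R : realType) (T : R) (n : nat).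
Hypothesis T0 : 0 < T.
Hypothesis n0 : (0 < n)%N.
Notation tm := (mesh T n).
Notation mu := (@lebesgue_measure R).

Let nR : 0 < n%:R :> R. Proof. by rewrite ltr0n. Qed.

Definition mstep : R := T / n%:R.

Lemma mstep_gt0 : 0 < mstep. Proof. by rewrite divr_gt0. Qed.

Lemma mstep_le : mstep <= T.
Proof. by rewrite ler_pdivrMr // ler_peMr ?(ltW T0) // ler1n. Qed.

Lemma meshE j : tm j = j%:R * mstep.
Proof. by rewrite /mesh /mstep mulrCA mulrA. Qed.

Lemma meshS j : tm j.+1 = tm j + mstep.
Proof. by rewrite !meshE -natr1 mulrDl mul1r. Qed.

Lemma mesh0 : tm 0 = 0. Proof. by rewrite meshE mul0r. Qed.

Lemma meshn : tm n = T.
Proof. by rewrite /mesh mulfK // gt_eqF. Qed.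

Lemma mesh_le i j : (i <= j)%N -> tm i <= tm j.
Proof. by move=> ij; rewrite !meshE ler_wpM2r ?(ltW mstep_gt0) // ler_nat. Qed.

Lemma mesh_ge0 j : 0 <= tm j.
Proof. by rewrite -mesh0 mesh_le. Qed.

Lemma mesh_leT j : (j <= n)%N -> tm j <= T.
Proof. by move=> jn; rewrite -[leRHS]meshn mesh_le. Qed.

Lemma mesh_in j : (j <= n)%N -> tm j \in `[0, T].
Proof. by move=> jn; rewrite in_itv /= mesh_ge0 mesh_leT. Qed.

(** The index of the cell that contains [t], capped so that [T] lies in the last one. *)
Definition cell (t : R) : nat := minn (Num.truncn (t * n%:R / T)) n.-1.

Lemma cell_lt t : (cell t < n)%N.
Proof. by rewrite /cell (leq_ltn_trans (geq_minr _ _)) // prednK. Qed.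

Let scaled t j : (j%:R <= t * n%:R / T) = (tm j <= t).
Proof.
by rewrite ler_pdivlMr // meshE /mstep mulrA ler_pdivrMr //.
Qed.

Lemma cell_itv t : t \in `[0, T] -> tm (cell t) <= t <= tm (cell t).+1.
Proof.
rewrite in_itv /= => /andP[t0 tT].
have q0 : 0 <= t * n%:R / T by rewrite divr_ge0 ?(ltW T0) // mulr_ge0 ?ler0n.
have /andP[h1 h2] := truncn_itv q0.
apply/andP; split.
  rewrite -scaled; apply: le_trans h1.
  by rewrite ler_nat geq_minl.
rewrite /cell; case: (leqP (Num.truncn (t * n%:R / T)) n.-1) => h.
  by apply: ltW; rewrite ltNge -scaled -ltNge.
by rewrite prednK // meshn.
Qed.

Lemma cellE t j : (j < n)%N -> tm j <= t < tm j.+1 -> cell t = j.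
Proof.
move=> jn /andP[h1 h2].
have t0 : 0 <= t by apply: le_trans h1; exact: mesh_ge0.
rewrite /cell (@truncn_def _ _ j); last by rewrite scaled h1 ltNge scaled -ltNge.
by apply/minn_idPl; rewrite -ltnS prednK.
Qed.

Lemma cell_mono s t : s <= t -> (cell s <= cell t)%N.
Proof.
move=> st; rewrite /cell leq_min geq_minr andbT.
apply: leq_trans (geq_minl _ _) _; apply: le_truncn.
by rewrite ler_pM2r ?invr_gt0 // ler_pM2r.
Qed.

Lemma measurable_cell_eq i : measurable [set t : measurableTypeR R | cell t = i].
Proof.
apply: is_interval_measurable => x y /= xi yi z /andP[xz zy].
apply/eqP; rewrite eqn_leq; apply/andP; split; [rewrite -yi|rewrite -xi]; exact: cell_mono.
Qed.

(** The cells open on the left, which match the step functions of the integrals,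
   whereas [cell] follows the convention closed on the left. *)
Lemma left_cell s : 0 < s -> s <= T -> exists2 j, (j < n)%N & tm j < s <= tm j.+1.
Proof.
move=> s0; rewrite -[X in _ <= X]meshn.
suff H m : s <= tm m -> exists2 j, (j < m)%N & tm j < s <= tm j.+1 by exact: H.
elim: m => [|m IH]; first by rewrite mesh0 leNgt s0.
have [sm _|ms sm] := leP s (tm m).
  by have [j jm hj] := IH sm; exists j => //; exact: ltnW.
by exists m; rewrite // ms.
Qed.

Section cellwise_integral.
Variable phi : nat -> R -> R.
Hypothesis phi_int : forall i, (i < n)%N -> mu.-integrable `[0, T] (EFin \o phi i).

Let mI : measurable (`[0, T] : set (measurableTypeR R)). Proof. exact: measurable_itv. Qed.

Let C i : set (measurableTypeR R) := [set t | cell t = i].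
Let piece i (s : R) := \1_(C i) s * phi i s.

Let phi_piece s : phi (cell s) s = \sum_(i < n) piece i s.
Proof.
rewrite (bigD1 (Ordinal (cell_lt s))) //= big1 ?addr0.
  by rewrite /piece indicE mem_set ?mul1r.
move=> i ic; rewrite /piece indicE memNset ?mul0r // => h.
by move: ic; rewrite -val_eqE /= -h eqxx.
Qed.

Let piece_int i : (i < n)%N -> mu.-integrable `[0, T] (EFin \o piece i).
Proof.
move=> ltin; have := phi_int ltin; apply: le_integrable => //.
  apply/measurable_EFinP; apply: measurable_funM.
    by apply: measurable_indic; exact: measurable_cell_eq.
  by apply/measurable_EFinP; apply: (measurable_int mu); exact: phi_int.
move=> x _ /=; rewrite lee_fin normrM indicE.
by case: (_ \in _); rewrite ?normr1 ?normr0 ?mul1r ?mul0r.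
Qed.

Let piece_integral i : (i < n)%N ->
  \int[mu]_(s in `[0, T]) piece i s = \int[mu]_(s in `[tm i, tm i.+1]) phi i s.
Proof.
move=> ltin.
have -> : \int[mu]_(s in `[0, T]) piece i s = \int[mu]_(s in `[0, T] `&` C i) phi i s.
  rewrite Rintegral_mkcondr; apply: eq_Rintegral => s _.
  by rewrite /piece patchE indicE; case: ifP => _; rewrite ?mul1r ?mul0r.
have sub1 : `[tm i, tm i.+1[ `<=` (`[0, T] `&` C i : set R).
  move=> x /=; rewrite !in_itv /= => h; move: (h) => /andP[h1 h2]; split; last exact: cellE.
  by rewrite (le_trans (mesh_ge0 i)) //= ltW // (lt_le_trans h2) // mesh_leT.
have sub2 : (`[0, T] `&` C i : set R) `<=` `[tm i, tm i.+1].
  by move=> x /= [/cell_itv + ci]; rewrite in_itv /= ci.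
have [h|h] := pselect (C i (tm i.+1)).
  congr (Rintegral _ _ _); apply/seteqP; split=> // x /=.
  rewrite in_itv /= => /andP[h1]; rewrite le_eqVlt => /predU1P[->|h2].
    by split=> //; apply: mesh_in.
  by apply: sub1; rewrite /= in_itv /= h1 h2.
rewrite -Rintegral_itv_bndo_bndc; last first.
  apply: integrableS (phi_int ltin) => // x /sub1; by case.
congr (Rintegral _ _ _); apply/seteqP; split=> // x hx.
have := sub2 _ hx; rewrite /= !in_itv /= => /andP[-> /=].
rewrite le_eqVlt => /predU1P[xE|//].
by case: hx => _; rewrite xE.
Qed.

Let phi_fun : (fun s => phi (cell s) s) = fun s => \sum_(i < n) piece i s.
Proof. by apply/funext => s; exact: phi_piece. Qed.

Lemma integrable_cellwise : mu.-integrable `[0, T] (EFin \o (fun s => phi (cell s) s)).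
Proof.
rewrite phi_fun (_ : _ \o _ = fun s => (\sum_(i < n) (piece i s)%:E)%E); last first.
  by apply/funext => s /=; rewrite sumEFin.
by apply: integrable_sum => // i _; exact: piece_int.
Qed.

Lemma Rintegral_cellwise : \int[mu]_(s in `[0, T]) phi (cell s) s =
  \sum_(i < n) \int[mu]_(s in `[tm i, tm i.+1]) phi i s.
Proof.
rewrite phi_fun /Rintegral; under eq_integral do rewrite -sumEFin.
rewrite integral_sum //; last by move=> i; exact: piece_int.
rewrite -sum_fine => [|i _].
  by apply: eq_bigr => i _; exact: piece_integral.
by apply: integrable_fin_num => //; exact: piece_int.
Qed.

End cellwise_integral.

End mesh.

(** * The drift coefficient *)

(** Used with a retraction onto an interval, to extend continuous paths to the line. *)
Lemma continuous_within_comp (X Y Z : topologicalType) (D : set Y) (f : Y -> Z) (g : X -> Y) :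
  continuous g -> (forall x, D (g x)) -> {within D, continuous f} -> continuous (fun x => f (g x)).
Proof.
move=> cg gD /subspace_continuousP cf x.
have h : g y @[y --> x] --> within D (nbhs (g x)).
  move=> U hU; have hn : \forall y \near x, D (g y) -> U (g y) := cg x _ hU.
  by apply: filterS hn => y; apply; exact: gD.
exact: (cvg_comp _ _ h (cf _ (gD x))).
Qed.

Section drift.
Variables (R : realType) (T C1 : R) (a : R -> R -> R).
Hypothesis C0 : 0 < C1.
Hypothesis ha : drift_conditions T C1 a.

Lemma lipschitz_measurable (f : R -> R) (K : R) :
  (forall x y, `|f x - f y| <= K * `|x - y|) -> continuous f /\ measurable_fun setT f.
Proof.
move=> lf; have cf : continuous f.
  move=> x; apply/cvgrPdist_lt => e e0.
  have K0 : 0 < `|K| + 1 by rewrite ltr_wpDl.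
  near=> y; apply: le_lt_trans (lf _ _) _.
  apply: (@le_lt_trans _ _ ((`|K| + 1) * `|x - y|)).
    by rewrite ler_wpM2r // (le_trans (ler_norm K)) // lerDl.
  rewrite mulrC -ltr_pdivlMr //; near: y.
  apply: cvgr_dist_lt; last by rewrite divr_gt0.
  exact: cvg_id.
by split=> //; exact: continuous_measurable_fun.
Unshelve. all: by end_near. Qed.

Lemma drift_measurable t : t \in `[0, T] -> measurable_fun setT (a t).
Proof.
move=> tT; have [] // := @lipschitz_measurable (a t) C1.
by move=> x y; exact: (drift_lipschitz ha).
Qed.

Lemma drift_growth (t x : R) : t \in `[0, T] -> `|a t x| <= C1 * (1 + `|x|).
Proof.
move=> tT; have := drift_lipschitz ha x 0 tT; have := drift_bound ha tT.
rewrite subr0 mulrDr mulr1 => h1 h2.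
rewrite -[a t x](subrK (a t 0)); apply: le_trans (ler_normD _ _) _; lra.
Qed.

Lemma drift_derivable (t x : R) : t \in `[0, T] -> derivable (a t) x 1.
Proof. by case: (drift_C12 ha) => _ _ [h _] _ tT; exact: h. Qed.

Lemma drift_derivative_bound (t x : R) : t \in `[0, T] -> `|derive1 (a t) x| <= C1.
Proof.
move=> tT; have := drift_derivable (x := x) tT => /cvg_ex[l hl].
have -> : derive1 (a t) x = l.
  by rewrite derive1E; apply: cvg_lim => //; exact: hl.
have hn : `|h^-1 *: (a t (h *: 1 + x) - a t x)| @[h --> 0^'] --> `|l : R|.
  by apply: cvg_norm; exact: hl.
apply: (cvgr_to_le hn); near=> h.
have h0 : h != 0 by near: h; exact: nbhs_dnbhs_neq.
rewrite /GRing.scale /= normrM normfV ler_pdivrMl ?normr_gt0 //.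
apply: le_trans (drift_lipschitz ha _ _ tT) _.
by rewrite addrK mulr1 mulrC.
Unshelve. all: by end_near. Qed.

Lemma drift_derivative_measurable t : t \in `[0, T] -> measurable_fun setT (derive1 (a t)).
Proof.
move=> tT; have [] // := @lipschitz_measurable (derive1 (a t)) C1.
by move=> x y; exact: (drift_derivative_lipschitz ha).
Qed.

Let is_d (t x : R) : t \in `[0, T] -> is_derive x 1 (a t) (derive1 (a t) x).
Proof.
by move=> tT; apply: DeriveDef; [exact: drift_derivable|rewrite derive1E].
Qed.

Let taylor_lt (t x y : R) : t \in `[0, T] -> x < y ->
  exists2 c, x <= c <= y & a t y - a t x = derive1 (a t) c * (y - x).
Proof.
move=> tT xy.
have [|c cI e] := MVT xy (fun z _ => is_d z tT).
  apply: continuous_subspaceT => z.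
  by have [] := @lipschitz_measurable (a t) C1 (fun x y => drift_lipschitz ha x y tT).
by exists c => //; move: cI; rewrite in_itv /= => /andP[? ?]; rewrite !ltW.
Qed.

Lemma drift_taylor (t x h : R) : t \in `[0, T] ->
  `|a t (x + h) - a t x - derive1 (a t) x * h| <= C1 * h ^+ 2.
Proof.
move=> tT; suff [c cx e] : exists2 c, `|c - x| <= `|h| &
    a t (x + h) - a t x = derive1 (a t) c * h.
  rewrite e -mulrBl normrM -real_normK ?num_real // expr2 mulrA.
  rewrite ler_wpM2r //; apply: le_trans (drift_derivative_lipschitz ha _ _ tT) _.
  by rewrite ler_pM2l.
have [h0|h0|->] := ltgtP h 0.
- have xh : x + h < x by rewrite gtrDl.
  have [c /andP[c1 c2] e] := taylor_lt tT xh; exists c.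
    by rewrite (ltr0_norm h0) ler_norml; apply/andP; split; lra.
  have e2 : derive1 (a t) c * (x - (x + h)) = - (derive1 (a t) c * h) by ring.
  by rewrite e2 in e; lra.
- have xh : x < x + h by rewrite ltrDl.
  have [c /andP[c1 c2] e] := taylor_lt tT xh; exists c.
    by rewrite (gtr0_norm h0) ler_norml; apply/andP; split; lra.
  by rewrite e; congr (_ * _); ring.
- by exists x; rewrite ?subrr // addr0 subrr mulr0.
Qed.

Lemma drift_path_continuous (g x : R -> R) : continuous g -> continuous x ->
  (forall s, g s \in `[0, T]) -> continuous (fun s => a (g s) (x s)).
Proof.
move=> cg cx gT; case: (drift_C12 ha) => ca _ _ _.
apply: (@continuous_within_comp _ _ _ (`[0, T] `*` [set: R]) (fun p : R * R => a p.1 p.2) (fun s => (g s, x s))) => //.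
- by move=> s; exact: (cvg_pair (cg s) (cx s)).
- by move=> s; split=> //=; exact: gT.
Qed.

End drift.

(** * Time integrals of jointly measurable processes *)

Section joint_measurability.
Context d (Omega : measurableType d) (R : realType).
Notation mu := (@lebesgue_measure R).
Implicit Types (H K : R -> Omega -> R).

Definition jmeas H :=
  measurable_fun setT (fun p : measurableTypeR R * Omega => H p.1 p.2).

Lemma jmeas_time H w : jmeas H -> measurable_fun setT (fun s : measurableTypeR R => H s w).
Proof.
move=> mH; exact: (measurableT_comp mH (measurable_pair2 w)).
Qed.

Lemma jmeas_omega H s : jmeas H -> measurable_fun setT (H s).
Proof. by move=> mH; exact: (measurableT_comp mH (measurable_pair1 s)). Qed.

Lemma jmeas_select (H : nat -> R -> Omega -> R) (c : R -> nat) :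
  (forall i, measurable [set s : measurableTypeR R | c s = i]) ->
  (forall i, jmeas (H i)) -> jmeas (fun s w => H (c s) s w).
Proof.
move=> mc mH _ B mB; rewrite setTI.
rewrite (_ : _ @^-1` B = \bigcup_i
   (fst @^-1` [set s : measurableTypeR R | c s = i] `&`
    (fun p : measurableTypeR R * Omega => H i p.1 p.2) @^-1` B)).
  apply: bigcup_measurable => i _; apply: measurableI.
    by rewrite -[X in measurable X]setTI; exact: measurable_fst.
  by rewrite -[X in measurable X]setTI; exact: mH.
apply/seteqP; split=> [p /= h|p [i _ [/= <-]] //].
by exists (c p.1).
Qed.

(** Functions that are measurable in the sample point and continuous in time
   (Carathéodory functions) are limits of their piecewise constant
   interpolations in time. *)
Lemma jmeas_continuous H : (forall w, continuous (H^~ w)) ->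
  (forall s, measurable_fun setT (H s)) -> jmeas H.
Proof.
move=> cH mH.
pose g m (s : R) : R := (Num.floor (s * m.+1%:R))%:~R / m.+1%:R.
apply: (measurable_fun_cvg (h := fun m p => H (g m p.1) p.2)).
  move=> m _ B mB; rewrite setTI.
  rewrite (_ : _ @^-1` B = \bigcup_(i in [set: int])
    (fst @^-1` [set s : measurableTypeR R | Num.floor (s * m.+1%:R) = i] `&`
     snd @^-1` (H (i%:~R / m.+1%:R) @^-1` B))); last first.
    apply/seteqP; split=> [p /= h|p [i _ [/= h1 h2]]].
      by exists (Num.floor (p.1 * m.+1%:R)).
    by rewrite /g h1.
  apply: countable_bigcupT_measurable => [|i]; first exact: countableP.
  apply: measurableI.
    rewrite -[X in measurable X]setTI; apply: measurable_fst => //.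
    apply: is_interval_measurable => x y /= xi yi z /andP[xz zy].
    apply: le_anti; apply/andP; split; [rewrite -yi|rewrite -xi];
      by apply: le_floor; rewrite ler_pM2r.
  rewrite -[X in measurable X]setTI; apply: measurable_snd => //.
  by rewrite -[X in measurable X]setTI; exact: mH.
move=> [s w] _ /=; suff hg : g m s @[m --> \oo] --> s by exact: (cvg_comp _ _ hg (cH w s)).
have hl : s - (m.+1%:R)^-1 @[m --> \oo] --> s.
  rewrite -[X in _ --> X]subr0; apply: cvgB; first exact: cvg_cst.
  exact: cvg_harmonic.
apply: (squeeze_cvgr _ hl (cvg_cst s)); apply: nearW => m.
have m0 : 0 < m.+1%:R :> R by rewrite ltr0n.
have /andP[h1 h2] := floor_itv (s * m.+1%:R).
rewrite /g ler_pdivrMr // h1 andbT.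
rewrite ler_pdivlMr // mulrBl mulVf ?gt_eqF // lerBlDr.
by apply: ltW; move: h2; rewrite intrD.
Qed.

Lemma jmeasD H K : jmeas H -> jmeas K -> jmeas (fun s w => H s w + K s w).
Proof. exact: measurable_funD. Qed.

Lemma jmeasB H K : jmeas H -> jmeas K -> jmeas (fun s w => H s w - K s w).
Proof. exact: measurable_funB. Qed.

Lemma jmeasM H K : jmeas H -> jmeas K -> jmeas (fun s w => H s w * K s w).
Proof. exact: measurable_funM. Qed.

Lemma jmeasX H n : jmeas H -> jmeas (fun s w => H s w ^+ n).
Proof. exact: measurable_funX. Qed.

Lemma jmeas_static (f : Omega -> R) : measurable_fun setT f -> jmeas (fun _ => f).
Proof. by move=> mf; apply: (measurableT_comp mf); exact: measurable_snd. Qed.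

Lemma jmeas_indic (A : set (measurableTypeR R)) : measurable A -> jmeas (fun s _ => \1_A s).
Proof.
move=> mA; apply: (@measurableT_comp _ _ _ _ _ _ (\1_A : measurableTypeR R -> R)).
  exact: measurable_indic.
exact: measurable_fst.
Qed.

End joint_measurability.

Section time_integrals.
Context d (Omega : measurableType d) (R : realType) (P : probability Omega R).
Notation mu := (@lebesgue_measure R).
Implicit Types (H K : R -> Omega -> R) (t b : R).

Let mT : measurable (setT : set Omega). Proof. exact: measurableT. Qed.
Let mI t : measurable (`[0, t] : set (measurableTypeR R)).
Proof. exact: measurable_itv. Qed.

Let onI t K (p : measurableTypeR R * Omega) : \bar R := (\1_(`[0, t] : set R) p.1 * K p.1 p.2)%:E.

Let monI t K : jmeas K -> measurable_fun setT (onI t K).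
Proof.
move=> mK; apply/measurable_EFinP; apply: measurable_funM => //.
exact: (jmeas_indic (mI t)).
Qed.

Let onI_ge0 t K p : (forall s w, 0 <= K s w) -> (0 <= onI t K p)%E.
Proof. by move=> K0; rewrite lee_fin mulr_ge0 // indicE. Qed.

Let onI_time t (f : R -> R) :
  (\int[mu]_s (\1_(`[0%R, t] : set R) s * f s)%:E = \int[mu]_(s in `[0%R, t]) (f s)%:E)%E.
Proof.
rewrite [RHS]integral_mkcond; apply: eq_integral => s _.
by rewrite patchE indicE; case: ifP => _; rewrite ?mul1r ?mul0r.
Qed.

Lemma tonelli_time K t : jmeas K -> (forall s w, 0 <= K s w) ->
  (\int[P]_w \int[mu]_(s in `[0%R, t]) (K s w)%:E =
   \int[mu]_(s in `[0%R, t]) \int[P]_w (K s w)%:E)%E.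
Proof.
move=> mK K0; have := @fubini_tonelli _ _ _ _ _ mu P (onI t K) (monI t mK) (fun p => onI_ge0 t p K0).
move=> h; transitivity (\int[P]_w \int[mu]_s onI t K (s, w))%E.
  by apply: eq_integral => w _; rewrite -onI_time.
rewrite -h [RHS]integral_mkcond; apply: eq_integral => s _.
rewrite patchE /onI /= indicE; case: ifP => sI.
  by under eq_integral do rewrite mul1r.
by under eq_integral do rewrite mul0r; rewrite integral0.
Qed.

Lemma measurable_ge0_integral_time K t : jmeas K -> (forall s w, 0 <= K s w) ->
  measurable_fun setT (fun w => \int[mu]_(s in `[0%R, t]) (K s w)%:E)%E.
Proof.
move=> mK K0.
have := @measurable_fun_fubini_tonelli_G _ _ _ _ _ mu (onI t K) (monI t mK) (fun p => onI_ge0 t p K0).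
by congr measurable_fun; apply/funext => w; rewrite /fubini_G /onI /= onI_time.
Qed.

Lemma measurable_ge0_integral_omega K : jmeas K -> (forall s w, 0 <= K s w) ->
  measurable_fun setT (fun s : measurableTypeR R => \int[P]_w (K s w)%:E)%E.
Proof.
move=> mK K0.
apply: (@measurable_fun_fubini_tonelli_F _ _ _ _ _ P (fun p : measurableTypeR R * Omega => (K p.1 p.2)%:E)).
  exact/measurable_EFinP.
by move=> p; rewrite lee_fin.
Qed.

Definition time_int H t (w : Omega) : R := \int[mu]_(s in `[0, t]) H s w.

Lemma measurable_time_int H t : jmeas H -> measurable_fun setT (time_int H t).
Proof.
move=> mH; apply: measurableT_comp; first exact: fine_measurable.
rewrite (_ : (fun w => _) = fun w => (\int[mu]_(s in `[0%R, t]) (Num.max (H s w) 0)%:E -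
   \int[mu]_(s in `[0%R, t]) (Num.max (- H s w) 0)%:E)%E); last first.
  apply/funext => w; rewrite integralE; congr (_ - _)%E.
    by apply: eq_integral => s _; rewrite funeposE -EFin_max.
  by apply: eq_integral => s _; rewrite funenegE -EFinN -EFin_max.
apply: emeasurable_funB.
  apply: (@measurable_ge0_integral_time (fun s w => Num.max (H s w) 0)).
    exact: measurable_maxr.
  by move=> s w; rewrite le_max lexx orbT.
apply: (@measurable_ge0_integral_time (fun s w => Num.max (- H s w) 0)).
  by apply: measurable_maxr => //; exact: measurableT_comp.
by move=> s w; rewrite le_max lexx orbT.
Qed.

Lemma mu_itv0 t : 0 <= t -> mu `[0, t] = t%:E.
Proof.
move=> t0; rewrite [LHS](lebesgue_measure_itv (`[0, t] : interval R)) /= lte_fin.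
case: ltP => [_|h]; first by rewrite oppr0 adde0.
by congr EFin; apply: le_anti; rewrite t0 h.
Qed.

Lemma sqr_time_int_le (h : R -> R) t : 0 <= t -> measurable_fun `[0, t] (h : measurableTypeR R -> R) ->
  (((\int[mu]_(s in `[0, t]) h s) ^+ 2)%:E <= t%:E * \int[mu]_(s in `[0%R, t]) ((h s) ^+ 2)%:E)%E.
Proof.
rewrite le_eqVlt => /predU1P[<- mh|t0 mh].
  by rewrite set_itv1 Rintegral_set1 expr0n mul0e.
have [hoo|hoo] := eqVneq (\int[mu]_(s in `[0%R, t]) ((h s) ^+ 2)%:E)%E +oo%E.
  by rewrite hoo mulry gtr0_sg // mul1e leey.
have sh : sqint mu `[0, t] h by split=> //; rewrite ltey.
have s1 : sqint mu `[0, t] (fun _ => 1 : R).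
  by apply: sqint_cst => //; rewrite [X in (X < _)%E](mu_itv0 (ltW t0)) ltry.
rewrite ip_sqE // -EFinM lee_fin.
set c := \int[mu]_(s in _) h s.
have cE : ip mu `[0, t] h (fun _ => 1) = c.
  by apply: eq_Rintegral => s _; rewrite mulr1.
have e1 : ip mu `[0, t] (fun _ => 1) (fun _ => 1 : R) = t.
  rewrite /ip (@eq_Rintegral _ _ _ mu _ (fun _ => 1)) => [|s _]; last by rewrite mulr1.
  by rewrite Rintegral_cst // mul1r [X in fine X](mu_itv0 (ltW t0)).
have a1 := sqintZ (mI t) t sh; have a2 := sqintZ (mI t) c s1.
have := ip_ge0 mu `[0, t] (fun s => t * h s - c * 1).
rewrite (ipBl (mI t) a1 a2 (sqintB (mI t) a1 a2)) (ipBr (mI t) a1 a2 a1) (ipBr (mI t) a1 a2 a2).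
rewrite (ipZl (mI t) t sh a1) (ipZr (mI t) t sh sh) (ipZl (mI t) t sh a2) (ipZr (mI t) c s1 sh).
rewrite (ipZl (mI t) c s1 a1) (ipZr (mI t) t sh s1) (ipZl (mI t) c s1 a2) (ipZr (mI t) c s1 s1).
rewrite (ipC _ _ (fun=> 1)) cE e1 => hh.
have : 0 <= t * (t * ip mu `[0, t] h h - c ^+ 2) by move: hh; nra.
by rewrite pmulr_rge0 // subr_ge0.
Qed.

Lemma integral_time_le (f : R -> \bar R) t b : 0 <= t ->
  (forall s, 0 <= f s)%E -> measurable_fun setT (f : measurableTypeR R -> \bar R) ->
  (forall s, 0 <= s -> s <= t -> (f s <= b%:E)%E) ->
  (\int[mu]_(s in `[0%R, t]) f s <= (t * b)%:E)%E.
Proof.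
move=> t0 f0 mf fb.
apply: (@le_trans _ _ (\int[mu]_(s in `[0%R, t]) (cst b%:E s))%E).
  apply: ge0_le_integral => //.
  - exact: measurable_funTS.
  - by move=> s; rewrite /= in_itv /= => /andP[? ?]; exact: fb.
by rewrite integral_cst // [X in (_ * X)%E](mu_itv0 t0) -EFinM mulrC.
Qed.

(** Cauchy-Schwarz in time, then Tonelli. *)
Lemma time_int_L2 H t b : 0 <= t -> jmeas H ->
  (forall s, 0 <= s -> s <= t -> (\int[P]_w ((H s w) ^+ 2)%:E <= b%:E)%E) ->
  sqint P setT (time_int H t) /\ ip P setT (time_int H t) (time_int H t) <= t ^+ 2 * b.
Proof.
move=> t0 mH Hb.
have key : (\int[P]_w ((time_int H t w) ^+ 2)%:E <= (t ^+ 2 * b)%:E)%E.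
  apply: (@le_trans _ _ (\int[P]_w (t%:E * \int[mu]_(s in `[0%R, t]) ((H s w) ^+ 2)%:E))%E).
    apply: ge0_le_integral => //.
    - by move=> w _; rewrite lee_fin sqr_ge0.
    - by apply: measurable_sqE; exact: measurable_time_int.
    - apply: measurable_funeM; apply: measurable_ge0_integral_time; first exact: jmeasX.
      by move=> s w; rewrite sqr_ge0.
    - move=> w _; apply: sqr_time_int_le => //; apply: measurable_funTS; exact: jmeas_time.
  rewrite ge0_integralZl_EFin //.
  - rewrite tonelli_time; [|exact: jmeasX|by move=> *; rewrite sqr_ge0].
    rewrite expr2 -mulrA EFinM lee_wpmul2l ?lee_fin //.
    apply: integral_time_le => //.
    + by move=> s; apply: integral_ge0 => w _; rewrite lee_fin sqr_ge0.
    + apply: (@measurable_ge0_integral_omega (fun s w => H s w ^+ 2)); first exact: jmeasX.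
      by move=> *; rewrite sqr_ge0.
  - by move=> w _; apply: integral_ge0 => s _; rewrite lee_fin sqr_ge0.
  - by apply: (@measurable_ge0_integral_time (fun s w => H s w ^+ 2)); [exact: jmeasX|move=> *; rewrite sqr_ge0].
have sq : sqint P setT (time_int H t).
  by split; [exact: measurable_time_int|exact: le_lt_trans key (ltry _)].
by split=> //; rewrite -lee_fin -ip_sqE.
Qed.

Let integrable_onI H t b (xi : Omega -> R) : 0 <= t -> jmeas H ->
  (forall s, 0 <= s -> s <= t -> (\int[P]_w ((H s w) ^+ 2)%:E <= b%:E)%E) ->
  sqint P setT xi ->
  (mu \x P)%E.-integrable setT (onI t (fun s w => H s w * xi w)).
Proof.
move=> t0 mH Hb sxi; have [mxi _] := sxi.
have mHx : jmeas (fun s w => H s w * xi w) by apply: jmeasM => //; exact: jmeas_static.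
apply/(integrable12ltyP mu P (monI t mHx)).
pose K s w := `|H s w * xi w|.
have mK : jmeas K by apply: measurableT_comp.
rewrite (_ : \int[mu]_s _ = \int[mu]_(s in `[0%R, t]) \int[P]_w (K s w)%:E)%E; last first.
  rewrite [RHS]integral_mkcond; apply: eq_integral => s _.
  rewrite patchE /onI /= indicE; case: ifP => sI.
    by apply: eq_integral => w _; rewrite mul1r.
  by rewrite integral0_eq // => w _; rewrite mul0r /= normr0.
apply: le_lt_trans (integral_time_le (b := b + ip P setT xi xi) t0 _ _ _) (ltry _).
- by move=> s; apply: integral_ge0 => w _; rewrite lee_fin /K.
- by apply: measurable_ge0_integral_omega => // s w; rewrite /K.
- move=> s s0 st; have mHs := jmeas_omega s mH.
  apply: (@le_trans _ _ (\int[P]_w (((H s w) ^+ 2)%:E + ((xi w) ^+ 2)%:E))%E).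
    apply: ge0_le_integral => //.
    + by move=> w _; rewrite lee_fin /K.
    + by apply/measurable_EFinP; exact: (jmeas_omega s mK).
    + by apply: emeasurable_funD; apply: measurable_sqE.
    + move=> w _; rewrite -EFinD lee_fin /K normrM.
      rewrite -(real_normK (num_real (H s w))) -(real_normK (num_real (xi w))).
      have := sqr_ge0 (`|H s w| - `|xi w|).
      have := normr_ge0 (H s w); have := normr_ge0 (xi w); nra.
  rewrite ge0_integralD //; [|by move=> *; rewrite lee_fin sqr_ge0|exact: measurable_sqE
    |by move=> *; rewrite lee_fin sqr_ge0|exact: measurable_sqE].
  by rewrite EFinD -ip_sqE // leeD2r // Hb.
Qed.

(** Pairing with a fixed square-integrable variable commutes with time
   integration (Fubini). *)
Lemma ip_time_int H t b (xi : Omega -> R) : 0 <= t -> jmeas H ->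
  (forall s, 0 <= s -> s <= t -> (\int[P]_w ((H s w) ^+ 2)%:E <= b%:E)%E) ->
  sqint P setT xi ->
  mu.-integrable `[0, t] (EFin \o (fun s => ip P setT (H s) xi)) /\
  ip P setT (time_int H t) xi = \int[mu]_(s in `[0, t]) ip P setT (H s) xi.
Proof.
move=> t0 mH Hb sxi; have [mxi _] := sxi.
have int_f := integrable_onI t0 mH Hb sxi.
have sH s : s \in `[0, t] -> sqint P setT (H s).
  rewrite in_itv /= => /andP[s0 st]; split; first exact: jmeas_omega.
  exact: le_lt_trans (Hb _ s0 st) (ltry _).
have sG : sqint P setT (time_int H t) by have [] := time_int_L2 t0 mH Hb.
have innerE s : (\int[P]_w onI t (fun s w => (H s w * xi w)%R) (s, w) =
    (\1_(`[0%R, t] : set R) s * ip P setT (H s) xi)%:E)%E.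
  rewrite /onI /= indicE; case: (boolP (s \in _)) => [/set_mem sI|_].
    by rewrite mul1r; under eq_integral do rewrite mul1r; rewrite ipE //; exact: sH.
  by rewrite mul0r; under eq_integral do rewrite mul0r; rewrite integral0.
have i1 : mu.-integrable `[0, t] (EFin \o (fun s => ip P setT (H s) xi)).
  have := integrable_fubini_F int_f; rewrite /fubini_F => h.
  apply/integrable_mkcond => //; apply: eq_integrable h => // s _.
  rewrite innerE patchE indicE; case: ifP => _; by rewrite ?mul1r ?mul0r.
split=> //; apply: EFin_inj; rewrite -ipE //.
rewrite /Rintegral fineK ?integrable_fin_num // -onI_time.
under [RHS]eq_integral do rewrite -innerE.
rewrite Fubini //; apply: ae_eq_integral => //.
- by apply/measurable_EFinP; apply: measurable_funM => //; case: sG.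
- exact: (measurable_fubini_G int_f).
have sub1 : sqint P setT (fun _ : Omega => 1 : R) by exact: sqint_prob_cst.
have := ae_integrable2 (integrable_onI t0 mH Hb sub1).
apply: filterS => w hw _; rewrite /onI /= onI_time.
have iH : mu.-integrable `[0, t] (EFin \o (fun s => H s w)).
  apply/integrable_mkcond => //; apply: eq_integrable hw => // s _.
  by rewrite /onI patchE indicE /= mulr1; case: ifP => _; rewrite ?mul1r ?mul0r.
under eq_integral do rewrite mulrC EFinM.
by rewrite integralZl // EFinM muleC /time_int /Rintegral fineK // integrable_fin_num.
Qed.

End time_integrals.


(** * A Gronwall inequality in $L^2([0,T])$ *)

Section gronwall.
Variable R : realType.
Notation mu := (@lebesgue_measure R).
Implicit Types (f e r : R -> R).

Lemma continuous_integrable f (u v : R) : continuous f -> mu.-integrable `[u, v] (EFin \o f).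
Proof.
move=> cf; apply: continuous_compact_integrable; first exact: segment_compact.
exact: continuous_subspaceT.
Qed.

Lemma continuous_sqint f (t : R) : continuous f -> sqint mu `[0, t] f.
Proof.
move=> cf; split.
  apply: (measurable_funTS (D := `[0, t])); exact: continuous_measurable_fun.
have c2 : continuous (fun s => f s ^+ 2).
  by move=> s; apply: (cvg_comp f (fun x => x ^+ 2)); [exact: cf|exact: exprn_continuous].
by apply: integrable_lty => //; exact: continuous_integrable.
Qed.

Let deriv f (T x : R) : continuous f -> 0 < x -> x < T ->
  is_derive x 1 (fun t => \int[mu]_(s in `[0, t]) f s) (f x).
Proof.
move=> cf x0 xT.
have [|h1 h2] := @continuous_FTC1_closed _ f 0 x T xT (continuous_integrable 0 T cf) x0.
  exact: cf.
by apply: DeriveDef; [exact: h1|rewrite -derive1E h2].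
Qed.

Let cint f (T : R) : continuous f -> 0 <= T ->
  {within `[0, T], continuous (fun t => \int[mu]_(s in `[0, t]) f s)}.
Proof.
move=> cf T0; exact: (parameterized_integral_continuous T0 (continuous_integrable 0 T cf)).
Qed.

(** The function $e^{-kt}\int_0^t f - \int_0^t g$ is non-increasing. *)
Let gron (f g : R -> R) (T k : R) : 0 < T -> 0 <= k -> continuous f -> continuous g ->
  (forall t, 0 <= g t) ->
  (forall t, 0 <= t -> t <= T -> f t <= g t + k * \int[mu]_(s in `[0, t]) f s) ->
  \int[mu]_(s in `[0, T]) f s <= expR (k * T) * \int[mu]_(s in `[0, T]) g s.
Proof.
move=> T0 k0 cf cg g0 H.
pose F t := \int[mu]_(s in `[0, t]) f s.
pose G t := \int[mu]_(s in `[0, t]) g s.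
pose E t := expR (- k * t).
have dE (x : R) : is_derive x 1 E (- k * E x).
  have h : is_derive x 1 (fun t : R => - k * t) (- k).
    apply: is_derive_eq; by rewrite /GRing.scale /= mulr1.
  rewrite mulrC; exact: (@is_derive1_comp _ (@expR R) (fun t => - k * t) x _ _ (is_derive_expR _) h).
pose psi t := E t * F t - G t.
have dpsi x : x \in `]0, T[ -> is_derive x 1 psi (E x * (f x - k * F x) - g x).
  rewrite in_itv /= => /andP[x0 xT].
  have dF := deriv cf x0 xT; have dG := deriv cg x0 xT; have dEx := dE x.
  have h1 : is_derive x 1 (fun t => E t * F t) (E x *: f x + F x *: (- k * E x)).
    exact: (@is_deriveM _ _ E F).
  apply: (is_derive_eq (@is_deriveB _ _ _ (fun t => E t * F t) G _ _ _ _ h1 dG)).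
  by rewrite /GRing.scale /=; ring.
have Eone t : 0 <= t -> E t <= 1.
  by move=> t0; rewrite /E expR_le1 mulNr oppr_le0 mulr_ge0.
have T0' := ltW T0.
have cpsi : {within `[0, T], continuous psi}.
  move=> x; apply: cvgB; last exact: (cint cg T0').
  apply: cvgM; last exact: (cint cf T0').
  apply: continuous_subspaceT => y.
  apply: (cvg_comp (fun t => - k * t) expR); last exact: continuous_expR.
  by apply: cvgM; [exact: cvg_cst|exact: cvg_id].
have hpsi : psi T <= psi 0.
  apply: (@ler0_derive1_nincr _ psi 0 T) => //.
  - by move=> x /dpsi [].
  - move=> x xI; have [_] := dpsi x xI; rewrite -derive1E => ->.
    move: xI; rewrite in_itv /= => /andP[x0 xT].
    have Ht := H x (ltW x0) (ltW xT).
    have h : E x * (f x - k * F x) <= E x * g x.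
      by rewrite ler_pM2l ?expR_gt0 // lerBlDr.
    have h' : E x * g x <= 1 * g x by rewrite ler_wpM2r // Eone // ltW.
    lra.
move: hpsi; rewrite /psi /F /G set_itv1 !Rintegral_set1 mulr0 subrr subr_le0 => h.
rewrite -ler_pdivrMl ?expR_gt0 // -expRN.
by move: h; rewrite /E mulNr.
Qed.

(** By Cauchy-Schwarz, $e^2 \le 2 r^2 + 2 C^2 T \int_0^t e^2$; only integrals over time
   of $r^2$ enter, and these can be averaged over the sample space without a supremum. *)
Lemma gronwall_L2 (e r : R -> R) (T C : R) : 0 < T -> 0 <= C -> continuous e -> continuous r ->
  (forall t, 0 <= t -> t <= T -> `|e t| <= `|r t| + C * \int[mu]_(s in `[0, t]) `|e s|) ->
  \int[mu]_(s in `[0, T]) (e s) ^+ 2 <=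
  2 * expR (2 * C ^+ 2 * T * T) * \int[mu]_(s in `[0, T]) (r s) ^+ 2.
Proof.
move=> T0 C0 ce cr H.
have sqc f : continuous f -> continuous (fun s => f s ^+ 2).
  by move=> cf s; apply: (cvg_comp f (fun x => x ^+ 2)); [exact: cf|exact: exprn_continuous].
have ce2 := sqc _ ce; have cr2 := sqc _ cr.
have c2r : continuous (fun s => 2 * r s ^+ 2) by move=> s; apply: cvgM; [exact: cvg_cst|exact: cr2].
have := @gron (fun s => e s ^+ 2) (fun s => 2 * r s ^+ 2) T (2 * C ^+ 2 * T) T0 _ ce2 c2r _ _.
rewrite RintegralZl //; last exact: continuous_integrable.
move=> h; rewrite (_ : 2 * expR _ * _ =
    expR (2 * C ^+ 2 * T * T) * (2 * \int[mu]_(s in `[0, T]) (r s) ^+ 2)); last by ring.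
apply: h.
- by rewrite !mulr_ge0 ?sqr_ge0 // ltW.
- by move=> t; rewrite mulr_ge0 ?sqr_ge0.
move=> t t0 tT.
have cn : continuous (fun s => `|e s|).
  by move=> s; apply: cvg_norm; exact: ce.
have hs := sqr_time_int_le (h := fun s => `|e s|) t0 (sqint_meas (continuous_sqint t cn)).
set A := \int[mu]_(s in `[0, t]) `|e s| in hs.
set B := \int[mu]_(s in `[0, t]) e s ^+ 2.
have hB : A ^+ 2 <= t * B.
  move: hs; rewrite (_ : \int[mu]_(s in _) _ = B%:E)%E -?EFinM ?lee_fin //.
  under eq_integral do rewrite real_normK ?num_real //.
  by rewrite /B /Rintegral fineK // integrable_fin_num //; exact: continuous_integrable.
have A0 : 0 <= A by apply: Rintegral_ge0.
have B0 : 0 <= B by apply: Rintegral_ge0 => s _; rewrite sqr_ge0.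
have hB' : A ^+ 2 <= T * B by apply: le_trans hB _; rewrite ler_wpM2r.
have := H t t0 tT; rewrite -/A => h.
have h1 : `|e t| ^+ 2 <= (`|r t| + C * A) ^+ 2.
  by rewrite lerXn2r ?nnegrE ?addr_ge0 ?mulr_ge0.
have h2 : C ^+ 2 * A ^+ 2 <= C ^+ 2 * (T * B) by rewrite ler_wpM2l ?sqr_ge0.
rewrite -(real_normK (num_real (e t))) -(real_normK (num_real (r t))).
have := sqr_ge0 (`|r t| - C * A); move: h1 h2; rewrite !expr2; lra.
Qed.

End gronwall.

(** * The Euler scheme and its time-continuous extension *)

Section domination.
Context d (T : measurableType d) (R : realType) (P : probability T R).
Let mT : measurable (setT : set T). Proof. exact: measurableT. Qed.

Lemma sqint_dominated n (c : nat -> R) (g : nat -> T -> R) (f : T -> R) :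
  measurable_fun setT f -> (forall i, (i < n)%N -> 0 <= c i) ->
  (forall i, (i < n)%N -> sqint P setT (g i)) ->
  (forall w, (f w) ^+ 2 <= \sum_(i < n) c i * (g i w) ^+ 2) ->
  sqint P setT f /\ ip P setT f f <= \sum_(i < n) c i * ip P setT (g i) (g i).
Proof.
move=> mf c0 sg fg.
have key : (\int[P]_w ((f w) ^+ 2)%:E <= (\sum_(i < n) c i * ip P setT (g i) (g i))%:E)%E.
  apply: (@le_trans _ _ (\int[P]_w (\sum_(i < n) (c i * (g i w) ^+ 2)%:E))%E).
    apply: ge0_le_integral => //.
    - by move=> w _; rewrite lee_fin sqr_ge0.
    - exact: measurable_sqE.
    - apply: emeasurable_sum => i; apply/measurable_EFinP; apply: measurable_funM => //.
      by apply: measurable_funX; case: (sg _ (ltn_ord i)).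
    - by move=> w _; rewrite sumEFin lee_fin.
  rewrite ge0_integral_sum //; last 2 first.
  - move=> i; apply/measurable_EFinP; apply: measurable_funM => //.
    by apply: measurable_funX; case: (sg _ (ltn_ord i)).
  - by move=> i w _; rewrite lee_fin mulr_ge0 ?sqr_ge0 // c0.
  rewrite -sumEFin; apply: lee_sum => i _.
  under eq_integral do rewrite EFinM.
  rewrite ge0_integralZl_EFin ?c0 //; last 2 first.
  - by move=> w _; rewrite lee_fin sqr_ge0.
  - by apply: measurable_sqE; case: (sg _ (ltn_ord i)).
  by rewrite ip_sqE ?EFinM //; exact: sg.
have sf : sqint P setT f by split=> //; exact: le_lt_trans key (ltry _).
by split=> //; rewrite -lee_fin -ip_sqE.
Qed.

Lemma ip_prob_cst (c : R) : ip P setT (fun _ => c) (fun _ => c) = c ^+ 2.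
Proof.
rewrite /ip Rintegral_cst // [X in fine X](_ : _ = 1%E) ?mulr1 ?expr2 //.
exact: probability_setT.
Qed.

End domination.

Lemma sqr_sum_le (R : realFieldType) m (x : nat -> R) :
  (\sum_(k < m) x k) ^+ 2 <= m%:R * \sum_(k < m) (x k) ^+ 2.
Proof.
elim: m => [|m IH]; first by rewrite !big_ord0 mul0r expr0n.
rewrite !big_ord_recr /=.
have [->|m0] := posnP m; first by rewrite !big_ord0 !add0r mul1r.
set s := \sum_(k < m) x k in IH *; set q := \sum_(k < m) x k ^+ 2 in IH *.
have m0' : 0 < m%:R :> R by rewrite ltr0n.
have h : s ^+ 2 / m%:R <= q by rewrite ler_pdivrMr // mulrC.
have h2 : (s + x m) ^+ 2 <= (m%:R + 1) * (s ^+ 2 / m%:R + x m ^+ 2).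
  rewrite -subr_ge0 (_ : _ - _ = (s - m%:R * x m) ^+ 2 / m%:R); last first.
    by field; rewrite gt_eqF.
  by rewrite divr_ge0 ?sqr_ge0 // ltW.
apply: le_trans h2 _; rewrite -natr1; apply: ler_wpM2l; first by rewrite addr_ge0.
by rewrite lerD2r.
Qed.

Lemma continuous_sum_ord (R : realType) n (f : nat -> R -> R) :
  (forall i, continuous (f i)) -> continuous (fun x => \sum_(i < n) f i x).
Proof.
move=> cf; elim: n => [|n IH] x.
  by under eq_fun do rewrite big_ord0; exact: cvg_cst.
under eq_fun do rewrite big_ord_recr /=.
by apply: cvgD; [exact: IH|exact: cf].
Qed.

Section clamp.
Variables (R : realType) (T : R).
Hypothesis T0 : 0 < T.

(** The retraction onto $[0,T]$, used to extend paths continuously to the whole line. *)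
Definition clamp (s : R) : R := Num.max 0 (Num.min s T).

Lemma clamp_in s : clamp s \in `[0, T].
Proof. by rewrite in_itv /= /clamp le_max lexx /= ge_max ltW //= ge_min lexx orbT. Qed.

Lemma clampE s : s \in `[0, T] -> clamp s = s.
Proof. by rewrite in_itv /= => /andP[h1 h2]; rewrite /clamp min_l // max_r. Qed.

Lemma clamp_ge0 s : 0 <= clamp s.
Proof. by have := clamp_in s; rewrite in_itv /= => /andP[]. Qed.

Lemma clamp_lip s t : `|clamp s - clamp t| <= `|s - t|.
Proof.
wlog st : s t / s <= t => [H|].
  by have [/H //|/ltW /H] := leP s t; rewrite distrC [X in _ <= X]distrC.
have t0 := ltW T0.
suff /andP[h1 h2] : 0 <= clamp t - clamp s <= t - s 
  by rewrite distrC (distrC s) !ger0_norm // subr_ge0.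
rewrite /clamp; case: (leP s T) => h1; case: (leP t T) => h2; rewrite ?(max_r t0);
  do ?[case: (leP 0 t) => h4]; do ?[case: (leP 0 s) => h3]; apply/andP; split; lra.
Qed.

Lemma continuous_clamp : continuous clamp.
Proof.
move=> s; apply: (@continuous_max _ _ (fun=> 0) (fun s => Num.min s T)); first exact: cvg_cst.
by apply: (@continuous_min _ _ id (fun=> T)); [exact: cvg_id|exact: cvg_cst].
Qed.

End clamp.

Section euler.
Context d (Omega : measurableType d) (R : realType) (P : probability Omega R).
Variables (F : R -> set (set Omega)) (W : nat -> R -> Omega -> R).
Variables (T x0 C1 C2 : R) (delta : nat -> R) (a : R -> R -> R) (sigma : R -> nat -> R).
Hypothesis nW : noise P F W.
Hypothesis cW : forall k w, continuous (fun t => W k t w).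
Hypothesis mW : forall k t, measurable_fun setT (W k t).
Hypothesis T0 : 0 < T.
Hypothesis C10 : 0 < C1.
Hypothesis C20 : 0 < C2.
Hypothesis ha : drift_conditions T C1 a.
Hypothesis hs : diffusion_conditions T C2 delta sigma.
Variables (n M : nat).
Hypothesis n0 : (0 < n)%N.
Notation E := (ip P setT).
Notation tm := (mesh T n).
Notation h := (mstep T n).
Notation Y := (euler T x0 a sigma W M n).
Notation S := (sbound T C2).

Let mT : measurable (setT : set Omega). Proof. exact: measurableT. Qed.

(** The increment over $[s,t]$ of the first [m] processes, with frozen coefficients. *)
Definition lin (m : nat) (c : nat -> R) (s t : R) (w : Omega) : R :=
  \sum_(k < m) c k * incr (W k) s t w.

Lemma euler_step j w : Y j.+1 w = Y j w + a (tm j) (Y j w) * h + lin M (sigma (tm j)) (tm j) (tm j.+1) w.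
Proof.
rewrite (_ : h = tm j.+1 - tm j) //.
by rewrite meshS [tm j + h - tm j]addrAC subrr add0r.
Qed.

Lemma sqint_lin m c s t : 0 <= s -> s <= t -> sqint P setT (lin m c s t).
Proof.
move=> s0 st; apply: (@sqint_sum_ord _ _ _ _ _ mT m (fun k w => c k * incr (W k) s t w)) => k _.
by apply: sqintZ => //; exact: (noise_sqint nW).
Qed.

Lemma ip_lin m c s t : 0 <= s -> s <= t ->
  E (lin m c s t) (lin m c s t) = (t - s) * \sum_(k < m) (c k) ^+ 2.
Proof.
move=> s0 st; have sk k := sqintZ mT (c k) (noise_sqint nW k s0 st).
rewrite (@ip_orthogonal_sum _ _ _ _ _ mT m (fun k w => c k * incr (W k) s t w)).
- rewrite mulr_sumr; apply: eq_bigr => k _.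
  have sW := noise_sqint nW k s0 st.
  rewrite (ipZl mT (c k) sW (sk k)) (ipZr mT (c k) sW sW) (noise_var nW) //; ring.
- by move=> k _; exact: sk.
- move=> i j _ _ ij; have si := noise_sqint nW i s0 st; have sj := noise_sqint nW j s0 st.
  by rewrite (ipZl mT (c i) si (sk j)) (ipZr mT (c j) sj si) (noise_uncorr nW) // !mulr0.
Qed.

Lemma fmeas_incr k s t u : 0 <= s -> s <= t -> t <= u -> fmeas (F u) (incr (W k) s t).
Proof.
move=> s0 st tu; have t0 := le_trans s0 st.
apply: fmeasB; first exact: (noise_mono nW t0 tu (noise_adapted nW _ t0)).
exact: (noise_mono nW s0 (le_trans st tu) (noise_adapted nW _ s0)).
Qed.

Lemma fmeas_lin m c s t u : 0 <= s -> s <= t -> t <= u -> fmeas (F u) (lin m c s t).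
Proof.
move=> s0 st tu; apply: (@fmeas_sum _ _ _ _ m (fun k w => c k * incr (W k) s t w)) => k _.
by apply: fmeasM; [exact: fmeas_cst|exact: fmeas_incr].
Qed.

Lemma ip_fmeas_lin m c s t xi : 0 <= s -> s <= t -> fmeas (F s) xi -> sqint P setT xi ->
  E xi (lin m c s t) = 0.
Proof.
move=> s0 st mxi sxi.
have sk k := sqintZ mT (c k) (noise_sqint nW k s0 st).
rewrite (@ip_sumr_ord _ _ _ _ _ mT m (fun k w => c k * incr (W k) s t w)) //.
rewrite big1 // => k _.
rewrite (ipZr mT (c k) (noise_sqint nW k s0 st) sxi).
by rewrite (noise_orth nW) // mulr0.
Qed.

Lemma fmeas_euler j : (j <= n)%N -> fmeas (F (tm j)) (Y j).
Proof.
elim: j => [|j IH] jn; first exact: fmeas_cst.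
have tj0 : 0 <= tm j by exact: mesh_ge0.
have tjS : tm j <= tm j.+1 by exact: mesh_le.
have mY := noise_mono nW tj0 tjS (IH (ltnW jn)).
rewrite (_ : Y j.+1 = fun w => Y j w + a (tm j) (Y j w) * h +
   lin M (sigma (tm j)) (tm j) (tm j.+1) w); last by apply/funext => w; exact: euler_step.
apply: fmeasD; last exact: fmeas_lin.
apply: fmeasD => //; apply: fmeasM; last exact: fmeas_cst.
apply: fmeas_comp => //; apply: (drift_measurable ha).
by apply: mesh_in => //; exact: ltnW.
Qed.

Lemma measurable_euler j : (j <= n)%N -> measurable_fun setT (Y j).
Proof. by move=> jn; apply: (noise_sub nW (mesh_ge0 T0 n0 j)); exact: fmeas_euler. Qed.

(** The exponential rate of the discrete Gronwall inequality for the second moments. *)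
Definition mom_rate : R := 3 * C1 + 2 * T * C1 ^+ 2 + S ^+ 2.

Lemma mom_rate_ge0 : 0 <= mom_rate.
Proof.
have := sqr_ge0 S; have := mulr_ge0 (ltW T0) (sqr_ge0 C1); have := ltW C10.
rewrite /mom_rate; lra.
Qed.

Definition euler_bound : R := (1 + x0 ^+ 2) * expR (mom_rate * T).

(** The noise of a step is orthogonal to the past, so only its variance, of order $h$,
   is added. *)
Lemma euler_moment_step j : (j < n)%N -> sqint P setT (Y j) ->
  sqint P setT (Y j.+1) /\ 1 + E (Y j.+1) (Y j.+1) <= (1 + h * mom_rate) * (1 + E (Y j) (Y j)).
Proof.
move=> jn sY; have h0 := mstep_gt0 T0 n0; have hT := mstep_le T0 n0.
have tjT : tm j \in `[0, T] by apply: mesh_in => //; exact: ltnW.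
have tj0 := mesh_ge0 T0 n0 j; have tjS : tm j <= tm j.+1 by exact: mesh_le.
pose A w := Y j w + a (tm j) (Y j w) * h.
pose Z := lin M (sigma (tm j)) (tm j) (tm j.+1).
have fA : fmeas (F (tm j)) A.
  apply: fmeasD; first by apply: fmeas_euler; exact: ltnW.
  apply: fmeasM; last exact: fmeas_cst.
  apply: fmeas_comp; first exact: (drift_measurable ha).
  by apply: fmeas_euler; exact: ltnW.
have mA : measurable_fun setT A := noise_sub nW tj0 fA.
pose K1 := 3 * C1 + 2 * T * C1 ^+ 2.
have K10 : 0 <= K1 by have := mulr_ge0 (ltW T0) (sqr_ge0 C1); have := ltW C10; rewrite /K1; lra.
have dom w : A w ^+ 2 <= (1 + h * K1) * Y j w ^+ 2 + h * K1 * 1 ^+ 2.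
  have ga := drift_growth ha (Y j w) tjT.
  set y := Y j w in ga *; set z := a (tm j) y in ga *.
  have z2 : z ^+ 2 <= 2 * C1 ^+ 2 * (1 + y ^+ 2).
    rewrite -(real_normK (num_real z)).
    apply: (@le_trans _ _ ((C1 * (1 + `|y|)) ^+ 2)); first by rewrite lerXn2r ?nnegrE ?mulr_ge0 ?addr_ge0 ?(ltW C10).
    rewrite exprMn -(real_normK (num_real y)).
    have : (1 + `|y|) ^+ 2 <= 2 * (1 + `|y| ^+ 2) by have := sqr_ge0 (1 - `|y|); rewrite !expr2; nra.
    move=> q; rewrite (_ : 2 * C1 ^+ 2 * _ = C1 ^+ 2 * (2 * (1 + `|y| ^+ 2))); last by ring.
    by rewrite ler_wpM2l ?sqr_ge0.
  have yz : y * z <= C1 * (1 + y ^+ 2) * (3 / 2).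
    apply: le_trans (ler_norm _) _; rewrite normrM -(real_normK (num_real y)).
    apply: (@le_trans _ _ (`|y| * (C1 * (1 + `|y|)))); first by rewrite ler_wpM2l.
    rewrite (_ : `|y| * _ = C1 * (`|y| + `|y| ^+ 2)); last by ring.
    rewrite -mulrA ler_pM2l //; have := sqr_ge0 (1 - `|y|); rewrite !expr2; nra.
  have hh : h ^+ 2 * z ^+ 2 <= h * T * (2 * C1 ^+ 2 * (1 + y ^+ 2)).
    apply: ler_pM; rewrite ?sqr_ge0 //.
    by rewrite expr2 ler_wpM2l // ltW.
  have hyz : h * (y * z) <= h * (C1 * (1 + y ^+ 2) * (3 / 2)) by rewrite ler_pM2l.
  rewrite (_ : A w ^+ 2 = y ^+ 2 + 2 * (h * (y * z)) + h ^+ 2 * z ^+ 2); last by rewrite /A -/y -/z; ring.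
  rewrite /K1; lra.
have [sA hA] : sqint P setT A /\ E A A <= (1 + h * K1) * E (Y j) (Y j) + h * K1 * 1.
  have := @sqint_dominated _ _ _ P 2 (fun i => if i == 0 then 1 + h * K1 else h * K1)
    (fun i => if i == 0 then Y j else fun _ => 1) A mA.
  rewrite !big_ord_recr !big_ord0 /= !add0r ip_prob_cst expr1n; apply.
  - by move=> i _; case: ifP => _; have := mulr_ge0 (ltW h0) K10; lra.
  - by move=> i _; case: ifP => _ //; exact: sqint_prob_cst.
  - by move=> w; rewrite !big_ord_recr !big_ord0 /= add0r.
have sZ : sqint P setT Z by exact: sqint_lin.
have YE : Y j.+1 = fun w => A w + Z w by apply/funext => w; rewrite euler_step.
have sY' : sqint P setT (Y j.+1) by rewrite YE; exact: sqintD.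
split=> //.
have EZ : E Z Z <= h * S ^+ 2.
  rewrite ip_lin // meshS [tm j + h - tm j]addrAC subrr add0r ler_pM2l //.
  exact: (sum_sigma_le T0 C20 hs).
have EAZ : E A Z = 0 by exact: ip_fmeas_lin.
rewrite YE (ipDl mT sA sZ (sqintD mT sA sZ)) (ipDr mT sA sZ sA) (ipDr mT sA sZ sZ) (ipC _ _ Z) EAZ.
have S2 : 0 <= h * S ^+ 2 * E (Y j) (Y j) by apply: mulr_ge0; [apply: mulr_ge0; [exact: ltW|exact: sqr_ge0]|exact: ip_ge0].
rewrite /mom_rate -/K1; lra.
Qed.

Lemma euler_moment j : (j <= n)%N -> sqint P setT (Y j) /\ 1 + E (Y j) (Y j) <= euler_bound.
Proof.
move=> jn; have h0 := mstep_gt0 T0 n0; have K0 := mom_rate_ge0.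
suff H : sqint P setT (Y j) /\ 1 + E (Y j) (Y j) <= (1 + x0 ^+ 2) * (1 + h * mom_rate) ^+ j.
  have [H1 H2] := H; split=> //; apply: le_trans H2 _.
  rewrite ler_wpM2l ?addr_ge0 ?sqr_ge0 //.
  apply: (@le_trans _ _ (expR (h * mom_rate) ^+ j)).
    have hK : 0 <= 1 + h * mom_rate by rewrite addr_ge0 // mulr_ge0 // ltW.
    by apply: lerXn2r; rewrite ?nnegrE ?expR_ge0 ?expR_ge1Dx.
  rewrite -expRM_natl ler_expR mulrA [mom_rate * T]mulrC ler_wpM2r // -meshE.
  exact: mesh_leT.
elim: j jn => [|j IH] jn.
  split; first exact: sqint_prob_cst.
  by rewrite ip_prob_cst expr0 mulr1.
have [s1 h1] := IH (ltnW jn).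
have [s2 h2] := euler_moment_step jn s1; split=> //.
apply: le_trans h2 _; rewrite [X in _ <= _ * X]exprS mulrCA; apply: ler_wpM2l => //.
by rewrite addr_ge0 // mulr_ge0 // ltW.
Qed.

Definition euler_inc i (t : R) (w : Omega) : R :=
  a (tm i) (Y i w) * (Num.min t (tm i.+1) - Num.min t (tm i)) +
  lin M (sigma (tm i)) (Num.min t (tm i)) (Num.min t (tm i.+1)) w.

(** The sum has a single formula on all of [0, T]; on the cells it is the usual
   time-continuous Euler process, see [euler_cont_cell]. *)
Definition euler_cont (t : R) (w : Omega) : R := x0 + \sum_(i < n) euler_inc i t w.

Lemma euler_cont_cell j t w : (j < n)%N -> tm j <= t <= tm j.+1 ->
  euler_cont t w = Y j w + a (tm j) (Y j w) * (t - tm j) + lin M (sigma (tm j)) (tm j) t w.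
Proof.
move=> jn /andP[h1 h2].
have part i : (i <= j)%N -> x0 + \sum_(l < i) euler_inc l t w = Y i w.
  elim: i => [|i IH] ij; first by rewrite big_ord0 addr0.
  rewrite big_ord_recr /= addrA IH ?(ltnW ij) // -[RHS]/(Y i.+1 w) euler_step /euler_inc.
  have l1 : tm i.+1 <= t by apply: le_trans h1; exact: mesh_le.
  have l2 : tm i <= t by apply: le_trans l1; exact: mesh_le.
  by rewrite !min_r // meshS [tm i + h - tm i]addrAC subrr add0r -!addrA.
rewrite /euler_cont (sum_ord_tail0 (f := fun i => euler_inc i t w) jn); last first.
  move=> i ji; have l1 : t <= tm i by apply: le_trans h2 _; exact: mesh_le.
  have l2 : t <= tm i.+1 by apply: le_trans l1 _; exact: mesh_le.
  rewrite /euler_inc !min_l // subrr mulr0 add0r /lin big1 // => k _.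
  by rewrite /incr subrr mulr0.
rewrite big_ord_recr /= addrA part // /euler_inc min_l // min_r //.
by rewrite -!addrA.
Qed.

Lemma continuous_euler_cont w : continuous (euler_cont^~ w).
Proof.
have cm (u : R) : continuous (fun t : R => Num.min t u).
  by move=> s; apply: (@continuous_min _ _ id (fun=> u)); [exact: cvg_id|exact: cvg_cst].
move=> t; apply: cvgD; first exact: cvg_cst.
apply: (@continuous_sum_ord _ n (fun i t => euler_inc i t w)) => i {}t.
apply: cvgD.
  by apply: cvgM; [exact: cvg_cst|apply: cvgB; exact: cm].
apply: (@continuous_sum_ord _ M (fun k t => sigma (tm i) k *
  incr (W k) (Num.min t (tm i)) (Num.min t (tm i.+1)) w)) => k {}t.
apply: cvgM; first exact: cvg_cst.
by apply: cvgB; apply: (cvg_comp (fun t => Num.min t _) (fun t => W k t w)); by [exact: cm|exact: cW].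
Qed.

Lemma measurable_lin m c s t : measurable_fun setT (lin m c s t).
Proof.
apply: measurable_sum => k; apply: measurable_funM => //.
by apply: measurable_funB.
Qed.

Lemma measurable_drift_euler j : (j <= n)%N -> measurable_fun setT (fun w => a (tm j) (Y j w)).
Proof.
move=> jn; apply: measurableT_comp; last exact: measurable_euler.
by apply: (drift_measurable ha); exact: mesh_in.
Qed.

Lemma measurable_euler_cont t : measurable_fun setT (euler_cont t).
Proof.
apply: measurable_funD => //; apply: measurable_sum => i.
apply: measurable_funD; last exact: measurable_lin.
apply: measurable_funM => //; apply: measurable_drift_euler; exact: ltnW.
Qed.

Lemma jmeas_euler_cont : jmeas euler_cont.
Proof. by apply: jmeas_continuous; [exact: continuous_euler_cont|exact: measurable_euler_cont]. Qed.

Lemma jmeas_lin m c s : jmeas (lin m c s).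
Proof.
apply: jmeas_continuous => [w t|t]; last exact: measurable_lin.
apply: (@continuous_sum_ord _ m (fun k t => c k * incr (W k) s t w)) => k {}t.
apply: cvgM; first exact: cvg_cst.
by apply: cvgB; [exact: cW|exact: cvg_cst].
Qed.

End euler.

(** * Linearization of the drift along the scheme *)

Section linearization.
Context d (Omega : measurableType d) (R : realType) (P : probability Omega R).
Variables (F : R -> set (set Omega)) (W : nat -> R -> Omega -> R).
Variables (T x0 C1 C2 : R) (delta : nat -> R) (a : R -> R -> R) (sigma : R -> nat -> R).
Hypothesis nW : noise P F W.
Hypothesis cW : forall k w, continuous (fun t => W k t w).
Hypothesis mW : forall k t, measurable_fun setT (W k t).
Hypothesis T0 : 0 < T.
Hypothesis C10 : 0 < C1.
Hypothesis C20 : 0 < C2.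
Hypothesis ha : drift_conditions T C1 a.
Hypothesis hs : diffusion_conditions T C2 delta sigma.
Variables (n M : nat).
Hypothesis n0 : (0 < n)%N.
Notation E := (ip P setT).
Notation tm := (mesh T n).
Notation h := (mstep T n).
Notation Y := (euler T x0 a sigma W M n).
Notation S := (sbound T C2).
Notation cl := (cell T n).
Notation Yc := (euler_cont W T x0 a sigma n M).
Notation mu := (@lebesgue_measure R).

Let mT : measurable (setT : set Omega). Proof. exact: measurableT. Qed.

Let cell_facts s : s \in `[0, T] -> [/\ (cl s < n)%N, 0 <= tm (cl s), tm (cl s) <= s <= tm (cl s).+1,
  s - tm (cl s) <= h & tm (cl s) \in `[0, T]].
Proof.
move=> sT; have c := cell_lt T n0 s; have /andP[h1 h2] := cell_itv T0 n0 sT.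
split=> //; [exact: mesh_ge0|by apply/andP| |by apply: mesh_in => //; exact: ltnW].
by move: h2; rewrite meshS; lra.
Qed.

Definition slope j (w : Omega) : R := derive1 (a (tm j)) (Y j w).

(** The part of the drift error linear in the noise; it is too large to be treated by
   absolute values, and its cancellations are exploited instead. *)
Definition lin_part (s : R) (w : Omega) : R :=
  slope (cl s) w * lin W M (sigma (tm (cl s))) (tm (cl s)) s w.

Definition drift_gap (s : R) (w : Omega) : R :=
  a (clamp T s) (Yc s w) - a (tm (cl s)) (Y (cl s) w).

Definition rem_part (s : R) (w : Omega) : R := drift_gap s w - lin_part s w.

Let tm_in j : (j < n)%N -> tm j \in `[0, T].
Proof. by move=> jn; apply: mesh_in => //; exact: ltnW. Qed.

Let fslope j u : (j < n)%N -> tm j <= u -> fmeas (F u) (slope j).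
Proof.
move=> jn ju; apply: (noise_mono nW (mesh_ge0 T0 n0 j) ju).
apply: fmeas_comp; first exact: (drift_derivative_measurable ha (tm_in jn)).
exact: (fmeas_euler x0 sigma nW T0 ha M n0 (ltnW jn)).
Qed.

Let mslope j : (j < n)%N -> measurable_fun setT (slope j).
Proof. by move=> jn; apply: (noise_sub nW (mesh_ge0 T0 n0 j)); exact: fslope. Qed.

Let slope_le j w : (j < n)%N -> `|slope j w| <= C1.
Proof. by move=> jn; apply: (drift_derivative_bound ha); exact: tm_in. Qed.

Lemma jmeas_cell (H : nat -> R -> Omega -> R) : (forall i, (i < n)%N -> jmeas (H i)) ->
  jmeas (fun s w => H (cl s) s w).
Proof.
move=> mH; rewrite (_ : (fun s w => _) = fun s w => (fun i s w => if (i < n)%N then H i s w else 0) (cl s) s w).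
  apply: (@jmeas_select _ _ _ (fun i s w => if (i < n)%N then H i s w else 0)) => i.
    exact: measurable_cell_eq.
  case: ltnP => [ltin|_]; first exact: mH.
  exact: measurable_cst.
by apply/funext => s; apply/funext => w /=; rewrite cell_lt.
Qed.

Lemma jmeas_lin_part : jmeas lin_part.
Proof.
apply: (jmeas_cell (H := fun i s w => slope i w * lin W M (sigma (tm i)) (tm i) s w)) => i ltin.
by apply: jmeasM; [apply: jmeas_static; exact: mslope|exact: jmeas_lin].
Qed.

Lemma jmeas_drift_gap : jmeas drift_gap.
Proof.
apply: jmeasB.
  apply: jmeas_continuous => [w|s].
    apply: (drift_path_continuous ha (g := clamp T)).
    - exact: continuous_clamp.
    - exact: continuous_euler_cont.
    - exact: clamp_in.
  apply: measurableT_comp; first by apply: (drift_measurable ha); exact: clamp_in.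
  exact: (measurable_euler_cont x0 sigma nW mW T0 ha M n0).
apply: (jmeas_cell (H := fun i s w => a (tm i) (Y i w))) => i ltin.
apply: jmeas_static; exact: (measurable_drift_euler x0 sigma nW T0 ha M n0 (ltnW ltin)).
Qed.

Lemma jmeas_rem_part : jmeas rem_part.
Proof. exact: jmeasB jmeas_drift_gap jmeas_lin_part. Qed.

Definition lin_bound : R := C1 ^+ 2 * S ^+ 2 * h.

Lemma ip_lin_sigma j s m : (j < n)%N -> tm j <= s -> s - tm j <= h ->
  E (lin W m (sigma (tm j)) (tm j) s) (lin W m (sigma (tm j)) (tm j) s) <= S ^+ 2 * h.
Proof.
move=> jn js jh; rewrite (ip_lin nW) // ?(mesh_ge0 T0) // mulrC.
apply: ler_pM => //; [by apply: sumr_ge0 => *; exact: sqr_ge0|by rewrite subr_ge0|].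
by apply: (sum_sigma_le T0 C20 hs); exact: tm_in.
Qed.

Lemma lin_part_L2 s : s \in `[0, T] ->
  sqint P setT (lin_part s) /\ E (lin_part s) (lin_part s) <= lin_bound.
Proof.
move=> sT; have [cn c0 /andP[cs sc] ch cT] := cell_facts sT.
have sZ := sqint_lin nW M (sigma (tm (cl s))) c0 cs.
split; first by apply: (sqint_bounded_mul mT (c := C1)) => //; [exact: mslope|move=> w _; exact: slope_le].
apply: (@le_trans _ _ (E (fun w => C1 * lin W M (sigma (tm (cl s))) (tm (cl s)) s w)
  (fun w => C1 * lin W M (sigma (tm (cl s))) (tm (cl s)) s w))).
  apply: ip_le => //; last exact: sqintZ.
    by apply: measurable_funM; [exact: mslope|case: sZ].
  move=> w _; rewrite !normrM ler_wpM2r // (le_trans (slope_le w cn)) // ler_norm //.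
rewrite (ipZl mT C1 sZ (sqintZ mT C1 sZ)) (ipZr mT C1 sZ sZ) mulrA -expr2.
by rewrite /lin_bound -mulrA ler_wpM2l ?sqr_ge0 // ip_lin_sigma.
Qed.

(** Over an earlier cell the linear part is known at the left end point of a
   later cell, and the noise over the later cell is orthogonal to the past. *)
Lemma lin_part_orth r s : r \in `[0, T] -> s \in `[0, T] -> (cl r < cl s)%N ->
  E (lin_part r) (lin_part s) = 0.
Proof.
move=> rT sT rs; have [cn c0 /andP[cs sc] ch cT] := cell_facts sT.
have [cn' c0' /andP[cs' sc'] ch' cT'] := cell_facts rT.
have rc : r <= tm (cl s) by apply: le_trans sc' _; exact: mesh_le.
have [sr _] := lin_part_L2 rT.
have f1 : fmeas (F (tm (cl s))) (lin_part r).
  apply: fmeasM; first by apply: fslope => //; exact: le_trans rc.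
  exact: (fmeas_lin nW).
have f2 : fmeas (F (tm (cl s))) (fun w => slope (cl s) w * lin_part r w).
  by apply: fmeasM => //; exact: fslope.
have s2 : sqint P setT (fun w => slope (cl s) w * lin_part r w).
  by apply: (sqint_bounded_mul mT (c := C1)) => //; [exact: mslope|move=> w _; exact: slope_le].
rewrite -(ip_fmeas_lin nW M (sigma (tm (cl s))) c0 cs f2 s2).
by apply: eq_Rintegral => w _; rewrite /lin_part; ring.
Qed.

Let lin_bound_ge0 : 0 <= lin_bound.
Proof. by apply: mulr_ge0; [apply: mulr_ge0; exact: sqr_ge0|apply: ltW; exact: mstep_gt0]. Qed.

Let E_le f b : measurable_fun setT f -> sqint P setT f /\ E f f <= b ->
  (\int[P]_w ((f w) ^+ 2)%:E <= b%:E)%E.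
Proof. by move=> mf [sf fb]; rewrite ip_sqE // lee_fin. Qed.

Let lin_part_E s : 0 <= s -> s <= T -> (\int[P]_w ((lin_part s w) ^+ 2)%:E <= lin_bound%:E)%E.
Proof.
move=> s0 sT; apply: E_le; first exact: (jmeas_omega s jmeas_lin_part).
by apply: lin_part_L2; rewrite in_itv /= s0.
Qed.

(** Orthogonality across cells makes the accumulated linear part of order $h$
   although its values are only of order $h^{1/2}$. *)
Lemma time_int_lin_part t : t \in `[0, T] ->
  sqint P setT (time_int lin_part t) /\
  E (time_int lin_part t) (time_int lin_part t) <= T * (C1 ^+ 2 * S ^+ 2 * h ^+ 2).
Proof.
rewrite in_itv /= => /andP[t0 tT].
have Hb s : 0 <= s -> s <= t -> (\int[P]_w ((lin_part s w) ^+ 2)%:E <= lin_bound%:E)%E.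
  by move=> s0 st; apply: lin_part_E => //; exact: le_trans tT.
have [sG _] := time_int_L2 t0 jmeas_lin_part Hb.
have mI u : measurable (`[0, u] : set (measurableTypeR R)) by exact: measurable_itv.
have inT s : s \in `[0, t] -> s \in `[0, T].
  by rewrite !in_itv /= => /andP[-> st]; exact: le_trans tT.
split=> //.
have h0 := ltW (mstep_gt0 T0 n0).
(* only the times in the cell of [s] correlate with it, a set of length [h] *)
have inner s : s \in `[0, t] -> E (lin_part s) (time_int lin_part t) <= lin_bound * h.
  move=> sI; have sT := inT _ sI; have [sL EL] := lin_part_L2 sT.
  have [cn c0 /andP[cs sc] ch cT] := cell_facts sT.
  have [i1 e1] := ip_time_int t0 jmeas_lin_part Hb sL.
  rewrite ipC e1.
  pose ind (r : R) : R := lin_bound * \1_(`[tm (cl s), tm (cl s).+1] : set R) r.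
  have iind : mu.-integrable `[0, t] (EFin \o ind).
    rewrite (_ : _ \o _ = fun r => (lin_bound%:E * (\1_(`[tm (cl s), tm (cl s).+1] : set R) r)%:E)%E); last first.
      by apply/funext => r /=; rewrite EFinM.
    apply: integrableZl => //.
    apply: integrableS (integrable_indic_itv (tm (cl s)) (tm (cl s).+1) true false) => //.
  apply: (@le_trans _ _ (\int[mu]_(r in `[0, t]) ind r)).
    apply: le_Rintegral => // r rI; have rT := inT r rI.
    have [sr Er] := lin_part_L2 rT.
    rewrite /ind indicE; case: (ltngtP (cl r) (cl s)) => rs.
    + by rewrite lin_part_orth // mulr_ge0 // lin_bound_ge0.
    + by rewrite ipC lin_part_orth // mulr_ge0 // lin_bound_ge0.
    + rewrite mem_set ?mulr1 /=; last by rewrite in_itv /= -rs; exact: cell_itv.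
      apply: le_trans (ler_norm _) _; apply: le_trans (ip_absM mT sr sL) _; lra.
  rewrite /ind RintegralZl //; last first.
    by apply: integrableS (integrable_indic_itv (tm (cl s)) (tm (cl s).+1) true false).
  rewrite ler_wpM2l //.
  rewrite /Rintegral integral_indic // -lee_fin fineK; last first.
    rewrite ge0_fin_numE //; apply: le_lt_trans (le_measure _ _ _ (@subIsetl _ _ _)) _; rewrite ?inE //.
      exact: measurableI.
    rewrite [X in (X < _)%E](lebesgue_measure_itv (`[tm (cl s), tm (cl s).+1] : interval R)) /=.
    by case: ifP => _; rewrite -?EFinB ltry.
  apply: le_trans (le_measure _ _ _ (@subIsetl _ _ _)) _; rewrite ?inE //; first exact: measurableI.
  rewrite [X in (X <= _)%E](lebesgue_measure_itv (`[tm (cl s), tm (cl s).+1] : interval R)) /= lte_fin.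
  case: ltP => _; last by rewrite lee_fin.
  by rewrite -EFinB lee_fin meshS; lra.
have [i2 e2] := ip_time_int t0 jmeas_lin_part Hb sG.
rewrite e2.
have icst : mu.-integrable `[0, t] (EFin \o (fun _ : R => lin_bound * h)).
  by apply: continuous_integrable => s; exact: cvg_cst.
apply: (@le_trans _ _ (\int[mu]_(s in `[0, t]) (lin_bound * h))).
  by apply: le_Rintegral => // s sI; exact: inner.
rewrite Rintegral_cst // [X in fine X](mu_itv0 t0) /=.
rewrite (_ : T * _ = lin_bound * h * T); last by rewrite /lin_bound; ring.
by rewrite ler_wpM2l // mulr_ge0 // lin_bound_ge0.
Qed.

End linearization.

(** * The remainder of the linearization *)

Lemma sqr_sum5 (R : realFieldType) (p1 p2 p3 p4 p5 : R) :
  (p1 + p2 + p3 + p4 + p5) ^+ 2 <= 5 * (p1 ^+ 2 + p2 ^+ 2 + p3 ^+ 2 + p4 ^+ 2 + p5 ^+ 2).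
Proof.
have := sqr_sum_le 5 (nth 0 [:: p1; p2; p3; p4; p5]).
by rewrite !big_ord_recr !big_ord0 /= !add0r.
Qed.

Section remainder.
Context d (Omega : measurableType d) (R : realType) (P : probability Omega R).
Variables (F : R -> set (set Omega)) (W : nat -> R -> Omega -> R).
Variables (T x0 C1 C2 : R) (delta : nat -> R) (a : R -> R -> R) (sigma : R -> nat -> R).
Hypothesis nW : noise P F W.
Hypothesis cW : forall k w, continuous (fun t => W k t w).
Hypothesis mW : forall k t, measurable_fun setT (W k t).
Hypothesis T0 : 0 < T.
Hypothesis C10 : 0 < C1.
Hypothesis C20 : 0 < C2.
Hypothesis ha : drift_conditions T C1 a.
Hypothesis hs : diffusion_conditions T C2 delta sigma.
Variables (n M : nat).
Hypothesis n0 : (0 < n)%N.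
Notation E := (ip P setT).
Notation tm := (mesh T n).
Notation h := (mstep T n).
Notation Y := (euler T x0 a sigma W M n).
Notation S := (sbound T C2).
Notation cl := (cell T n).
Notation Yc := (euler_cont W T x0 a sigma n M).
Notation rem := (rem_part W T x0 a sigma n M).

Let mT : measurable (setT : set Omega). Proof. exact: measurableT. Qed.

Definition rem_cst1 : R := C1 * (1 + C1 * T + C1).
Definition rem_cst2 : R := C1 * (T + 2).

(** Here [z1 + z2] is the increment of the noise, [z1] the contribution of its leading
   components. The time increment and the drift displacement cost $h$, the linearization
   in [z1] costs $z_1^2$ by the Lipschitz condition on the derivative, and [z2] is
   estimated linearly. *)
Lemma drift_remainder (s t y z1 z2 : R) : s \in `[0, T] -> t \in `[0, T] ->
  0 <= s - t <= h ->
  (a s (y + a t y * (s - t) + (z1 + z2)) - a t y - derive1 (a t) y * (z1 + z2)) ^+ 2 <=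
  5 * (rem_cst1 * h) ^+ 2 * 1 ^+ 2 + 5 * (rem_cst1 * h) ^+ 2 * y ^+ 2 +
  5 * (C1 * h) ^+ 2 * z1 ^+ 2 + 5 * rem_cst2 ^+ 2 * z2 ^+ 2 + 5 * C1 ^+ 2 * (z1 ^+ 2) ^+ 2.
Proof.
move=> sT tT /andP[u0 uh].
have h0 := ltW (mstep_gt0 T0 n0); have hT := mstep_le T0 n0; have c0 := ltW C10.
set z := a t y; set b := derive1 (a t) y; set u := s - t in u0 uh *.
pose yt := y + z * u + (z1 + z2).
have t1 : `|a s yt - a t yt| <= C1 * (1 + `|yt|) * h.
  apply: le_trans (drift_time ha _ sT tT) _.
  by rewrite (ger0_norm u0) ler_wpM2l // mulr_ge0 // addr_ge0.
have t2 : `|a t yt - a t (y + z1)| <= C1 * (`|z| * h + `|z2|).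
  apply: le_trans (drift_lipschitz ha _ _ tT) _; rewrite ler_wpM2l //.
  rewrite (_ : yt - (y + z1) = z * u + z2); last by rewrite /yt; ring.
  apply: le_trans (ler_normD _ _) _; rewrite lerD2r normrM (ger0_norm u0).
  exact: ler_wpM2l.
have t3 := drift_taylor C10 ha y z1 tT.
have t4 : `|b * z2| <= C1 * `|z2|.
  by rewrite normrM ler_wpM2r // (drift_derivative_bound ha).
have zl : `|z| <= C1 * (1 + `|y|) := drift_growth ha y tT.
have zh : `|z| * h <= C1 * (1 + `|y|) * h by rewrite ler_wpM2r.
have ytl : `|yt| <= `|y| + `|z| * h + `|z1| + `|z2|.
  rewrite /yt; apply: le_trans (ler_normD _ _) _.
  have e1 := ler_normD y (z * u); have e2 := ler_normD z1 z2.
  have e3 : `|z * u| <= `|z| * h by rewrite normrM (ger0_norm u0); exact: ler_wpM2l.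
  lra.
set X := a s yt - z - b * (z1 + z2).
have XE : X = (a s yt - a t yt) + (a t yt - a t (y + z1)) + (a t (y + z1) - z - b * z1) + (- (b * z2)).
  by rewrite /X; ring.
have Xl : `|X| <= `|a s yt - a t yt| + `|a t yt - a t (y + z1)| + `|a t (y + z1) - z - b * z1| + `|b * z2|.
  rewrite XE -[X in _ <= _ + X]normrN; apply: le_trans (ler_normD _ _) _; rewrite lerD2r.
  by apply: le_trans (ler_normD _ _) _; rewrite lerD2r ler_normD.
set Ay := `|y| in zl zh ytl *; set A1 := `|z1| in ytl *; set A2 := `|z2| in t2 t4 ytl *.
have Ay0 : 0 <= Ay by exact: normr_ge0.
have A10 : 0 <= A1 by exact: normr_ge0.
have A20 : 0 <= A2 by exact: normr_ge0.
have t1' : C1 * (1 + `|yt|) * h <= C1 * (1 + (Ay + C1 * (1 + Ay) * h + A1 + A2)) * h.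
  by rewrite ler_wpM2r // ler_wpM2l // lerD2l; lra.
have t2' : C1 * (`|z| * h + A2) <= C1 * (C1 * (1 + Ay) * h + A2).
  by rewrite ler_wpM2l // lerD2r.
have hh : C1 * (C1 * (1 + Ay) * h) * h <= C1 * (C1 * (1 + Ay) * T) * h.
  by rewrite ler_wpM2r // ler_wpM2l // ler_wpM2l // mulr_ge0 // addr_ge0.
have hh2 : C1 * h * A2 <= C1 * T * A2 by rewrite ler_wpM2r // ler_wpM2l.
have Xb : `|X| <= rem_cst1 * h + rem_cst1 * h * Ay + C1 * h * A1 + rem_cst2 * A2 + C1 * z1 ^+ 2.
  by rewrite /rem_cst1 /rem_cst2; lra.
have r10 : 0 <= rem_cst1 by rewrite mulr_ge0 // addr_ge0 // addr_ge0 // mulr_ge0 // ltW.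
have r20 : 0 <= rem_cst2 by rewrite mulr_ge0 // addr_ge0 // ltW.
rewrite -(real_normK (num_real X)).
apply: (@le_trans _ _ ((rem_cst1 * h + rem_cst1 * h * Ay + C1 * h * A1 + rem_cst2 * A2 + C1 * z1 ^+ 2) ^+ 2)).
  rewrite lerXn2r ?nnegrE //.
  by apply: le_trans Xb.
apply: le_trans (sqr_sum5 _ _ _ _ _) _.
rewrite -(real_normK (num_real y)) -(real_normK (num_real z2)) -/Ay -/A2.
rewrite -(real_normK (num_real z1)) -/A1.
by rewrite le_eqVlt; apply/orP; left; apply/eqP; ring.
Qed.

Lemma lin_split K m c s t w :
  lin W m c s t w = lin W (minn K m) c s t w +
    lin W m (fun k => if (k < K)%N then 0 else c k) s t w.
Proof.
rewrite /lin [X in _ = X + _](big_ord_widen m (fun k => c k * incr (W k) s t w)) ?geq_minr //.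
rewrite [X in _ = X + _]big_mkcond -big_split /=; apply: eq_bigr => k _.
rewrite leq_min ltn_ord andbT; case: ifP => _; first by rewrite mul0r addr0.
by rewrite add0r.
Qed.

Lemma sqint_incr_sqr k s t : 0 <= s -> s <= t ->
  sqint P setT (fun w => incr (W k) s t w ^+ 2) /\
  E (fun w => incr (W k) s t w ^+ 2) (fun w => incr (W k) s t w ^+ 2) <= 3 * (t - s) ^+ 2.
Proof.
move=> s0 st.
have m2 : measurable_fun setT (fun w => incr (W k) s t w ^+ 2).
  by apply: measurable_funX; case: (noise_sqint nW k s0 st).
have key : (\int[P]_w (((incr (W k) s t w ^+ 2)%R ^+ 2)%:E) <= (3 * (t - s) ^+ 2)%:E)%E.
  apply: le_trans (noise_fourth nW k s0 st).
  by under eq_integral do rewrite -exprM.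
have sq : sqint P setT (fun w => incr (W k) s t w ^+ 2).
  by split=> //; exact: le_lt_trans key (ltry _).
by split=> //; rewrite -lee_fin -ip_sqE.
Qed.

(** Fourth moments of a sum of [m] terms, at the price of a power of [m]. *)
Lemma lin_fourth m j s : (j < n)%N -> tm j <= s -> s - tm j <= h ->
  sqint P setT (fun w => lin W m (sigma (tm j)) (tm j) s w ^+ 2) /\
  E (fun w => lin W m (sigma (tm j)) (tm j) s w ^+ 2)
    (fun w => lin W m (sigma (tm j)) (tm j) s w ^+ 2) <= 3 * m%:R ^+ 4 * S ^+ 4 * h ^+ 2.
Proof.
move=> jn js jh; have j0 := mesh_ge0 T0 n0 j.
have tjT : tm j \in `[0, T] by apply: mesh_in => //; exact: ltnW.
have S0 := ltW (sbound_gt0 T0 C20).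
have sg4 k : sigma (tm j) k ^+ 4 <= S ^+ 4.
  have : sigma (tm j) k ^+ 2 <= S ^+ 2.
    apply: le_trans (sum_sigma_le T0 C20 hs k.+1 tjT).
    by rewrite big_ord_recr /= lerDr sumr_ge0 // => i _; exact: sqr_ge0.
  move=> q; rewrite (exprM _ 2 2) (exprM S 2 2).
  by rewrite lerXn2r ?nnegrE ?sqr_ge0.
have [] := @sqint_dominated _ _ _ P m (fun k => m%:R ^+ 3 * sigma (tm j) k ^+ 4)
  (fun k w => incr (W k) (tm j) s w ^+ 2) (fun w => lin W m (sigma (tm j)) (tm j) s w ^+ 2).
- by apply: measurable_funX; case: (sqint_lin nW m (sigma (tm j)) j0 js).
- by move=> k _; rewrite mulr_ge0 // exprn_even_ge0.
- by move=> k _; have [] := sqint_incr_sqr k j0 js.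
- move=> w; rewrite /lin.
  apply: (@le_trans _ _ ((m%:R * \sum_(k < m) (sigma (tm j) k * incr (W k) (tm j) s w) ^+ 2) ^+ 2)).
    rewrite lerXn2r ?nnegrE ?sqr_ge0 //.
      by rewrite mulr_ge0 // sumr_ge0 // => k _; exact: sqr_ge0.
    exact: (sqr_sum_le m (fun k => sigma (tm j) k * incr (W k) (tm j) s w)).
  rewrite exprMn; apply: (@le_trans _ _ (m%:R ^+ 2 * (m%:R * \sum_(k < m) ((sigma (tm j) k * incr (W k) (tm j) s w) ^+ 2) ^+ 2))).
    rewrite ler_wpM2l ?sqr_ge0 //.
    exact: (sqr_sum_le m (fun k => (sigma (tm j) k * incr (W k) (tm j) s w) ^+ 2)).
  rewrite mulrA -exprSr mulr_sumr; apply: ler_sum => k _.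
  by rewrite le_eqVlt; apply/orP; left; apply/eqP; ring.
move=> sq le; split=> //; apply: le_trans le _.
apply: (@le_trans _ _ (\sum_(k < m) m%:R ^+ 3 * S ^+ 4 * (3 * h ^+ 2))).
  apply: ler_sum => k _; apply: ler_pM.
  - by rewrite mulr_ge0 // exprn_even_ge0.
  - exact: ip_ge0.
  - by rewrite ler_wpM2l // exprn_ge0.
  - have [_ le2] := sqint_incr_sqr k j0 js; apply: le_trans le2 _.
    by rewrite ler_pM2l // lerXn2r ?nnegrE ?subr_ge0 // ltW // mstep_gt0.
rewrite sumr_const card_ord -mulr_natl.
by rewrite le_eqVlt; apply/orP; left; apply/eqP; ring.
Qed.

Definition rem_bound (K : nat) : R :=
  5 * (rem_cst1 * h) ^+ 2 * euler_bound T x0 C1 C2 +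
  5 * (C1 * h) ^+ 2 * (S ^+ 2 * h) +
  5 * rem_cst2 ^+ 2 * (h * (C2 * delta K) ^+ 2) +
  5 * C1 ^+ 2 * (3 * K%:R ^+ 4 * S ^+ 4 * h ^+ 2).

(** Only the first [K] components of the noise enter quadratically; the others
   are estimated by the Lipschitz condition alone. This avoids fourth moments of
   the full noise, at the price of the term with [delta K], which is made small
   by the choice of [K] before the mesh is refined. *)
Lemma rem_part_L2 K s : (0 < K)%N -> s \in `[0, T] ->
  (\int[P]_w ((rem s w) ^+ 2)%:E <= (rem_bound K)%:E)%E.
Proof.
move=> K0 sT; pose j := cl s.
have jn : (j < n)%N := cell_lt T n0 s; have /andP[js sj] := cell_itv T0 n0 sT.
have j0 := mesh_ge0 T0 n0 j; have h0 := mstep_gt0 T0 n0.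
have jh : s - tm j <= h by move: sj; rewrite meshS -/j; lra.
have tjT : tm j \in `[0, T] by apply: mesh_in => //; exact: ltnW.
pose c2 k := if (k < K)%N then 0 else sigma (tm j) k.
pose Z1 := lin W (minn K M) (sigma (tm j)) (tm j) s.
pose Z2 := lin W M c2 (tm j) s.
have sZ1 : sqint P setT Z1 := sqint_lin nW _ _ j0 js.
have sZ2 : sqint P setT Z2 := sqint_lin nW _ _ j0 js.
have [sY EY] := euler_moment x0 nW T0 C10 C20 ha hs M n0 (ltnW jn).
have [sZ4 EZ4] := lin_fourth (minn K M) jn js jh.
have mrem := jmeas_omega s (jmeas_rem_part x0 sigma nW cW mW T0 ha M n0).
(* coefficients and functions of the five squares in [drift_remainder] *)
pose cs := nth 0 [:: 5 * (rem_cst1 * h) ^+ 2; 5 * (rem_cst1 * h) ^+ 2; 5 * (C1 * h) ^+ 2;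
   5 * rem_cst2 ^+ 2; 5 * C1 ^+ 2].
pose gs := nth (fun=> 0) [:: (fun _ : Omega => 1 : R); Y j; Z1; Z2; (fun w => Z1 w ^+ 2)].
have [] := @sqint_dominated _ _ _ P 5 cs gs (rem s) mrem.
- by move=> [|[|[|[|[|]]]]] // _; rewrite /cs /= mulr_ge0 ?sqr_ge0.
- by move=> [|[|[|[|[|]]]]] // _; rewrite /gs /=; exact: sqint_prob_cst.
- move=> w; rewrite !big_ord_recr !big_ord0 /= add0r.
  rewrite /rem_part /drift_gap /lin_part /slope -/j (clampE sT).
  rewrite (euler_cont_cell W x0 a sigma T0 M n0 w jn); last by rewrite js.
  rewrite (lin_split K).
  by apply: drift_remainder => //; rewrite subr_ge0 js.
move=> sr; rewrite !big_ord_recr !big_ord0 /= add0r ip_prob_cst expr1n => le.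
rewrite ip_sqE // lee_fin; apply: le_trans le _.
have b1 : 5 * (rem_cst1 * h) ^+ 2 * (1 + E (Y j) (Y j)) <= 5 * (rem_cst1 * h) ^+ 2 * euler_bound T x0 C1 C2.
  by rewrite ler_wpM2l // mulr_ge0 // sqr_ge0.
have b2 : 5 * (C1 * h) ^+ 2 * E Z1 Z1 <= 5 * (C1 * h) ^+ 2 * (S ^+ 2 * h).
  rewrite ler_wpM2l //; first by rewrite mulr_ge0 // sqr_ge0.
  exact: (ip_lin_sigma nW T0 C20 hs n0).
have b3 : 5 * rem_cst2 ^+ 2 * E Z2 Z2 <= 5 * rem_cst2 ^+ 2 * (h * (C2 * delta K) ^+ 2).
  rewrite ler_wpM2l //; first by rewrite mulr_ge0 // sqr_ge0.
  rewrite (ip_lin nW) //; apply: ler_pM => //; first by rewrite subr_ge0.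
    by apply: sumr_ge0 => k _; exact: sqr_ge0.
  exact: (sum_sigma_tail hs M tjT K0).
have b4 : 5 * C1 ^+ 2 * E (fun w => Z1 w ^+ 2) (fun w => Z1 w ^+ 2) <=
    5 * C1 ^+ 2 * (3 * K%:R ^+ 4 * S ^+ 4 * h ^+ 2).
  rewrite ler_wpM2l //; first by rewrite mulr_ge0 // sqr_ge0.
  apply: le_trans EZ4 _; rewrite ler_wpM2r ?sqr_ge0 // ler_wpM2r ?exprn_even_ge0 //.
  by rewrite ler_pM2l // lerXn2r ?nnegrE // ler_nat geq_minl.
rewrite /rem_bound; apply: lerD b4; apply: lerD b3; apply: lerD b2.
by move: b1; rewrite mulrDr.
Qed.

End remainder.

(** * Mean square distance between the solution and the continuous Euler process *)

Section noise_replacement.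
Context d (Omega : measurableType d) (R : realType) (P : probability Omega R).
Variables (W W' : nat -> R -> Omega -> R).
Hypothesis mW : forall k (t : R), 0 <= t -> measurable_fun setT (W k t).
Hypothesis mW' : forall k (t : R), 0 <= t -> measurable_fun setT (W' k t).
Hypothesis WW' : forall k (t : R), 0 <= t -> {ae P, forall w, W' k t w = W k t w}.

Let measurable_step (V : nat -> R -> Omega -> R) k t l : step_in t l ->
  (forall k (t : R), 0 <= t -> measurable_fun setT (V k t)) ->
  measurable_fun setT (step_integral (V k) l).
Proof.
move=> hl mV; rewrite /step_integral; elim: l hl => [|p l IH] /=.
  by move=> _; under eq_fun do rewrite big_nil; exact: measurable_cst.
move=> /andP[/and3P[p0 p1 p2] /IH ml]; under eq_fun do rewrite big_cons.
apply: measurable_funD ml; apply: measurable_funM => //.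
by apply: measurable_funB; apply: mV => //; exact: le_trans p1.
Qed.

Let step_ae k t l : step_in t l ->
  {ae P, forall w, step_integral (W' k) l w = step_integral (W k) l w}.
Proof.
elim: l => [|p l IH] /=.
  by move=> _; apply: aeW => w; rewrite /step_integral !big_nil.
move=> /andP[/and3P[p0 p1 p2] /IH el].
apply: filterS3 (WW' k p0) (WW' k (le_trans p0 p1)) el => w e1 e2 e3.
by move: e3; rewrite /step_integral !big_cons e1 e2 => ->.
Qed.

(** Only countably many values of the processes, each up to a null set, enter the
   definition of the integral. *)
Lemma stoch_integral_seq_ae (sg : R -> nat -> R) t I :
  is_stoch_integral_seq P W sg t I -> is_stoch_integral_seq P W' sg t I.
Proof.
move=> [mI [J [hJ cJ]]]; split=> //; exists J; split=> // k.
have [mJ [phi [h1 h2 h3]]] := hJ k; split=> //; exists phi; split=> //.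
rewrite (_ : (fun n => _) =
  (fun n => 'E_P[fun w => ((J k w - step_integral (W k) (phi n) w) ^+ 2)%R]%E)) //.
apply/funext => m; rewrite unlock; apply: ae_eq_integral => //.
- by apply/measurable_EFinP; apply: measurable_funX; apply: measurable_funB => //; exact: (measurable_step k (h1 m)).
- by apply/measurable_EFinP; apply: measurable_funX; apply: measurable_funB => //; exact: (measurable_step k (h1 m)).
- by apply: filterS (step_ae k (h1 m)) => w /= -> _.
Qed.

End noise_replacement.

Section solution_distance.
Context d (Omega : measurableType d) (R : realType) (P : probability Omega R).
Variables (F : R -> set (set Omega)) (W : nat -> R -> Omega -> R).
Variables (T x0 C1 C2 : R) (delta : nat -> R) (a : R -> R -> R) (sigma : R -> nat -> R).
Hypothesis nW : noise P F W.
Hypothesis cW : forall k w, continuous (fun t => W k t w).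
Hypothesis mW : forall k t, measurable_fun setT (W k t).
Hypothesis T0 : 0 < T.
Hypothesis C10 : 0 < C1.
Hypothesis C20 : 0 < C2.
Hypothesis ha : drift_conditions T C1 a.
Hypothesis hs : diffusion_conditions T C2 delta sigma.
Variables (n M : nat).
Hypothesis n0 : (0 < n)%N.
Hypothesis M0 : (0 < M)%N.
Notation E := (ip P setT).
Notation tm := (mesh T n).
Notation h := (mstep T n).
Notation Y := (euler T x0 a sigma W M n).
Notation S := (sbound T C2).
Notation cl := (cell T n).
Notation Yc := (euler_cont W T x0 a sigma n M).
Notation rem := (rem_part W T x0 a sigma n M).
Notation mu := (@lebesgue_measure R).

Let mT : measurable (setT : set Omega). Proof. exact: measurableT. Qed.
Let mI t : measurable (`[0, t] : set (measurableTypeR R)). Proof. exact: measurable_itv. Qed.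

(** The step function $s \mapsto \sigma_k(t_i)$ on $]t_i,t_{i+1}]$, cut at [t]. *)
Definition euler_steps (t : R) (k : nat) : seq (R * R * R) :=
  if (k < M)%N then
    [seq (sigma (tm i) k, Num.min t (tm i), Num.min t (tm i.+1)) | i <- index_iota 0 n]
  else [::].

Lemma step_in_euler_steps t k : 0 <= t -> step_in t (euler_steps t k).
Proof.
move=> t0; rewrite /euler_steps; case: ifP => // _.
apply/allP => p /mapP[i _ ->] /=; rewrite le_min t0 (mesh_ge0 T0 n0) /=.
apply/andP; split; last by rewrite ge_min lexx.
by rewrite le_min !ge_min lexx /= (mesh_le T0 n0) // orbT.
Qed.

Lemma euler_steps_integral t w :
  \sum_(k < M) step_integral (W k) (euler_steps t k) w =
  \sum_(i < n) lin W M (sigma (tm i)) (Num.min t (tm i)) (Num.min t (tm i.+1)) w.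
Proof.
rewrite /lin exchange_big /=; apply: eq_bigr => k _.
by rewrite /step_integral /euler_steps ltn_ord big_map big_mkord.
Qed.

Lemma euler_steps_fun t k j s : s <= t -> (j < n)%N -> tm j < s <= tm j.+1 ->
  step_fun (euler_steps t k) s = if (k < M)%N then sigma (tm j) k else 0.
Proof.
move=> st jn /andP[js sj]; rewrite /step_fun /euler_steps; case: ifP => _; last by rewrite big_nil.
rewrite big_map big_mkord (bigD1 (Ordinal jn)) //= big1 => [|i].
  rewrite addr0 indicE mem_set ?mulr1 //=; rewrite in_itv /= le_min st sj gt_min js orbT //.
rewrite -val_eqE /= neq_ltn => ij; rewrite indicE memNset ?mulr0 //=; rewrite in_itv /= => /andP[h1 h2].
move: ij => /orP[] ij.
  move: h2; rewrite le_min => /andP[_]; apply/negP; rewrite -ltNge.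
  by apply: le_lt_trans js; exact: mesh_le.
move: h1; apply/negP; rewrite -leNgt le_min st /=.
by apply: le_trans sj _; exact: mesh_le.
Qed.

Let sigma_sqint t k : t <= T -> sqint mu `[0, t] (fun s => sigma s k).
Proof.
move=> tT.
have [cs _] := @lipschitz_measurable _ (fun s => sigma (clamp T s) k) C2 (fun x y =>
  le_trans (sigma_lip C20 hs k (clamp_in T0 y) (clamp_in T0 x)) (ler_wpM2l (ltW C20) (clamp_lip T0 x y))).
have [m1 i1] := continuous_sqint t cs.
have e s : s \in `[0, t]%classic -> sigma (clamp T s) k = sigma s k.
  rewrite inE /= in_itv /= => /andP[h1 h2]; rewrite clampE // in_itv /= h1.
  exact: le_trans tT.
split; first by apply: eq_measurable_fun m1.
apply: le_lt_trans i1; rewrite le_eqVlt; apply/orP; left; apply/eqP.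
by apply: eq_integral => s sI; rewrite (e s sI).
Qed.

Lemma sigma_step_error t m : t \in `[0, T] ->
  \sum_(k < m) ip mu `[0, t] (fun s => sigma s k - step_fun (euler_steps t k) s)
                            (fun s => sigma s k - step_fun (euler_steps t k) s) <=
  t * (2 * (C2 * h) ^+ 2 + 2 * (C2 * delta M) ^+ 2).
Proof.
rewrite in_itv /= => /andP[t0 tT].
pose f k s := sigma s k - step_fun (euler_steps t k) s.
have sf k : sqint mu `[0, t] (f k).
  by apply: sqintB => //; [exact: sigma_sqint|exact: sqint_step_fun].
have mf2 k : measurable_fun `[0, t] (fun s : measurableTypeR R => ((f k s) ^+ 2)%:E).
  by apply: measurable_sqE; case: (sf k).
rewrite -lee_fin -sumEFin.
rewrite (eq_bigr (fun k : 'I_m => \int[mu]_(s in `[0%R, t]) ((f k s) ^+ 2)%:E)%E); last first.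
  by move=> k _; rewrite (ip_sqE (mI t) (sf k)).
rewrite -(ge0_integral_sum mu (mI t)) ; last first.
  by move=> k x _; rewrite lee_fin sqr_ge0.
  by move=> k; exact: mf2.
rewrite -integral_itv_obnd_cbnd; last first.
  apply: (@measurable_funS _ _ _ _ `[0, t]) => //; first by apply: subset_itvr; rewrite bnd_simp.
  exact: emeasurable_sum.
have mo : measurable (`]0, t] : set (measurableTypeR R)) by exact: measurable_itv.
apply: (@le_trans _ _ (\int[mu]_(x in `]0%R, t]) (2 * (C2 * h) ^+ 2 + 2 * (C2 * delta M) ^+ 2)%:E)%E).
  apply: ge0_le_integral => //.
  - by move=> x _; apply: sume_ge0 => k _; rewrite lee_fin sqr_ge0.
  - apply: (@measurable_funS _ _ _ _ `[0, t]) => //; first by apply: subset_itvr; rewrite bnd_simp.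
    exact: emeasurable_sum.
  - move=> s; rewrite /= in_itv /= => /andP[s0 st]; have sT := le_trans st tT.
    have [j jn js] := left_cell n0 s0 sT; have /andP[js1 js2] := js.
    rewrite sumEFin lee_fin; under eq_bigr do rewrite /f (euler_steps_fun _ st jn js).
    apply: le_trans (sum_sigma_error hs m _ _ M0) _.
    + by rewrite in_itv /= ltW.
    + by apply: mesh_in => //; exact: ltnW.
    rewrite lerD2r ler_pM2l // lerXn2r ?nnegrE ?mulr_ge0 // ?(ltW C20) // ?(ltW T0) //.
    rewrite ler_wpM2l ?(ltW C20) // ger0_norm; last by rewrite subr_ge0 ltW.
    by move: js2; rewrite meshS; lra.
rewrite integral_cst // [X in (_ * X)%E](lebesgue_measure_itv (`]0, t] : interval R)) /= lte_fin.
have [_|t0'] := ltP 0 t; first by rewrite oppr0 adde0 -EFinM mulrC.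
by rewrite mule0 (le_anti (introT andP (conj t0' t0))) mul0r.
Qed.

Lemma continuous_primitive (f : R -> R) : continuous f ->
  continuous (fun t => \int[mu]_(s in `[0, clamp T t]) f s).
Proof.
move=> cf.
apply: (@continuous_within_comp _ _ _ `[0, T]%classic (fun t => \int[mu]_(s in `[0, t]) f s) (clamp T)).
- exact: continuous_clamp.
- by move=> t; exact: clamp_in.
- exact: (parameterized_integral_continuous (ltW T0) (continuous_integrable 0 T cf)).
Qed.

Lemma drift_integral (b : nat -> R) t : t \in `[0, T] ->
  \int[mu]_(s in `[0, t]) b (cl s) =
  \sum_(i < n) b i * (Num.min t (tm i.+1) - Num.min t (tm i)).
Proof.
rewrite in_itv /= => /andP[t0 tT].
pose one : R -> R := \1_(`[0, t] : set R).
pose phi (i : nat) (s : R) := one s * b i.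
have ind (u v : R) : mu.-integrable `[u, v] (EFin \o one).
  have c1 : continuous (fun _ : R => 1 : R) by move=> x; exact: cvg_cst.
  apply: le_integrable (continuous_integrable u v c1) => //.
    by apply/measurable_EFinP; exact: measurable_indic.
  by move=> x _ /=; rewrite lee_fin /one indicE; case: (_ \in _); rewrite ?normr1 ?normr0.
have phi_int i : (i < n)%N -> mu.-integrable `[0, T] (EFin \o phi i).
  move=> _; rewrite (_ : EFin \o _ = (fun s => (b i)%:E * (EFin \o one) s)%E).
    exact: integrableZl.
  by apply/funext => s; rewrite /phi /= -EFinM mulrC.
have -> : \int[mu]_(s in `[0, t]) b (cl s) = \int[mu]_(s in `[0, T]) phi (cl s) s.
  rewrite [RHS](_ : _ = \int[mu]_(s in `[0, T] `&` `[0, t]) b (cl s)).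
    congr (Rintegral _ _ _); apply/seteqP; split=> x /=.
      by rewrite !in_itv /= => /andP[p0 xt]; rewrite p0 xt (le_trans xt tT).
    by case.
  rewrite Rintegral_mkcondr; apply: eq_Rintegral => s _.
  by rewrite /phi /one patchE indicE; case: ifP => _; rewrite ?mul1r ?mul0r.
rewrite (Rintegral_cellwise T0 n0 phi_int); apply: eq_bigr => i _.
rewrite RintegralZr // mulrC; congr (_ * _).
have mII : measurable (`[tm i, tm i.+1] : set (measurableTypeR R)) by exact: measurable_itv.
rewrite /Rintegral /= integral_indic //.
have iS : tm i <= tm i.+1 by exact: mesh_le.
have i0 := mesh_ge0 T0 n0 i.
have -> : (`[0, t] `&` `[tm i, tm i.+1] : set R) = `[tm i, Num.min t (tm i.+1)]%classic.
  apply/seteqP; split=> x /=; rewrite !in_itv /= le_min.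
    by move=> [/andP[_ ->] /andP[-> ->]].
  move=> /and3P[ix xt ->]; rewrite ix xt; split=> //.
  by rewrite (le_trans i0 ix).
rewrite [X in fine X](lebesgue_measure_itv (`[tm i, Num.min t (tm i.+1)] : interval R)) /= lte_fin.
by case: (leP t (tm i)) => h1; case: (leP t (tm i.+1)) => h2; case: ltP => h3 //=; lra.
Qed.

Lemma euler_cont_integral t w : t \in `[0, T] ->
  Yc t w = x0 + \int[mu]_(s in `[0, t]) a (tm (cl s)) (Y (cl s) w) +
    \sum_(k < M) step_integral (W k) (euler_steps t k) w.
Proof.
move=> tT; rewrite (drift_integral (fun i => a (tm i) (Y i w)) tT) euler_steps_integral.
by rewrite /euler_cont big_split /= addrA.
Qed.

Let integrable_sub (f : R -> R) t : t \in `[0, T] -> mu.-integrable `[0, T] (EFin \o f) ->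
  mu.-integrable `[0, t] (EFin \o f).
Proof.
rewrite in_itv /= => /andP[t0 tT]; apply: integrableS => //.
by apply: subset_itvl; rewrite bnd_simp.
Qed.

Let integrable_frozen t w : t \in `[0, T] ->
  mu.-integrable `[0, t] (EFin \o (fun s => a (tm (cl s)) (Y (cl s) w))).
Proof.
move=> tT; apply: (integrable_sub tT).
apply: (@integrable_cellwise _ T n T0 n0 (fun i _ => a (tm i) (Y i w))) => i _.
by apply: continuous_integrable => s; exact: cvg_cst.
Qed.

Let integrable_lin_part t w : t \in `[0, T] ->
  mu.-integrable `[0, t] (EFin \o (fun s => lin_part W T x0 a sigma n M s w)).
Proof.
move=> tT; apply: (integrable_sub tT).
apply: (@integrable_cellwise _ T n T0 n0 (fun i s => slope W T x0 a sigma n M i w *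
  lin W M (sigma (tm i)) (tm i) s w)) => i _.
apply: continuous_integrable => s; apply: cvgM; first exact: cvg_cst.
apply: (@continuous_sum_ord _ M (fun k t => sigma (tm i) k * incr (W k) (tm i) t w)) => k {}s.
apply: cvgM; first exact: cvg_cst.
by apply: cvgB; [exact: cW|exact: cvg_cst].
Qed.

Variable X : R -> Omega -> R.
Hypothesis cX : forall w, continuous (X^~ w).
Hypothesis mX : forall t, measurable_fun setT (X t).
Hypothesis solX : forall t, t \in `[0, T] ->
  exists2 I, is_stoch_integral_seq P W sigma t I &
    {ae P, forall w, X t w = x0 + \int[mu]_(s in `[0, t]) a s (X s w) + I w}.

Let cYc w : continuous (Yc^~ w).
Proof. exact: continuous_euler_cont. Qed.

Let drift_X s w := a (clamp T s) (X s w).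
Let drift_Y s w := a (clamp T s) (Yc s w).
Let drift_diff s w := drift_X s w - drift_Y s w.

Let c_drift_X w : continuous (drift_X^~ w).
Proof. by apply: (drift_path_continuous ha (g := clamp T)); [exact: continuous_clamp|exact: cX|exact: clamp_in]. Qed.

Let c_drift_Y w : continuous (drift_Y^~ w).
Proof. by apply: (drift_path_continuous ha (g := clamp T)); [exact: continuous_clamp|exact: cYc|exact: clamp_in]. Qed.

Let c_diff w : continuous (drift_diff^~ w).
Proof. by move=> s; apply: cvgB; [exact: c_drift_X|exact: c_drift_Y]. Qed.

(** What remains of the difference of the two processes after the Lipschitz part of the
   drift has been subtracted. *)
Definition gronwall_rest t w := X t w - Yc t w - time_int drift_diff (clamp T t) w.

Let c_rest w : continuous (gronwall_rest^~ w).
Proof.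
move=> t; apply: cvgB; last exact: continuous_primitive.
by apply: cvgB; [exact: cX|exact: cYc].
Qed.

Let j_diff : jmeas drift_diff.
Proof.
apply: jmeasB; apply: jmeas_continuous => // s.
  by apply: measurableT_comp => //; exact: (drift_measurable ha (clamp_in T0 s)).
apply: measurableT_comp; first exact: (drift_measurable ha (clamp_in T0 s)).
exact: (measurable_euler_cont x0 sigma nW mW T0 ha M n0).
Qed.

Let j_rest : jmeas gronwall_rest.
Proof.
apply: jmeas_continuous => // t; apply: measurable_funB; last exact: measurable_time_int.
by apply: measurable_funB => //; exact: (measurable_euler_cont x0 sigma nW mW T0 ha M n0).
Qed.

Let path_bound w :
  \int[mu]_(s in `[0, T]) (X s w - Yc s w) ^+ 2 <=
  2 * expR (2 * C1 ^+ 2 * T * T) * \int[mu]_(s in `[0, T]) (gronwall_rest s w) ^+ 2.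
Proof.
have ce : continuous (fun s => X s w - Yc s w).
  by move=> s; apply: cvgB; [exact: cX|exact: cYc].
apply: (gronwall_L2 T0 (ltW C10) ce (@c_rest w)) => t t0 tT.
have tI : t \in `[0, T] by rewrite in_itv /= t0.
rewrite (_ : X t w - Yc t w = gronwall_rest t w + time_int drift_diff t w); last first.
  by rewrite /gronwall_rest (clampE tI) subrK.
apply: le_trans (ler_normD _ _) _; rewrite lerD2l.
apply: le_trans (le_normr_Rintegral (mI t) (continuous_integrable 0 t (@c_diff w))) _.
have cn f : continuous f -> continuous (fun s : R => `|f s| : R).
  by move=> cf s; apply: cvg_norm; exact: cf.
rewrite -RintegralZl //; last by apply: continuous_integrable; exact: cn.
apply: le_Rintegral => //.
- by apply: continuous_integrable; exact: cn.
- have cC : continuous (fun s : R => C1 * `|X s w - Yc s w|).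
    by move=> s; apply: cvgM; [exact: cvg_cst|apply: cvg_norm; exact: ce].
  exact: continuous_integrable.
- by move=> s _; exact: (drift_lipschitz ha _ _ (clamp_in T0 s)).
Qed.

Definition rest_bound (K : nat) : R :=
  3 * (8 * (T * (2 * (C2 * h) ^+ 2 + 2 * (C2 * delta M) ^+ 2))) +
  3 * (T ^+ 2 * rem_bound T x0 C1 C2 delta n K) + 3 * (T * (C1 ^+ 2 * S ^+ 2 * h ^+ 2)).

(** The rest consists of the error of the stochastic integral and of the accumulated
   drift error, itself split into its linear part and its remainder. *)
Lemma rest_decomposition t w I : t \in `[0, T] ->
  X t w = x0 + \int[mu]_(s in `[0, t]) a s (X s w) + I ->
  gronwall_rest t w = (I - \sum_(k < M) step_integral (W k) (euler_steps t k) w) +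
    time_int rem t w + time_int (lin_part W T x0 a sigma n M) t w.
Proof.
move=> tT XE; rewrite /gronwall_rest (clampE tT) XE (euler_cont_integral w tT).
have -> : \int[mu]_(s in `[0, t]) a s (X s w) = time_int drift_X t w.
  apply: eq_Rintegral => s; rewrite inE /= in_itv /= => /andP[s0 st].
  rewrite /drift_X clampE // in_itv /= s0; move: tT; rewrite in_itv /= => /andP[_ tT].
  exact: le_trans st tT.
have -> : time_int drift_diff t w = time_int drift_X t w - time_int drift_Y t w.
  by apply: RintegralB => //; exact: continuous_integrable.
have -> : time_int rem t w = time_int drift_Y t w -
    \int[mu]_(s in `[0, t]) a (tm (cl s)) (Y (cl s) w) - time_int (lin_part W T x0 a sigma n M) t w.
  have iY : mu.-integrable `[0, t] (EFin \o (drift_Y^~ w)) by apply: continuous_integrable; exact: c_drift_Y.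
  have gi : mu.-integrable `[0, t] (EFin \o (fun s => drift_gap W T x0 a sigma n M s w)).
    exact: (integrableB (mI t) iY (integrable_frozen w tT)).
  rewrite /time_int RintegralB //; last exact: integrable_lin_part.
  by rewrite RintegralB //; exact: integrable_frozen.
ring.
Qed.

Lemma rest_L2 K t : (0 < K)%N -> t \in `[0, T] ->
  (\int[P]_w ((gronwall_rest t w) ^+ 2)%:E <= (rest_bound K)%:E)%E.
Proof.
move=> K0 tT; have [I hI eI] := solX tT.
have [t0 tT'] : 0 <= t /\ t <= T by move: tT; rewrite in_itv /= => /andP[].
pose Q w := I w - \sum_(k < M) step_integral (W k) (euler_steps t k) w.
pose C := t * (2 * (C2 * h) ^+ 2 + 2 * (C2 * delta M) ^+ 2).
have [sQ EQ] : sqint P setT Q /\ E Q Q <= 8 * C.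
  apply: (stoch_integral_seq_error nW hI).
  - by move=> k; exact: step_in_euler_steps.
  - by move=> k Mk; rewrite /euler_steps ltnNge Mk.
  - by move=> k; exact: sigma_sqint.
  - by move=> m; exact: sigma_step_error.
have [sG EG] := time_int_L2 (H := rem) t0 (jmeas_rem_part x0 sigma nW cW mW T0 ha M n0)
  (fun s s0 st => rem_part_L2 x0 nW cW mW T0 C10 C20 ha hs M n0 K0
    (introT andP (conj s0 (le_trans st tT')))).
have [sL EL] := time_int_lin_part x0 nW cW mW T0 C20 ha hs M n0 tT.
set G := time_int rem t in sG EG; set L := time_int _ t in sL EL.
pose r w := Q w + G w + L w.
have sr : sqint P setT r by apply: sqintD => //; exact: sqintD.
have -> : (\int[P]_w ((gronwall_rest t w) ^+ 2)%:E = \int[P]_w ((r w) ^+ 2)%:E)%E.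
  apply: ae_eq_integral => //.
  - by apply: measurable_sqE; exact: (jmeas_omega t j_rest).
  - by apply: measurable_sqE; case: sr.
  - by apply: filterS eI => w /(rest_decomposition tT) e _ /=; rewrite e.
rewrite ip_sqE // lee_fin.
pose gs := nth (fun=> 0) [:: Q; G; L].
have [] := @sqint_dominated _ _ _ P 3 (fun=> 3) gs r (sqint_meas sr).
- by [].
- by move=> [|[|[|]]].
- move=> w; rewrite /r -mulr_sumr; have := sqr_sum_le 3 (fun i => gs i w).
  by rewrite !big_ord_recr !big_ord0 /= !add0r.
move=> _; rewrite !big_ord_recr !big_ord0 /= add0r => le; apply: le_trans le _.
have h0 := mstep_gt0 T0 n0.
have hC : 8 * C <= 8 * (T * (2 * (C2 * h) ^+ 2 + 2 * (C2 * delta M) ^+ 2)).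
  by rewrite ler_pM2l // ler_wpM2r // addr_ge0 // mulr_ge0 // sqr_ge0.
have hG : t ^+ 2 * rem_bound T x0 C1 C2 delta n K <= T ^+ 2 * rem_bound T x0 C1 C2 delta n K.
  rewrite ler_wpM2r //; last by rewrite lerXn2r ?nnegrE ?(ltW T0).
  rewrite -lee_fin; apply: le_trans (rem_part_L2 x0 nW cW mW T0 C10 C20 ha hs M n0 K0 tT).
  exact: ge0_integral_sq.
rewrite /rest_bound; apply: lerD; [apply: lerD|]; rewrite ler_pM2l //.
- exact: le_trans hC.
- exact: le_trans hG.
Qed.

(** The solution and the continuous Euler process solve the same equation up to
   [gronwall_rest], whose second moment is of order
   $h^2+\delta(M)^2+h\,\delta(K)^2$. *)
Lemma solution_euler_cont K : (0 < K)%N ->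
  (\int[P]_w \int[mu]_(s in `[0%R, T]) ((X s w - Yc s w) ^+ 2)%:E <=
   (2 * expR (2 * C1 ^+ 2 * T * T) * (T * rest_bound K))%:E)%E.
Proof.
move=> K0.
have c2 w : continuous (fun s => X s w - Yc s w) by move=> s; apply: cvgB; [exact: cX|exact: cYc].
pose A := 2 * expR (2 * C1 ^+ 2 * T * T).
have A0 : 0 <= A by rewrite mulr_ge0 // expR_ge0.
have j2 : jmeas (fun s w => gronwall_rest s w ^+ 2) by exact: jmeasX.
apply: (@le_trans _ _ (\int[P]_w (A%:E * \int[mu]_(s in `[0%R, T]) ((gronwall_rest s w) ^+ 2)%:E))%E).
  apply: ge0_le_integral => //.
  - by move=> w _; exact: ge0_integral_sq.
  - apply: measurable_ge0_integral_time => [|s w]; last exact: sqr_ge0.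
    apply: jmeasX; apply: jmeasB; first exact: jmeas_continuous.
    exact: (jmeas_euler_cont x0 sigma nW cW mW T0 ha M n0).
  - by apply: emeasurable_funM => //; apply: measurable_ge0_integral_time => // s w; exact: sqr_ge0.
  - move=> w _; have s1 := continuous_sqint T (c2 w); have s2 := continuous_sqint T (@c_rest w).
    rewrite (ip_sqE (mI T) s1) (ip_sqE (mI T) s2) -EFinM lee_fin.
    have := path_bound w; rewrite -/A /ip.
    by under eq_Rintegral do rewrite expr2; under [X in _ <= _ * X]eq_Rintegral do rewrite expr2.
rewrite ge0_integralZl //; last first.
- by move=> w _; exact: ge0_integral_sq.
- by apply: measurable_ge0_integral_time => // s w; exact: sqr_ge0.
rewrite (tonelli_time P T j2) => [|s w]; last exact: sqr_ge0.
rewrite -/A [X in (_ <= X)%E]EFinM; apply: lee_wpmul2l; first by rewrite lee_fin.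
apply: integral_time_le; first exact: ltW.
- by move=> s; exact: ge0_integral_sq.
- by apply: measurable_ge0_integral_omega => // s w; exact: sqr_ge0.
- by move=> s s0 sT; apply: rest_L2 => //; rewrite in_itv /= s0.
Qed.

End solution_distance.

(** * The interpolation error: Brownian bridges on the cells *)

Section bridge_integral.
Variable R : realType.
Notation mu := (@lebesgue_measure R).

Lemma bridge_variance_integral (c p h : R) : 0 < h ->
  \int[mu]_(s in `[p, p + h]) (c * ((s - p) * (p + h - s) / h)) = c * (h ^+ 2 / 6).
Proof.
move=> h0.
pose F (s : R) : R := c / h * (h / 2 * (s - p) ^+ 2 - 3^-1 * (s - p) ^+ 3).
pose f (s : R) : R := c * ((s - p) * (p + h - s) / h).
have dF (x : R) : is_derive x 1 F (f x).
  have d1 : is_derive x 1 (fun s : R => s - p) 1.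
    by apply: is_derive_eq; rewrite ?oppr0 ?addr0.
  have d2 := @is_deriveX _ _ (fun s : R => s - p) 2 x 1 _ d1.
  have d3 := @is_deriveX _ _ (fun s : R => s - p) 3 x 1 _ d1.
  have e2 := @is_deriveZ _ _ _ _ (h / 2) _ _ _ d2.
  have e3 := @is_deriveZ _ _ _ _ (3^-1) _ _ _ d3.
  have e := @is_deriveZ _ _ _ _ (c / h) _ _ _ (@is_deriveB _ _ _ _ _ _ _ _ _ e2 e3).
  apply: (is_derive_eq e); rewrite /f /GRing.scale /= /GRing.scale /=.
  by field; rewrite gt_eqF.
have cont : continuous f.
  move=> s; apply: cvgM; first exact: cvg_cst.
  apply: cvgM; last exact: cvg_cst.
  apply: cvgM; apply: cvgB; first exact: cvg_id.
  - exact: cvg_cst.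
  - exact: cvg_cst.
  - exact: cvg_id.
have cF : continuous F by move=> s; apply: differentiable_continuous; apply/derivable1_diffP; case: (dF s).
have ph : p < p + h by rewrite ltrDl.
rewrite /Rintegral (@continuous_FTC2 _ f F p (p + h) ph).
- by rewrite -EFinB /= /F; field; rewrite gt_eqF.
- exact: continuous_subspaceT.
- split; first by move=> x _; case: (dF x).
  + by apply: cvg_at_right_filter; exact: cF.
  + by apply: cvg_at_left_filter; exact: cF.
- by move=> x _; rewrite derive1E; exact: derive_val.
Qed.

End bridge_integral.

Section interpolation.
Context d (Omega : measurableType d) (R : realType) (P : probability Omega R).
Variables (F : R -> set (set Omega)) (W : nat -> R -> Omega -> R).
Variables (T x0 C1 C2 : R) (delta : nat -> R) (a : R -> R -> R) (sigma : R -> nat -> R).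
Hypothesis nW : noise P F W.
Hypothesis cW : forall k w, continuous (fun t => W k t w).
Hypothesis mW : forall k t, measurable_fun setT (W k t).
Hypothesis T0 : 0 < T.
Hypothesis C20 : 0 < C2.
Hypothesis ha : drift_conditions T C1 a.
Hypothesis hs : diffusion_conditions T C2 delta sigma.
Variables (n M : nat).
Hypothesis n0 : (0 < n)%N.
Notation E := (ip P setT).
Notation tm := (mesh T n).
Notation h := (mstep T n).
Notation Y := (euler T x0 a sigma W M n).
Notation S := (sbound T C2).
Notation cl := (cell T n).
Notation Yc := (euler_cont W T x0 a sigma n M).
Notation Yl := (euler_interp T x0 a sigma W M n).
Notation mu := (@lebesgue_measure R).

Let mT : measurable (setT : set Omega). Proof. exact: measurableT. Qed.
Let mI t : measurable (`[0, t] : set (measurableTypeR R)). Proof. exact: measurable_itv. Qed.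

Definition trunc_norm2 j : R := \sum_(k < M) sigma (tm j) k ^+ 2.

Lemma jmeas_euler_interp : jmeas Yl.
Proof.
pose H j t w := Y j w + (t - tm j) / (tm j.+1 - tm j) * (Y j.+1 w - Y j w).
rewrite (_ : Yl = fun s w => H (cl s) s w) //; apply: jmeas_cell => // i ltin; rewrite /H.
have mY j : (j <= n)%N -> jmeas (fun _ : R => Y j).
  by move=> jn; apply: jmeas_static; exact: (measurable_euler x0 sigma nW T0 ha M n0).
apply: jmeasD; first by apply: mY; exact: ltnW.
apply: jmeasM; last by apply: jmeasB; apply: mY => //; exact: ltnW.
apply: jmeas_continuous => [w s|s]; last exact: measurable_cst.
by apply: cvgM; [apply: cvgB; [exact: cvg_id|exact: cvg_cst]|exact: cvg_cst].
Qed.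

(** On a cell the difference is the bridge of the noise between the end points,
    whose variance vanishes there. *)
Lemma bridge_L2 s : s \in `[0, T] ->
  (\int[P]_w ((Yc s w - Yl s w) ^+ 2)%:E =
   (trunc_norm2 (cl s) * ((s - tm (cl s)) * (tm (cl s) + h - s) / h))%:E)%E.
Proof.
move=> sT; pose j := cl s; rewrite -/j.
have jn : (j < n)%N := cell_lt T n0 s; have /andP[js sj] := cell_itv T0 n0 sT.
rewrite -/j in js sj.
have j0 := mesh_ge0 T0 n0 j; have h0 := mstep_gt0 T0 n0.
pose u := (s - tm j) / h.
pose A := lin W M (sigma (tm j)) (tm j) s.
pose B := lin W M (sigma (tm j)) s (tm j.+1).
have s0 : 0 <= s by exact: le_trans js.
have sA : sqint P setT A := sqint_lin nW _ _ j0 js.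
have sB : sqint P setT B := sqint_lin nW _ _ s0 sj.
have AB : E A B = 0.
  by apply: (ip_fmeas_lin nW) => //; exact: (fmeas_lin nW).
have brE w : Yc s w - Yl s w = (1 - u) * A w + (- u) * B w.
  rewrite (euler_cont_cell W x0 a sigma T0 M n0 w jn) ?js // /euler_interp -/(cell T n s) -/j.
  rewrite (euler_step W T x0 a sigma n M j w).
  have -> : lin W M (sigma (tm j)) (tm j) (tm j.+1) w = A w + B w.
    rewrite /A /B /lin -big_split /=; apply: eq_bigr => k _; rewrite /incr; ring.
  by rewrite -/(A w) meshS /u; field; rewrite gt_eqF.
have s1 := sqintZ mT (1 - u) sA; have s2 := sqintZ mT (- u) sB.
under eq_integral do rewrite brE.
rewrite ip_sqE //; last exact: sqintD.
congr EFin.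
rewrite (ipDl mT s1 s2 (sqintD mT s1 s2)) (ipDr mT s1 s2 s1) (ipDr mT s1 s2 s2).
rewrite !(ipZl mT) // !(ipZr mT) // (ipC _ _ B A) AB.
rewrite (ip_lin nW _ _ j0 js) (ip_lin nW _ _ s0 sj) -/(trunc_norm2 j) meshS /u.
by field; rewrite gt_eqF.
Qed.

Lemma interpolation_error :
  (\int[P]_w \int[mu]_(s in `[0%R, T]) ((Yc s w - Yl s w) ^+ 2)%:E =
   (h ^+ 2 / 6 * \sum_(j < n) trunc_norm2 j)%:E)%E.
Proof.
have jb : jmeas (fun s w => (Yc s w - Yl s w) ^+ 2).
  by apply: jmeasX; apply: jmeasB; [exact: (jmeas_euler_cont x0 sigma nW cW mW T0 ha M n0)|exact: jmeas_euler_interp].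
have h0 := mstep_gt0 T0 n0.
rewrite (tonelli_time P T jb) => [|s w]; last exact: sqr_ge0.
pose phi j s := trunc_norm2 j * ((s - tm j) * (tm j + h - s) / h).
have phi_int j : (j < n)%N -> mu.-integrable `[0, T] (EFin \o phi j).
  move=> _; apply: continuous_integrable => s; apply: cvgM; first exact: cvg_cst.
  apply: cvgM; last exact: cvg_cst.
  apply: cvgM; apply: cvgB; first exact: cvg_id.
  - exact: cvg_cst.
  - exact: cvg_cst.
  - exact: cvg_id.
transitivity (\int[mu]_(s in `[0%R, T]) (phi (cl s) s)%:E)%E.
  by apply: eq_integral => s; rewrite inE /= => sT; rewrite bridge_L2.
transitivity (\int[mu]_(s in `[0, T]) phi (cl s) s)%:E.
  by rewrite /Rintegral fineK // integrable_fin_num //; exact: integrable_cellwise.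
rewrite (Rintegral_cellwise T0 n0 phi_int) mulr_sumr; congr EFin; apply: eq_bigr => j _.
by rewrite meshS bridge_variance_integral // mulrC.
Qed.

Lemma integrable_snorm2 : mu.-integrable `[0, T] (EFin \o (fun s => snorm sigma s ^+ 2)).
Proof.
have [cs _] := @lipschitz_measurable _ (fun s => snorm sigma (clamp T s)) C2 (fun x y =>
  le_trans (snorm_lip hs (clamp_in T0 y) (clamp_in T0 x)) (ler_wpM2l (ltW C20) (clamp_lip T0 x y))).
have := integrable_sq (continuous_sqint T cs).
apply: eq_integrable => // s; rewrite inE /= => sT; by rewrite /= clampE.
Qed.

(** The sum over the mesh is a Riemann sum of $|P_M\sigma|^2$. *)
Lemma trunc_norm2_riemann : (0 < M)%N ->
  `|h * (\sum_(j < n) trunc_norm2 j) - \int[mu]_(s in `[0, T]) (snorm sigma s ^+ 2)| <=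
  T * (2 * S * (C2 * h + C2 * delta M)).
Proof.
move=> M0; have h0 := mstep_gt0 T0 n0.
pose phi j (s : R) := trunc_norm2 j.
have phi_int j : (j < n)%N -> mu.-integrable `[0, T] (EFin \o phi j).
  by move=> _; apply: continuous_integrable => s; exact: cvg_cst.
have -> : h * \sum_(j < n) trunc_norm2 j = \int[mu]_(s in `[0, T]) phi (cl s) s.
  rewrite (Rintegral_cellwise T0 n0 phi_int) mulr_sumr; apply: eq_bigr => j _.
  rewrite /phi Rintegral_cst //.
  rewrite [X in fine X](lebesgue_measure_itv (`[tm j, tm j.+1] : interval R)) /= lte_fin.
  by rewrite meshS ltrDl h0 /= mulrC addrAC subrr add0r.
have pI := integrable_cellwise T0 n0 phi_int.
rewrite -(RintegralB (mI T) pI integrable_snorm2).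
apply: le_trans (le_normr_Rintegral (mI T) (integrableB (mI T) pI integrable_snorm2)) _.
have -> : T * (2 * S * (C2 * h + C2 * delta M)) = \int[mu]_(s in `[0, T]) (2 * S * (C2 * h + C2 * delta M)).
  by rewrite Rintegral_cst // [X in fine X](mu_itv0 (ltW T0)) /= mulrC.
apply: le_Rintegral => //.
- exact: (integrable_norm (integrableB (mI T) pI integrable_snorm2)).
- by apply: continuous_integrable => s; exact: cvg_cst.
- move=> s sT; have /andP[js sj] := cell_itv T0 n0 sT.
  have tjT : tm (cl s) \in `[0, T] by apply: mesh_in => //; exact: ltnW (cell_lt T n0 s).
  apply: le_trans (sum_sigma_snorm T0 C20 hs sT tjT M0) _.
  rewrite ler_wpM2l //; first by rewrite mulr_ge0 // ltW // sbound_gt0.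
  rewrite lerD2r ler_pM2l // ger0_norm ?subr_ge0 //.
  by move: sj; rewrite meshS; lra.
Qed.

End interpolation.

(** * The limit for processes with continuous paths *)

(** A substitute for the triangle inequality of the norm: the Young inequalities with
   arbitrary [e] transfer the limit from [b] to [v] when the perturbation [r]
   vanishes. *)
Lemma two_sided_young_cvg (R : realType) (v b r : nat -> R) (L : R) :
  (forall n, 0 <= b n) -> (forall n, 0 <= v n) ->
  (forall n (e : R), (0 < n)%N -> 0 < e -> v n <= (1 + e) * b n + (1 + e^-1) * r n) ->
  (forall n (e : R), (0 < n)%N -> 0 < e -> b n <= (1 + e) * v n + (1 + e^-1) * r n) ->
  b n @[n --> \oo] --> L -> r n @[n --> \oo] --> 0 -> v n @[n --> \oo] --> L.
Proof.
move=> b0 v0 h1 h2 bL r0; apply/cvgrPdist_lt => eta eta0.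
have L0 : 0 <= L.
  by rewrite -(cvg_lim _ bL) //; apply: limr_ge; [apply: cvgP bL|apply: nearW].
pose e := eta / (3 * (2 * L + 4)).
have e0 : 0 < e by rewrite divr_gt0 // mulr_gt0 // ltr_wpDl // mulr_ge0.
have eE : e * (2 * L + 4) = eta / 3.
  by rewrite /e; field; rewrite gt_eqF // ltr_wpDl // mulr_ge0.
have c0 : 0 < 1 + e^-1 by rewrite addr_gt0 // invr_gt0.
have d0 : 0 < eta / 3 / (1 + e^-1) by rewrite !divr_gt0.
move/cvgrPdist_lt : bL => bL; move/cvgrPdist_lt : r0 => r0.
have e3 : 0 < eta / 3 by rewrite divr_gt0.
near=> n.
have n0 : (0 < n)%N by near: n; exact: nbhs_infty_gt.
have k1 : `|L - b n| < eta / 3 by near: n; exact: bL.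
have k2 : `|L - b n| < 1 by near: n; exact: bL.
have k3 : `|0 - r n| < 1 by near: n; exact: r0.
have k4 : `|0 - r n| < eta / 3 / (1 + e^-1) by near: n; exact: r0.
have k5 : (1 + e^-1) * r n < eta / 3.
  rewrite mulrC -ltr_pdivlMr //; apply: le_lt_trans k4.
  by rewrite sub0r normrN ler_norm.
have := h1 n 1 n0 ltr01; rewrite invr1 => v1.
have bb := b0 n; have vv := v0 n.
have rr : r n <= 1 by move: k3; rewrite sub0r normrN ltr_norml; lra.
have bl : b n <= L + 1 by move: k2; rewrite ltr_norml; lra.
have g1 : e * b n <= e * (2 * L + 4) by rewrite ler_pM2l //; lra.
have g2 : e * v n <= e * (2 * L + 4) by rewrite ler_pM2l //; lra.
have := h1 n e n0 e0; have := h2 n e n0 e0.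
move: k1; rewrite !ltr_norml; lra.
Unshelve. all: by end_near. Qed.

Section continuous_case.
Context d (Omega : measurableType d) (R : realType) (P : probability Omega R).
Variables (F : R -> set (set Omega)) (W : nat -> R -> Omega -> R).
Variables (T x0 C1 C2 : R) (delta : nat -> R) (a : R -> R -> R) (sigma : R -> nat -> R).
Hypothesis nW : noise P F W.
Hypothesis cW : forall k w, continuous (fun t => W k t w).
Hypothesis mW : forall k t, measurable_fun setT (W k t).
Hypothesis T0 : 0 < T.
Hypothesis C10 : 0 < C1.
Hypothesis C20 : 0 < C2.
Hypothesis hd : delta_seq delta.
Hypothesis ha : drift_conditions T C1 a.
Hypothesis hs : diffusion_conditions T C2 delta sigma.
Variable X : R -> Omega -> R.
Hypothesis cX : forall w, continuous (X^~ w).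
Hypothesis mX : forall t, measurable_fun setT (X t).
Hypothesis solX : forall t, t \in `[0, T] ->
  exists2 I, is_stoch_integral_seq P W sigma t I &
    {ae P, forall w, X t w = x0 + \int[@lebesgue_measure R]_(s in `[0, t]) a s (X s w) + I w}.
Variable M : nat -> nat.
Hypothesis hM : G_class delta M.
Notation mu := (@lebesgue_measure R).
Notation S := (sbound T C2).
Notation Yc n := (euler_cont W T x0 a sigma n (M n)).
Notation Yl n := (euler_interp T x0 a sigma W (M n) n).
Notation energy H := (\int[P]_w \int[mu]_(s in `[0%R, T]) ((H s w) ^+ 2)%:E)%E.

Let mI t : measurable (`[0, t] : set (measurableTypeR R)). Proof. exact: measurable_itv. Qed.

Lemma energy_ge0 (H : R -> Omega -> R) : (0 <= energy H)%E.
Proof. by apply: integral_ge0 => w _; exact: ge0_integral_sq. Qed.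

Lemma energy_combination (c1 c2 : R) (H H1 H2 : R -> Omega -> R) :
  jmeas H -> jmeas H1 -> jmeas H2 -> 0 <= c1 -> 0 <= c2 ->
  (forall s w, (H s w) ^+ 2 <= c1 * (H1 s w) ^+ 2 + c2 * (H2 s w) ^+ 2) ->
  (energy H <= c1%:E * energy H1 + c2%:E * energy H2)%E.
Proof.
move=> jH j1 j2 c10 c20 le.
have mi H' : jmeas H' -> measurable_fun setT (fun w => \int[mu]_(s in `[0%R, T]) ((H' s w) ^+ 2)%:E)%E.
  by move=> jH'; apply: measurable_ge0_integral_time => [|s w]; [exact: jmeasX|exact: sqr_ge0].
have ms H' w : jmeas H' -> measurable_fun `[0, T] (fun s : measurableTypeR R => ((H' s w) ^+ 2)%:E).
  by move=> jH'; apply: measurable_sqE; apply: measurable_funTS; exact: jmeas_time.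
rewrite -!ge0_integralZl //; try by [exact: mi | move=> w _; exact: ge0_integral_sq].
rewrite -ge0_integralD //; last first.
- by apply: emeasurable_funM => //; exact: mi.
- by move=> w _; apply: mule_ge0; [rewrite lee_fin|exact: ge0_integral_sq].
- by apply: emeasurable_funM => //; exact: mi.
- by move=> w _; apply: mule_ge0; [rewrite lee_fin|exact: ge0_integral_sq].
apply: ge0_le_integral => //.
- by move=> w _; exact: ge0_integral_sq.
- exact: mi.
- by apply: emeasurable_funD; apply: emeasurable_funM => //; exact: mi.
move=> w _; rewrite -!ge0_integralZl //; try by [exact: ms|move=> s _; rewrite lee_fin sqr_ge0].
rewrite -ge0_integralD //; last first.
- by apply: emeasurable_funM => //; exact: ms.
- by move=> s _; rewrite -EFinM lee_fin mulr_ge0 // sqr_ge0.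
- by apply: emeasurable_funM => //; exact: ms.
- by move=> s _; rewrite -EFinM lee_fin mulr_ge0 // sqr_ge0.
apply: ge0_le_integral => //.
- by move=> s _; rewrite lee_fin sqr_ge0.
- exact: ms.
- by apply: emeasurable_funD; apply: emeasurable_funM => //; exact: ms.
by move=> s _; rewrite -!EFinM -EFinD lee_fin.
Qed.

Let M_gt0 n : (0 < n)%N -> (0 < M n)%N. Proof. by case: hM => h _ _ _; exact: h. Qed.

Let mstep_cvg : mstep T n @[n --> \oo] --> 0.
Proof.
rewrite -[X in _ --> X](mulr0 T); apply: cvgM; first exact: cvg_cst.
exact: cvg_invn.
Qed.

Let delta_cvg : delta (M n) @[n --> \oo] --> 0.
Proof. by case: hM => _ _ Moo _; case: hd => _ _ d0; exact: (cvg_comp _ _ Moo d0). Qed.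

Let rem1 := rem_cst1 T C1.
Let rem2 := rem_cst2 T C1.
Let gr : R := 2 * expR (2 * C1 ^+ 2 * T * T).

Let euler_rate n : R := n%:R * fine (energy (fun s w => X s w - Yc n s w)).
Let interp_rate n : R := n%:R * (mstep T n ^+ 2 / 6 * \sum_(j < n) trunc_norm2 T sigma n (M n) j).

Let tail_cst : R := gr * T * (3 * T ^+ 2 * (5 * rem2 ^+ 2 * T * C2 ^+ 2)).
Let coef_mesh K : R :=
  gr * T * (48 * T * C2 ^+ 2 * T + 3 * T ^+ 2 * (5 * rem1 ^+ 2 * euler_bound T x0 C1 C2 * T +
    15 * C1 ^+ 2 * K%:R ^+ 4 * S ^+ 4 * T) + 3 * T ^+ 2 * C1 ^+ 2 * S ^+ 2).
Let coef_mesh2 : R := gr * T * (3 * T ^+ 2 * (5 * C1 ^+ 2 * S ^+ 2 * T)).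
Let coef_delta : R := gr * T * (48 * T * C2 ^+ 2).
Let vanishing (K n : nat) : R := coef_mesh K * mstep T n + coef_mesh2 * (mstep T n * mstep T n) +
  coef_delta * (Num.sqrt n%:R * delta (M n) * (Num.sqrt n%:R * delta (M n))).

Let vanishing_cvg K : vanishing K n @[n --> \oo] --> 0.
Proof.
rewrite -[X in _ --> X](_ : coef_mesh K * 0 + coef_mesh2 * (0 * 0) + coef_delta * (0 * 0) = 0); last first.
  by rewrite !(mulr0, addr0).
case: hM => _ _ _ hq.
apply: cvgD; first apply: cvgD; (apply: cvgM; first exact: cvg_cst).
- exact: mstep_cvg.
- by apply: cvgM; exact: mstep_cvg.
- by apply: cvgM; exact: hq.
Qed.

(** Multiplied by the number of steps, every term of the bound vanishes as the mesh is
   refined, except for the tail of order $\delta(K)^2$. *)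
Let rest_bound_rate K n : (0 < n)%N ->
  n%:R * (gr * (T * rest_bound T x0 C1 C2 delta n (M n) K)) =
  vanishing K n + tail_cst * delta K ^+ 2.
Proof.
move=> n0; have nz : n%:R != 0 :> R by rewrite pnatr_eq0 -lt0n.
rewrite /vanishing /coef_mesh /coef_mesh2 /coef_delta /tail_cst /rest_bound /rem_bound -/rem1 -/rem2.
rewrite [X in _ = _ + _ + _ * X + _](_ : _ = n%:R * delta (M n) ^+ 2); last first.
  by rewrite -{3}(sqr_sqrtr (ler0n R n)); ring.
by rewrite /mstep; field.
Qed.

Let euler_energy_le K n : (0 < K)%N -> (0 < n)%N ->
  (energy (fun s w => X s w - Yc n s w) <=
   (gr * (T * rest_bound T x0 C1 C2 delta n (M n) K))%:E)%E.
Proof.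
by move=> K0 n0; exact: (solution_euler_cont nW cW mW T0 C10 C20 ha hs n0 (M_gt0 n0) cX mX solX K0).
Qed.

Let euler_energy_fin n : (0 < n)%N -> energy (fun s w => X s w - Yc n s w) \is a fin_num.
Proof.
move=> n0; rewrite ge0_fin_numE; last exact: energy_ge0.
by apply: le_lt_trans (euler_energy_le (ltn0Sn 0) n0) _; exact: ltry.
Qed.

(** The mesh is refined with the number [K] of quadratically treated components
    fixed; then [K] is let to infinity. *)
Let euler_rate_cvg : euler_rate n @[n --> \oo] --> 0.
Proof.
apply/cvgrPdist_lt => eta eta0.
have tail0 : 0 <= tail_cst.
  have g0 : 0 <= gr by rewrite mulr_ge0 // expR_ge0.
  rewrite /tail_cst; apply: mulr_ge0; first by rewrite mulr_ge0 // ltW.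
  apply: mulr_ge0; first by rewrite mulr_ge0 // sqr_ge0.
  by apply: mulr_ge0; [apply: mulr_ge0; [rewrite mulr_ge0 // sqr_ge0|exact: ltW]|exact: sqr_ge0].
have [K K0 hK] : exists2 K, (0 < K)%N & tail_cst * delta K ^+ 2 < eta / 2.
  have c : tail_cst * delta k ^+ 2 @[k --> \oo] --> 0.
    rewrite -[X in _ --> X](_ : tail_cst * (0 * 0) = 0); last by rewrite !mulr0.
    apply: cvgM; first exact: cvg_cst.
    by case: hd => _ _ d0; apply: (cvgM d0 d0).
  have e2 : 0 < eta / 2 by rewrite divr_gt0.
  move/cvgrPdist_lt : c => /(_ _ e2) [m _ hm]; exists m.+1 => //.
  by apply: le_lt_trans (hm m.+1 (leqnSn m)); rewrite sub0r normrN ler_norm.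
have e2 : 0 < eta / 2 by rewrite divr_gt0.
near=> n.
have n0 : (0 < n)%N by near: n; exact: nbhs_infty_gt.
have k1 : `|0 - vanishing K n| < eta / 2 by near: n; move/cvgrPdist_lt : (@vanishing_cvg K); apply.
have r0 : 0 <= euler_rate n by rewrite mulr_ge0 // fine_ge0 // energy_ge0.
rewrite sub0r normrN ger0_norm //.
apply: (@le_lt_trans _ _ (vanishing K n + tail_cst * delta K ^+ 2)).
  rewrite -rest_bound_rate // ler_wpM2l // -lee_fin fineK; last exact: euler_energy_fin.
  exact: euler_energy_le.
move: k1; rewrite sub0r normrN ltr_norml; lra.
Unshelve. all: by end_near. Qed.

Let interp_rate_cvg : interp_rate n @[n --> \oo] -->
  T / 6 * \int[mu]_(s in `[0, T]) (snorm sigma s ^+ 2).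
Proof.
set L := \int[mu]_(s in _) _.
pose err n := T / 6 * (T * (2 * S * (C2 * mstep T n + C2 * delta (M n)))).
have err0 : err n @[n --> \oo] --> 0.
  rewrite -[X in _ --> X](_ : T / 6 * (T * (2 * S * (C2 * 0 + C2 * 0))) = 0); last first.
    by rewrite !(mulr0, addr0).
  do 3 (apply: cvgM; first exact: cvg_cst).
  by apply: cvgD; (apply: cvgM; first exact: cvg_cst).
have lo : T / 6 * L - err n @[n --> \oo] --> T / 6 * L.
  by rewrite -[X in _ --> X]subr0; apply: cvgB => //; exact: cvg_cst.
have up : T / 6 * L + err n @[n --> \oo] --> T / 6 * L.
  by rewrite -[X in _ --> X]addr0; apply: cvgD => //; exact: cvg_cst.
apply: (squeeze_cvgr _ lo up); near=> n.
have n0 : (0 < n)%N by near: n; exact: nbhs_infty_gt.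
have := trunc_norm2_riemann T0 C20 hs n0 (M_gt0 n0); rewrite -/L.
set Sg := \sum_(j < n) _ => h.
have -> : interp_rate n = T / 6 * (mstep T n * Sg).
  rewrite /interp_rate -/Sg /mstep; field.
  by rewrite pnatr_eq0 -lt0n.
have T6 : 0 <= T / 6 by rewrite divr_ge0 // ltW.
move: h; rewrite ler_norml => /andP[h1 h2].
have := ler_wpM2l T6 h1; have := ler_wpM2l T6 h2; rewrite /err; lra.
Unshelve. all: by end_near. Qed.

Let interp_energy n : (0 < n)%N ->
  energy (fun s w => Yc n s w - Yl n s w) = (mstep T n ^+ 2 / 6 * \sum_(j < n) trunc_norm2 T sigma n (M n) j)%:E.
Proof. by move=> n0; exact: (interpolation_error x0 sigma nW cW mW T0 ha (M n) n0). Qed.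

Let young (e x y : R) : 0 < e -> (x + y) ^+ 2 <= (1 + e) * x ^+ 2 + (1 + e^-1) * y ^+ 2.
Proof.
move=> e0; have : 0 <= e^-1 * (e * x - y) ^+ 2 by apply: mulr_ge0; [rewrite invr_ge0 ltW|exact: sqr_ge0].
rewrite (_ : e^-1 * (e * x - y) ^+ 2 = e * x ^+ 2 - 2 * x * y + e^-1 * y ^+ 2); last first.
  by field; rewrite gt_eqF.
lra.
Qed.

Let jYc n : (0 < n)%N -> jmeas (Yc n).
Proof. by move=> n0; exact: (jmeas_euler_cont x0 sigma nW cW mW T0 ha (M n) n0). Qed.

Let jYl n : (0 < n)%N -> jmeas (Yl n).
Proof. by move=> n0; exact: (jmeas_euler_interp x0 sigma nW T0 ha (M n) n0). Qed.

Let jX : jmeas X. Proof. exact: jmeas_continuous. Qed.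

Let energy_split n (e : R) : (0 < n)%N -> 0 < e ->
  (energy (fun s w => X s w - Yl n s w) <=
   (1 + e)%:E * energy (fun s w => Yc n s w - Yl n s w) +
   (1 + e^-1)%:E * energy (fun s w => X s w - Yc n s w))%E /\
  (energy (fun s w => Yc n s w - Yl n s w) <=
   (1 + e)%:E * energy (fun s w => X s w - Yl n s w) +
   (1 + e^-1)%:E * energy (fun s w => X s w - Yc n s w))%E.
Proof.
move=> n0 e0.
have e1 : 0 <= 1 + e by rewrite addr_ge0 // ltW.
have e2 : 0 <= 1 + e^-1 by rewrite addr_ge0 // invr_ge0 ltW.
have j1 : jmeas (fun s w => X s w - Yl n s w) by apply: jmeasB => //; exact: jYl.
have j2 : jmeas (fun s w => Yc n s w - Yl n s w) by apply: jmeasB; [exact: jYc|exact: jYl].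
have j3 : jmeas (fun s w => X s w - Yc n s w) by apply: jmeasB => //; exact: jYc.
split; apply: energy_combination => // s w.
  rewrite (_ : X s w - Yl n s w = (Yc n s w - Yl n s w) + (X s w - Yc n s w)); last by ring.
  exact: young.
rewrite (_ : Yc n s w - Yl n s w = (X s w - Yl n s w) + (- (X s w - Yc n s w))); last by ring.
by rewrite -[in X in _ <= X](sqrrN (X s w - Yc n s w)); exact: young.
Qed.

Lemma energy_fin n : (0 < n)%N -> energy (fun s w => X s w - Yl n s w) \is a fin_num.
Proof.
move=> n0; rewrite ge0_fin_numE; last exact: energy_ge0.
have [h _] := energy_split n0 ltr01; apply: le_lt_trans h _.
by rewrite interp_energy // -(fineK (euler_energy_fin n0)) -!EFinM -EFinD ltry.
Qed.

Lemma energy_rate_cvg :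
  n%:R * fine (energy (fun s w => X s w - Yl n s w)) @[n --> \oo] -->
  T / 6 * \int[mu]_(s in `[0, T]) (snorm sigma s ^+ 2).
Proof.
apply: (@two_sided_young_cvg _ _ interp_rate euler_rate).
- move=> n; apply: mulr_ge0 => //; apply: mulr_ge0; first by rewrite divr_ge0 // ?sqr_ge0.
  by apply: sumr_ge0 => j _; apply: sumr_ge0 => k _; exact: sqr_ge0.
- by move=> n; rewrite mulr_ge0 // fine_ge0 // energy_ge0.
- move=> n e n0 e0; have [h _] := energy_split n0 e0.
  rewrite /interp_rate /euler_rate [X in _ <= X + _]mulrCA [X in _ <= _ + X]mulrCA -mulrDr.
  rewrite ler_wpM2l // -lee_fin fineK ?energy_fin //; move: h.
  by rewrite interp_energy // -(fineK (euler_energy_fin n0)) -!EFinM -EFinD.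
- move=> n e n0 e0; have [_ h] := energy_split n0 e0.
  rewrite /interp_rate /euler_rate [X in _ <= X + _]mulrCA [X in _ <= _ + X]mulrCA -mulrDr.
  rewrite ler_wpM2l // -lee_fin; move: h.
  by rewrite interp_energy // -(fineK (euler_energy_fin n0)) -(fineK (energy_fin n0)) -!EFinM -EFinD.
- exact: interp_rate_cvg.
- exact: euler_rate_cvg.
Qed.

End continuous_case.

(** * Transfer to the given processes *)

Section modification.
Context d (Omega : measurableType d) (R : realType) (P : probability Omega R).
Variables (F : R -> set (set Omega)) (W : nat -> R -> Omega -> R).
Variables (T x0 : R) (a : R -> R -> R) (sigma : R -> nat -> R) (X : R -> Omega -> R).
Hypothesis T0 : 0 < T.
Hypothesis hF : filtration_usual P F.
Hypothesis hW : forall k, wiener_process P F (W k).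
Hypothesis hI : independent_processes P W.
Hypothesis hX : sde_solution P F W T x0 a sigma X.

(** The exceptional null set belongs to every sigma-algebra of the filtration, so
    the modified processes stay adapted. *)
Lemma continuous_modification : exists (W' : nat -> R -> Omega -> R) (X' : R -> Omega -> R),
  [/\ noise P F W', forall k w, continuous (fun t => W' k t w),
      forall k t, measurable_fun setT (W' k t) &
   [/\ forall w, continuous (X'^~ w), forall t, measurable_fun setT (X' t),
      forall t, t \in `[0, T] -> exists2 I, is_stoch_integral_seq P W' sigma t I &
        {ae P, forall w, X' t w = x0 + \int[@lebesgue_measure R]_(s in `[0, t]) a s (X' s w) + I w} &
      {ae P, forall w, (forall k t, 0 <= t -> W' k t w = W k t w) /\
                       (forall t, t \in `[0, T] -> X' t w = X t w)}]].
Proof.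
have nW := wiener_noise hF hW hI.
have : {ae P, forall w, (forall k, {within `[0, +oo[, continuous (W k ^~ w)}) /\
                        {within `[0, T], continuous (X^~ w)}}.
  apply: filterS2 (ae_foralln (fun k => wiener_continuous (hW k))) (sde_continuous hX).
  by move=> w h1 h2; split.
move=> [N [mN PN0 subN]].
have good w : (~` N) w -> (forall k, {within `[0, +oo[, continuous (W k ^~ w)}) /\
    {within `[0, T], continuous (X^~ w)}.
  by move=> Nw; apply: contrapT => bad; apply: Nw; exact: subN.
pose chi : Omega -> R := \1_(~` N).
pose W' k t w := chi w * W k (Num.max t 0) w.
pose X' t w := chi w * X (clamp T t) w.
have chi1 w : (~` N) w -> chi w = 1 by move=> h; rewrite /chi indicE mem_set.
have chi0 w : ~ (~` N) w -> chi w = 0 by move=> h; rewrite /chi indicE memNset.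
have nN : P.-negligible N by exists N; split.
have aeN : {ae P, forall w, (~` N) w} by exists N; split=> // w /contrapT.
have EW w k t : (~` N) w -> 0 <= t -> W' k t w = W k t w.
  by move=> wN t0; rewrite /W' chi1 // mul1r max_l.
have EX w t : (~` N) w -> t \in `[0, T] -> X' t w = X t w.
  by move=> wN tT; rewrite /X' chi1 // mul1r clampE.
have fchi t : 0 <= t -> fmeas (F t) chi.
  move=> t0; apply: measurable_indic; apply: sub_sigma_algebra.
  have := filtration_sigma hF t0 => -[_ sC _].
  rewrite -setTD; apply: sC.
  apply: (filtration_mono hF (lexx 0) t0); exact: (filtration_null hF).
have mchi : measurable_fun setT chi by apply: measurable_indic; exact: measurableC.
have fW k t : 0 <= t -> fmeas (F t) (W' k t).
  move=> t0; apply: fmeasM; first exact: fchi.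
  by rewrite max_l //; exact: (noise_adapted nW).
have mW k t : 0 <= t -> measurable_fun setT (W k t).
  by move=> t0; apply: (noise_sub nW t0); exact: (noise_adapted nW).
have m0 (t : R) : 0 <= Num.max t 0 by rewrite le_max lexx orbT.
have mW' k t : measurable_fun setT (W' k t).
  by apply: measurable_funM => //; exact: mW.
have WW' k t : 0 <= t -> {ae P, forall w, W' k t w = W k t w}.
  by move=> t0; apply: filterS aeN => w wN; exact: EW.
exists W', X'; split=> //.
- apply: (noise_ae nW fW) => k t t0.
  by apply: filterS (WW' k t t0) => w -> _.
- move=> k w; have [wN|wN] := pselect ((~` N) w); last first.
    by under eq_fun do rewrite /W' chi0 // mul0r; move=> t; exact: cvg_cst.
  have -> : (fun t => W' k t w) = (fun t => W k (Num.max t 0) w).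
    by apply/funext => t; rewrite /W' chi1 // mul1r.
  have cm : continuous (fun t : R => Num.max t 0 : R).
    by move=> t; apply: (@continuous_max _ _ id (fun=> 0)); [exact: cvg_id|exact: cvg_cst].
  have Dm (t : R) : (`[0, +oo[%classic : set R) (Num.max t 0) by rewrite /= in_itv /= m0.
  have [cWk _] := good w wN.
  exact: (continuous_within_comp cm Dm (cWk k)).
split=> //.
- move=> w; have [wN|wN] := pselect ((~` N) w); last first.
    by under eq_fun do rewrite /X' chi0 // mul0r; move=> t; exact: cvg_cst.
  have -> : X'^~ w = (fun t => X (clamp T t) w).
    by apply/funext => t; rewrite /X' chi1 // mul1r.
  apply: (@continuous_within_comp _ _ _ (`[0, T]%classic) (X ^~ w) (clamp T)).
  + exact: continuous_clamp.
  + by move=> t; exact: clamp_in.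
  + by case: (good w wN).
- move=> t; apply: measurable_funM => //.
  have ct := clamp_in T0 t; have c0 := clamp_ge0 T0 t.
  apply: (fmeas_sub (filtration_sub hF c0)); apply: fmeasP; first exact: (filtration_sigma hF).
  exact: (sde_adapted hX).
- move=> t tT; have [I hI' eI] := sde_equation hX tT; exists I.
    by apply: (stoch_integral_seq_ae mW _ WW' hI') => k u _; exact: mW'.
  apply: filterS2 aeN eI => w wN e; rewrite EX // e; congr (_ + _ + _).
  apply: eq_Rintegral => s; rewrite inE /= in_itv /= => /andP[s0 st].
  rewrite EX // in_itv /= s0; move: tT; rewrite in_itv /= => /andP[_ tT].
  exact: le_trans st tT.
- by apply: filterS aeN => w wN; split=> *; [exact: EW|exact: EX].
Qed.

Lemma euler_eq (V V' : nat -> R -> Omega -> R) w m n j :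
  (forall k t, 0 <= t -> V' k t w = V k t w) ->
  (0 < n)%N -> euler T x0 a sigma V' m n j w = euler T x0 a sigma V m n j w.
Proof.
move=> e n0; elim: j => //= j ->; congr (_ + _); apply: eq_bigr => k _.
by rewrite !e // mesh_ge0.
Qed.

(** Completeness makes the error of the given processes measurable, as it agrees almost
   surely with that of their modifications. *)
Lemma dist2_ae (V : nat -> R -> Omega -> R) (Z : R -> Omega -> R) m n :
  measure_is_complete P -> (0 < n)%N ->
  {ae P, forall w, (forall k t, 0 <= t -> V k t w = W k t w) /\
                   (forall t, t \in `[0, T] -> Z t w = X t w)} ->
  jmeas (fun s w => Z s w - euler_interp T x0 a sigma V m n s w) ->
  dist2 P T X (euler_interp T x0 a sigma W m n) =
  sqrte (\int[P]_w \int[@lebesgue_measure R]_(s in `[0%R, T])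
    ((Z s w - euler_interp T x0 a sigma V m n s w) ^+ 2)%:E)%E.
Proof.
move=> cP n0 eVZ jZ; rewrite /dist2; congr sqrte.
pose f w := (\int[@lebesgue_measure R]_(s in `[0%R, T])
    ((Z s w - euler_interp T x0 a sigma V m n s w) ^+ 2)%:E)%E.
pose g w := (\int[@lebesgue_measure R]_(s in `[0%R, T])
    (`|X s w - euler_interp T x0 a sigma W m n s w| ^+ 2)%:E)%E.
have mf : measurable_fun setT f.
  by apply: measurable_ge0_integral_time => [|s w]; [exact: jmeasX|exact: sqr_ge0].
have fg : ae_eq P setT f g.
  apply: filterS eVZ => w [eV eZ] _; apply: eq_integral => s; rewrite inE /= => sT.
  by rewrite real_normK ?num_real // /euler_interp -!(euler_eq _ _ eV n0) eZ.
have mg := ae_measurable_fun cP fg mf.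
by rewrite -[LHS]/(\int[P]_w g w)%E -[RHS]/(\int[P]_w f w)%E; apply/esym; apply: ae_eq_integral.
Qed.

End modification.

(** * The energy of the diffusion and the limit *)

Section diffusion_energy.
Variables (R : realType) (T C2 : R) (delta : nat -> R) (sigma : R -> nat -> R).
Hypothesis T0 : 0 < T.
Hypothesis C20 : 0 < C2.
Hypothesis hs : diffusion_conditions T C2 delta sigma.
Notation mu := (@lebesgue_measure R).

Lemma integral_l2norm2 :
  (\int[mu]_(t in `[0%R, T]) (l2norm (sigma t) ^+ 2) =
   (\int[mu]_(t in `[0, T]) snorm sigma t ^+ 2)%R%:E)%E.
Proof.
rewrite /Rintegral fineK; last by apply: integrable_fin_num => //; exact: integrable_snorm2 C20 hs.
apply: eq_integral => t; rewrite inE /= => tT.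
by rewrite (snormE hs tT) EFin_expe.
Qed.

(** By the Lipschitz condition the norm stays above half its value at [t0] on an
   interval of positive length. *)
Lemma snorm_energy_gt0 (t0 : R) k : t0 \in `[0, T] -> sigma t0 k != 0 ->
  0 < \int[mu]_(t in `[0, T]) snorm sigma t ^+ 2.
Proof.
move=> tT sk.
have s0 : 0 < snorm sigma t0.
  rewrite lt0r snorm_ge0 andbT; apply/eqP => s0.
  have := @l2norm_sum_le _ (sigma t0) (snorm sigma t0) k.+1.
  rewrite (snormE hs tT) lexx big_ord_recr /= s0 expr0n /= => /(_ isT) h.
  have p1 : 0 <= \sum_(i < k) sigma t0 i ^+ 2 by apply: sumr_ge0 => i _; exact: sqr_ge0.
  have p2 : 0 < sigma t0 k ^+ 2 by rewrite lt0r sqr_ge0 sqrf_eq0 sk.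
  by move: h; lra.
pose m := snorm sigma t0 / 2; pose rho := m / C2.
have m0 : 0 < m by rewrite divr_gt0.
have r0 : 0 < rho by rewrite divr_gt0.
pose l := Num.max 0 (t0 - rho); pose r := Num.min T (t0 + rho).
have [t00 t0T] : 0 <= t0 /\ t0 <= T by move: tT; rewrite in_itv /= => /andP[].
have lr : l < r.
  have e1 : t0 - rho < T by lra.
  have e2 : 0 < t0 + rho by lra.
  have e3 : t0 - rho < t0 + rho by lra.
  by rewrite lt_min !gt_max T0 e1 e2 e3.
have sub : `[l, r]%classic `<=` (`[0, T]%classic : set R).
  move=> x /=; rewrite !in_itv /= ge_max le_min => /andP[/andP[-> _] /andP[-> _]] //.
have ms : measurable_fun `[0, T] (fun s : measurableTypeR R => (snorm sigma s ^+ 2)%:E).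
  exact: measurable_int (integrable_snorm2 T0 C20 hs).
rewrite -lte_fin -integral_l2norm2.
rewrite (eq_integral (fun s : measurableTypeR R => (snorm sigma s ^+ 2)%:E)); last first.
  by move=> t; rewrite inE /= => tT'; rewrite (snormE hs tT') EFin_expe.
have mlr : measurable (`[l, r] : set (measurableTypeR R)) by exact: measurable_itv.
apply: (@lt_le_trans _ _ (\int[mu]_(s in `[l, r]) (m ^+ 2)%:E)%E).
  rewrite integral_cst // [X in (_ < _ * X)%E](lebesgue_measure_itv (`[l, r] : interval R)) /= lte_fin lr.
  by rewrite -EFinB -EFinM lte_fin mulr_gt0 ?exprn_gt0 // subr_gt0.
apply: (@le_trans _ _ (\int[mu]_(s in `[l, r]) (snorm sigma s ^+ 2)%:E)%E).
  apply: ge0_le_integral => //.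
  - by move=> s _; rewrite lee_fin sqr_ge0.
  - by apply: measurable_funS ms.
  - move=> s lrs; rewrite lee_fin lerXn2r ?nnegrE ?snorm_ge0 // ?(ltW m0) //.
    have sT := sub _ lrs.
    have := snorm_lip hs tT sT; move: lrs; rewrite /= in_itv /= ge_max le_min => /andP[/andP[_ h1] /andP[_ h2]].
    have h3 : C2 * `|s - t0| <= m.
      by rewrite mulrC -ler_pdivlMr // ler_norml -/rho; apply/andP; split; lra.
    rewrite ler_norml; move: h3; rewrite /m; lra.
by apply: ge0_subset_integral => // s _; rewrite lee_fin sqr_ge0.
Qed.

End diffusion_energy.

Theorem mainTheorem4 (R : realType) (d : measure_display)
  (Omega : measurableType d) (P : probability Omega R)
  (F : R -> set (set Omega)) (W : nat -> R -> Omega -> R)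
  (T x0 C1 C2 : R) (delta : nat -> R) (a : R -> R -> R)
  (sigma : R -> nat -> R) (X : R -> Omega -> R) (M : nat -> nat) :
  0 < T -> 0 < C1 -> 0 < C2 ->
  measure_is_complete P ->
  filtration_usual P F ->
  (forall k, wiener_process P F (W k)) ->
  independent_processes P W ->
  delta_seq delta ->
  drift_conditions T C1 a ->
  diffusion_conditions T C2 delta sigma ->
  sde_solution P F W T x0 a sigma X ->
  G_class delta M ->
  asymp_equiv
    (fun n => (Num.sqrt (cost T sigma (M n) n))%:E
              * dist2 P T X (euler_interp T x0 a sigma W (M n) n))%E
    (fun n => (Num.sqrt ((M n)%:R * T / 6))%:E
              * sqrte (\int[lebesgue_measure]_(t in `[0%R, T])
                         (l2norm (sigma t) ^+ 2)))%E.
Proof.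
move=> T0 C10 C20 cP hF hW hI hd ha hs hX hM; rewrite /asymp_equiv /cost.
case: asboolP => [sigma0|sigma1].
  (* both sides vanish for every [n], and the quotient is 1 by convention *)
  have i0 : (\int[@lebesgue_measure R]_(t in `[0%R, T]) (l2norm (sigma t) ^+ 2) = 0)%E.
    apply: integral0_eq => t /= tT.
    rewrite (_ : sigma t = fun=> 0); first by rewrite /l2norm Lnorm0 ?expe2 ?mule0.
    by apply/funext => k; exact: sigma0.
  rewrite i0 sqrte0 sqrtr0; under eq_fun do rewrite mul0e mule0 eqxx /=.
  exact: cvg_cst.
have [t0 [k [t0T sk]]] : exists t0 k, t0 \in `[0, T] /\ sigma t0 k != 0.
  apply: contrapT => h; apply: sigma1 => t k tT; apply: contrapT => /eqP sk.
  by apply: h; exists t, k.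
have L0 := snorm_energy_gt0 T0 C20 hs t0T sk.
rewrite (integral_l2norm2 T0 C20 hs); set L := \int[lebesgue_measure]_(_ in _) _ in L0 *.
have [W' [X' [nW cW mW [cX mX solX eWX]]]] := continuous_modification T0 hF hW hI hX.
pose V n := fine (\int[P]_w \int[@lebesgue_measure R]_(s in `[0%R, T])
  ((X' s w - euler_interp T x0 a sigma W' (M n) n s w) ^+ 2)%:E)%E.
have VL : n%:R * V n @[n --> \oo] --> T / 6 * L.
  exact: (energy_rate_cvg nW cW mW T0 C10 C20 hd ha hs cX mX solX hM).
have V0 n : 0 <= V n by rewrite fine_ge0 // energy_ge0.
have distE n : (0 < n)%N ->
    dist2 P T X (euler_interp T x0 a sigma W (M n) n) = (Num.sqrt (V n))%:E.
  move=> n0; rewrite (dist2_ae T0 cP n0 eWX); last first.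
    apply: jmeasB; first exact: jmeas_continuous.
    exact: (jmeas_euler_interp x0 sigma nW T0 ha (M n) n0).
  by rewrite -(fineK (energy_fin nW cW mW T0 C10 C20 ha hs cX mX solX hM n0)).
have c0 : 0 < T / 6 * L by rewrite mulr_gt0 // divr_gt0.
have lim : (Num.sqrt (n%:R * V n) / Num.sqrt (T / 6 * L))%:E @[n --> \oo] --> 1%:E.
  apply: cvg_EFin; first exact: nearW.
  rewrite [X in _ --> X](_ : _ = Num.sqrt (T / 6 * L) / Num.sqrt (T / 6 * L)); last first.
    by rewrite divff // gt_eqF // sqrtr_gt0.
  apply: cvgM; last exact: cvg_cst.
  exact: (cvg_comp _ _ VL (@sqrt_continuous R _)).
apply: cvg_trans lim; apply: near_eq_cvg; near=> n.
have n0 : (0 < n)%N by near: n; exact: nbhs_infty_gt.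
have Mn : 0 < (M n)%:R :> R by case: hM => h _ _ _; rewrite ltr0n h.
have v0 : 0 < Num.sqrt ((M n)%:R * T / 6) * Num.sqrt L.
  by rewrite mulr_gt0 // sqrtr_gt0 // divr_gt0 // mulr_gt0.
rewrite distE //= -!EFinM [X in _ && X]gt_eqF ?lte_fin // andbF.
rewrite inver gt_eqF // -EFinM; congr EFin.
(* the factor [M n] is common to both sides *)
have T6 : 0 < T / 6 by rewrite divr_gt0.
rewrite natrM -(mulrA (M n)%:R) !sqrtrM ?(ltW T6) ?(ltW Mn) ?(ltW T0) //.
have nz (y : R) : 0 < y -> Num.sqrt y != 0 by move=> y0; rewrite gt_eqF // sqrtr_gt0.
by field; rewrite !nz ?invr_gt0.
Unshelve. all: by end_near. Qed.
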